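(* Let $\mathsf G$ be a weighted graph with a well and let $\mathsf F$ be a Euclidean (real) vector bundle over $\mathsf G$ with an orthogonal connection $h$. Let $\mathrm{End}(\mathsf F)$ be the bundle of endomorphisms of $\mathsf F$, endowed with the connection $h^*\otimes h$ induced from $h$ by conjugation, and let $x\mapsto\Psi_x$ be the associated Gaussian free vector field. Let $\mathcal L$ be a Poisson point process of continuous loops with intensity $\frac12\,\mathrm{Tr}(\mathrm{hol}_h(\gamma))^2\,d\mu(\gamma)$. Then the random field $\left(\frac12\mathrm{Tr}(\Psi_x^*\Psi_x)\right)_{x\in\mathsf V\setminus\mathsf W}$ has the same distribution as the occupation field $(\ell_x(\mathcal L))_{x\in\mathsf V\setminus\mathsf W}$ of $\mathcal L$.
   Context: Graphs. A graph $\mathsf G$ consists of non-empty finite sets $\mathsf V$ (vertices) and $\mathsf E$ (oriented edges), maps $s,t:\mathsf E\to\mathsf V$ and a fixed-point free involution $i$ of $\mathsf E$ with $t\circ i=s$; write $\underline e=s(e)$, $\overline e=t(e)$, $e^{-1}=i(e)$ (multiple edges and loop edges are allowed). A weighted graph with a well is a connected graph with a non-empty proper subset $\mathsf W\subset \mathsf V$ (the well; elements of $\mathsf V\setminus\mathsf W$ are the proper vertices) and a function $\chi:\mathsf E\to(0,\infty)$ with $\chi_{e^{-1}}=\chi_e$. Set $\lambda_x=\sum_{e:\underline e=x}\chi_e$ and $P_{x,e}=\chi_e/\lambda_x$ when $\underline e=x$. Paths. A discrete path is $(x_0,e_1,x_1,\dots,e_n,x_n)$, $n\ge0$, with $\underline{e_k}=x_{k-1}$,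 $\overline{e_k}=x_k$. A continuous path is $\gamma=((x_0,\tau_0),e_1,(x_1,\tau_1),\dots,e_n,(x_n,\tau_n))$ with $(x_0,e_1,\dots,x_n)$ a discrete path, $\tau_0,\dots,\tau_{n-1}\in(0,\infty)$, $\tau_n\in(0,\infty]$; it is a continuous loop if $x_n=x_0$ (natural $\sigma$-field: countable union of products of finite sets and intervals). For $0\le t<|\gamma|=\sum_k\tau_k$, $\gamma_t=x_k$ if $\tau_0+\dots+\tau_{k-1}\le t<\tau_0+\dots+\tau_k$, and for $0<t<|\gamma|$, $\gamma_{|[0,t)}=((x_0,\tau_0),e_1,\dots,e_k,(x_k,t-(\tau_0+\dots+\tau_{k-1})))$. The local time of $\gamma$ at $x$ is $\ell_x(\gamma)=\frac1{\lambda_x}\sum_{k:x_k=x}\tau_k$, and for a set $\mathcal L$ of paths $\ell_x(\mathcal L)=\sum_{\gamma\in\mathcal L}\ell_x(\gamma)$. Random walk and loop measure. For $x\in\mathsf V$, $\mathbb P_x$ is the law of the continuous path obtained as follows: start at $x_0=x$; from a proper vertex $x_k$ choose an edge $e_{k+1}$ issued from $x_k$ with probability $P_{x_k,e_{k+1}}$ and move to $\overline{e_{k+1}}$; stop at the first vertex in $\mathsf W$; holding times at the proper vertices visited are independent exponential variables of parameter $1$, and the last holding time (in the well) is $+\infty$. The measure $\mu$ on continuous loops is $\int F\,d\mu=\sum_{x\in\mathsf V\setminus\mathsf W}\int\int_0^\infty F(\gamma_{|[0,t)})\mathbf 1_{\{\gamma_t=x\}}\frac{dt}{t}\,d\mathbb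 P_x(\gamma)$; it is $\sigma$-finite. Bundles. A Euclidean vector bundle of rank $r$ is a collection of $r$-dimensional Euclidean spaces $\mathsf F_x$ ($x\in\mathsf V$), $\mathsf F_e=\mathsf F_{e^{-1}}$ ($e\in\mathsf E$). A connection $h$ consists, for every edge $e$, of isometric isomorphisms $h_{e,\underline e}:\mathsf F_{\underline e}\to\mathsf F_e$ and $h_{\overline e,e}:\mathsf F_e\to\mathsf F_{\overline e}$ with $h_{\underline e,e^{-1}}=h_{e,\underline e}^{-1}$; set $h_e=h_{\overline e,e}\circ h_{e,\underline e}$. The holonomy along $\gamma$ is $\mathrm{hol}_h(\gamma)=h_{e_n}\circ\cdots\circ h_{e_1}$. The bundle $\mathrm{End}(\mathsf F)$ has fibres $\mathrm{End}(\mathsf F_a)$, with scalar product $\langle u,v\rangle=\mathrm{Tr}(u^*v)$, and the connection $h^*\otimes h$ acts by conjugation, so that its holonomy along $\gamma$ from $x$ to $y$ sends $u\in\mathrm{End}(\mathsf F_x)$ to $\mathrm{hol}_h(\gamma)\circ u\circ\mathrm{hol}_h(\gamma)^{-1}\in\mathrm{End}(\mathsf F_y)$. Gaussian free vector field. For a Euclidean bundle $\mathsf B$ with connection $g$, the associated Gaussian free vector field is the centred Gaussian random section of $\mathsf B$ vanishing on $\mathsf W$ whose law has, with respect to Lebesgue measure on the space of such sections, density proportional to $\exp\left(-\frac14\sum_{e\in\mathsf E}\chi_e\|f_{\underline e}-g_e^{-1}f_{\overline e}\|^2\right)$. *)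

(* Defs.v *)
From HB Require Import structures.
From mathcomp Require Import all_boot all_order all_algebra.
From mathcomp Require Import all_classical all_reals all_analysis measurable_realfun.

Set Implicit Arguments.
Unset Strict Implicit.
Unset Printing Implicit Defensive.

Import Order.TTheory GRing.Theory Num.Theory.
Import numFieldNormedType.Exports.

Local Open Scope classical_set_scope.
Local Open Scope ring_scope.

Record espace (R : realType) := ESpace {
  evect :> vectType R;
  edot : {dot evect for idfun} }.
Arguments edot {R} e.

Section trace.
Context {R : realType}.
Implicit Types V W : vectType R.

(* Computed in the basis vbasis; lftraceC (applied to a conjugation) shows that
   the choice of basis does not matter. *)
Definition lftrace V (f : 'End(V)) : R :=
  \sum_(i < \dim {:V}) coord (vbasis {:V}) i (f (vbasis {:V})`_i).

Lemma lftraceC V W (f : 'Hom(W, V)) (g : 'Hom(V, W)) :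
  lftrace (f \o g)%VF = lftrace (g \o f)%VF.
Proof.
rewrite /lftrace.
under eq_bigr => i _ do rewrite comp_lfunE
  [in g _](coord_vbasis (memvf (g (vbasis {:V})`_i))) linear_sum linear_sum.
under [RHS]eq_bigr => i _ do rewrite comp_lfunE
  [in f _](coord_vbasis (memvf (f (vbasis {:W})`_i))) linear_sum linear_sum.
rewrite exchange_big /=; apply: eq_bigr => j _; apply: eq_bigr => i _.
by rewrite !linearZ /= mulrC.
Qed.

Lemma lftraceD V (f g : 'End(V)) : lftrace (f + g) = lftrace f + lftrace g.
Proof.
by rewrite /lftrace -big_split; apply: eq_bigr => i _; rewrite lfunE /= linearD.
Qed.

Lemma lftraceZ V k (f : 'End(V)) : lftrace (k *: f) = k * lftrace f.
Proof.
by rewrite /lftrace mulr_sumr; apply: eq_bigr => i _; rewrite lfunE /= linearZ.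
Qed.

Lemma lftrace_sum V n (f : 'I_n -> 'End(V)) :
  lftrace (\sum_i f i) = \sum_i lftrace (f i).
Proof.
rewrite [RHS](_ : _ = \sum_i \sum_(j < \dim {:V})
  coord (vbasis {:V}) j (f i (vbasis {:V})`_j)) // exchange_big.
by apply: eq_bigr => j _; rewrite sum_lfunE linear_sum.
Qed.

End trace.

Section espace_theory.
Context {R : realType} (V : espace R).
Local Notation "''[' u , v ]" := (edot V u%R v%R) : ring_scope.

Lemma edotC (u v : V) : '[u, v] = '[v, u].
Proof. by rewrite [LHS](hermC (edot V)) expr0 mul1r. Qed.

Lemma edotDl (u v w : V) : '[u + v, w] = '[u, w] + '[v, w].
Proof. exact: linearDl. Qed.
Lemma edotZl k (v w : V) : '[k *: v, w] = k * '[v, w].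
Proof. exact: linearZl_LR. Qed.
Lemma edotDr (w u v : V) : '[w, u + v] = '[w, u] + '[w, v].
Proof. by rewrite edotC edotDl !(edotC w). Qed.
Lemma edotZr k (w v : V) : '[w, k *: v] = k * '[w, v].
Proof. by rewrite edotC edotZl edotC. Qed.
Lemma edot0l (w : V) : '[0, w] = 0.
Proof. by rewrite -(scale0r 0) edotZl mul0r. Qed.
Lemma edot_suml n (f : 'I_n -> V) w : '[\sum_i f i, w] = \sum_i '[f i, w].
Proof.
by apply: (big_morph (fun x => '[x, w])) => [x y|]; rewrite ?edotDl ?edot0l.
Qed.
Lemma edot_gt0 (u : V) : u != 0 -> 0 < '[u, u].
Proof. exact: neq0_dnorm_gt0. Qed.
Lemma edot_ge0 (u : V) : 0 <= '[u, u].
Proof. by have [->|/edot_gt0/ltW//] := eqVneq u 0; rewrite edot0l. Qed.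
Lemma edot_eq0 (u : V) : '[u, u] = 0 -> u = 0.
Proof.
by move=> h; apply/eqP; apply: contra_eqT h => /edot_gt0; rewrite lt0r => /andP[].
Qed.

Lemma edot_inj (u v : V) : (forall w, '[u, w] = '[v, w]) -> u = v.
Proof.
move=> h; apply/eqP; rewrite -subr_eq0; apply/eqP/edot_eq0.
by rewrite edotDl -scaleN1r edotZl h mulN1r subrr.
Qed.

Lemma orthobasis (U : {vspace V}) : exists s : seq V,
  basis_of U s /\ pairwise (fun u v => '[u, v] == 0) s.
Proof.
have [n] := ubnP (\dim U); elim: n U => // n IH U; rewrite ltnS => leUn.
have [->|U0] := eqVneq U 0%VS.
  by exists [::]; rewrite /basis_of span_nil eqxx nil_free.
set u := vpick U.
have u0 : u != 0 by rewrite vpick0.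
have uU : u \in U by rewrite memv_pick.
have uNort : u \notin orthov (edot V) U.
  apply/(mem_orthovPn) ; exists u => //.
  by have := edot_gt0 u0; rewrite lt0r => /andP[].
have dimE := eq_dim_orthov1 uNort.
set U' := (U :&: orthov (edot V) <[u]>)%VS in dimE.
have dU : (0 < \dim U)%N by rewrite lt0n dimv_eq0.
have [|s [bs ps]] := IH U'; first by rewrite -dimE; case: (\dim U) dU leUn.
have sU' x : x \in s -> x \in U' by move/(basis_mem bs).
exists (u :: s); split; last first.
  rewrite /= ps andbT; apply/allP => x /sU'; rewrite memv_cap => /andP[_].
  by rewrite mem_orthov1 edotC.
rewrite basisEfree free_cons (basis_free bs) (span_basis bs) andbT.
apply/and3P; split.
- rewrite memv_cap uU /= mem_orthov1.
  by have := edot_gt0 u0; rewrite lt0r => /andP[].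
- by rewrite span_cons (span_basis bs) subv_add -memvE uU; exact: capvSl.
- suff sE : \dim U' = size s by rewrite /= -sE -dimE prednK.
  by have /andP[/eqP <- /eqP] := bs.
Qed.

Lemma orthobasisT : exists b : (\dim {:V}).-tuple V,
  (forall i, tnth b i != 0) /\
  forall u, u = \sum_i ('[u, tnth b i] / '[tnth b i, tnth b i]) *: tnth b i.
Proof.
have [s [bs ps]] := orthobasis fullv.
have sz : size s == \dim {:V} by have /andP[/eqP sE /eqP] := bs; rewrite sE => ->.
exists (Tuple sz); set b := Tuple sz.
have b0 i : tnth b i != 0.
  by apply: (free_not0 (basis_free bs)); exact: (mem_tnth i b).
have ort i j : i != j -> '[tnth b i, tnth b j] = 0.
  move=> ij; wlog ltij : i j ij / (i < j)%N.
    move=> H; case: (ltngtP i j) => [/H|/H|/val_inj/eqP]; first exact.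
      by rewrite edotC; apply; rewrite eq_sym.
    by rewrite (negPf ij).
  move/(pairwiseP 0): ps => /(_ i j) /[!inE]; rewrite (eqP sz) => /(_ _ _ ltij)/eqP.
  by rewrite -!(tnth_nth 0 b); apply.
split => // u; have bb : basis_of fullv b by exact: bs.
rewrite {1}(coord_basis bb (memvf u)); apply: eq_bigr => i _.
rewrite -(tnth_nth 0); congr (_ *: _).
rewrite [in RHS](coord_basis bb (memvf u)) edot_suml (bigD1 i) //= big1.
  by rewrite addr0 -(tnth_nth 0 b) edotZl mulfK // gt_eqF // edot_gt0.
by move=> j ji; rewrite -(tnth_nth 0 b) edotZl ort // mulr0.
Qed.

Lemma lftrace_rank1 (w v : V) :
  lftrace (linfun (fun u : V => '[u, v] *: w)) = '[w, v].
Proof.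
have lin : linear (fun u : V => '[u, v] *: w).
  by move=> k x y; rewrite edotDl edotZl scalerDl scalerA.
pose L := GRing.isLinear.Build _ _ _ _ _ lin.
pose f : {linear V -> V} := HB.pack (fun u : V => '[u, v] *: w) L.
rewrite /lftrace; under eq_bigr => i _ do
  rewrite (lfunE f) /= linearZ /= mulrC -edotZl.
by rewrite -edot_suml -coord_vbasis ?memvf.
Qed.

End espace_theory.

Section adjoint.
Context {R : realType} (V W : espace R).

Definition adjoint (f : 'Hom(V, W)) : 'Hom(W, V) :=
  xget 0 [set g : 'Hom(W, V) | forall u v, edot W (f u) v = edot V u (g v)].

Lemma adjointP (f : 'Hom(V, W)) u v : edot W (f u) v = edot V u (adjoint f v).
Proof.
rewrite /adjoint; case: xgetP => [g _ /= -> //|].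
have [b [b0 bE]] := orthobasisT V.
have lin : linear (fun v : W => \sum_i
  (edot W v (f (tnth b i)) / edot V (tnth b i) (tnth b i)) *: tnth b i).
  move=> k x y; rewrite scaler_sumr -big_split; apply: eq_bigr => i _ /=.
  by rewrite edotDl edotZl scalerA -scalerDl mulrA -mulrDl.
pose L := GRing.isLinear.Build _ _ _ _ _ lin.
pose g : {linear W -> V} := HB.pack (fun v : W => \sum_i
  (edot W v (f (tnth b i)) / edot V (tnth b i) (tnth b i)) *: tnth b i) L.
move=> /(_ (linfun g)); case=> x y; rewrite lfunE /= (edotC x) edot_suml.
rewrite [in LHS](bE x) linear_sum edot_suml; apply: eq_bigr => i _.
rewrite linearZ edotZl edotZl (edotC (f _)) (edotC x).
by rewrite mulrAC [RHS]mulrAC [edot V _ x * _]mulrC.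
Qed.

End adjoint.

Section end_espace.
Context {R : realType} (V : espace R).

(* <f, g> = Tr(f^* g). *)
Definition end_dot (f g : 'End(V)) : R := lftrace (adjoint f \o g)%VF.

Lemma end_dotE : exists b : (\dim {:V}).-tuple V, (forall i, tnth b i != 0) /\
  (forall u, u = \sum_i (edot V u (tnth b i) / edot V (tnth b i) (tnth b i)) *: tnth b i)
  /\ forall f g, end_dot f g =
  \sum_i edot V (f (tnth b i)) (g (tnth b i)) / edot V (tnth b i) (tnth b i).
Proof.
have [b [b0 bE]] := orthobasisT V; exists b; do 2!split => //.
move=> f g; rewrite /end_dot.
have -> : (adjoint f \o g)%VF = \sum_i (edot V (tnth b i) (tnth b i))^-1 *:
   linfun (fun u : V => edot V u (tnth b i) *: adjoint f (g (tnth b i))).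
  apply/lfunP => u; rewrite comp_lfunE {1}(bE u) !linear_sum sum_lfunE.
  apply: eq_bigr => i _; rewrite !linearZ lfunE /= .
  have lin : linear (fun u : V => edot V u (tnth b i) *: adjoint f (g (tnth b i))).
    by move=> k x y; rewrite edotDl edotZl scalerDl scalerA.
  pose L := GRing.isLinear.Build _ _ _ _ _ lin.
  pose h : {linear V -> V} := HB.pack
    (fun u : V => edot V u (tnth b i) *: adjoint f (g (tnth b i))) L.
  by rewrite (lfunE h) /= scalerA mulrC.
rewrite lftrace_sum; apply: eq_bigr => i _.
by rewrite lftraceZ lftrace_rank1 edotC -adjointP mulrC.
Qed.

Fact end_dot_bilinear : bilinear_for *%R (idfun \; *%R) end_dot.
Proof.
have [b [_ [_ E]]] := end_dotE; split=> [f|f] k x y; rewrite !E.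
  rewrite /= mulr_sumr -big_split; apply: eq_bigr => i _ /=.
  by rewrite !lfunE /= !lfunE /= edotDl edotZl mulrDl mulrA.
rewrite /= mulr_sumr -big_split; apply: eq_bigr => i _ /=.
by rewrite !lfunE /= !lfunE /= edotDr edotZr mulrDl mulrA.
Qed.

Fact end_dot_sym f g : end_dot f g = (-1) ^+ false * idfun (end_dot g f).
Proof.
have [b [_ [_ E]]] := end_dotE; rewrite mul1r !E.
by apply: eq_bigr => i _; rewrite edotC.
Qed.

Fact end_dot_pos f : f != 0 -> 0 < end_dot f f.
Proof.
have [b [b0 [bE E]]] := end_dotE; move=> f0; rewrite lt0r.
have ge0 i : 0 <= edot V (f (tnth b i)) (f (tnth b i)) /
  edot V (tnth b i) (tnth b i) by rewrite divr_ge0 ?edot_ge0.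
rewrite E sumr_ge0 // andbT; apply: contra f0; rewrite psumr_eq0 // => /allP h.
apply/eqP/lfunP => u; rewrite (bE u) linear_sum lfunE /= big1 // => i _.
have := h i (mem_index_enum _); rewrite /= mulf_eq0 invr_eq0.
rewrite (gt_eqF (edot_gt0 (b0 i))) orbF => /eqP/edot_eq0 e.
by rewrite linearZ /= e scaler0.
Qed.

HB.instance Definition _ :=
  @bilinear_isBilinear.Build R 'End(V) 'End(V) R _ _ end_dot end_dot_bilinear.
HB.instance Definition _ :=
  @isHermitianSesquilinear.Build R 'End(V) false idfun end_dot end_dot_sym.
HB.instance Definition _ := @isDotProduct.Build R 'End(V) end_dot end_dot_pos.

Definition end_space : espace R := @ESpace R 'End(V) end_dot.

End end_espace.

Section tuple_measure.
Context d (T : measurableType d) (R : realType).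
Variable m : {sigma_finite_measure set T -> \bar R}.

Definition tcons n (p : T * n.-tuple T) : n.+1.-tuple T := [tuple of p.1 :: p.2].

Lemma measurable_tcons n : measurable_fun [set: T * n.-tuple T] (@tcons n).
Proof. exact: measurable_cons. Qed.

Definition tcons_measure n (mu : {sigma_finite_measure set (n.-tuple T) -> \bar R}) :
  set (n.+1.-tuple T) -> \bar R := pushforward (m \x mu)%E (@tcons n).

HB.instance Definition _ n mu := Measure.copy (@tcons_measure n mu)
  (measure_function_pushforward__canonical__measure_function_Measure
    (m \x mu)%E (@measurable_tcons n)).

Fact tcons_measure_sigma_finite n mu : sigma_finite setT (@tcons_measure n mu).
Proof.
have /sigma_finiteP[F [TF ndF Foo]] := sigma_finiteT m.
have /sigma_finiteP[G [TG ndG Goo]] := sigma_finiteT mu.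
exists (fun k => [set t | F k (thead t) /\ G k [tuple of behead t]]).
  apply/seteqP; split=> // t _; have: setT (thead t) by [].
  have: setT [tuple of behead t] by []; rewrite TF TG => -[j _ Gj] [i _ Fi].
  exists (maxn i j) => //; split.
    by move: (thead t) Fi; exact/subsetPset/ndF/leq_maxl.
  by move: [tuple of behead t] Gj; exact/subsetPset/ndG/leq_maxr.
move=> k; have [mF Fk] := Foo k; have [mG Gk] := Goo k; split.
  apply: measurableI.
    by rewrite -[X in measurable X]setTI; apply: (measurable_tnth ord0).
  by rewrite -[X in measurable X]setTI; apply: measurable_behead.
rewrite [X in (X < _)%E](_ : _ = (m \x mu)%E (F k `*` G k)).
  by rewrite product_measure1E// lte_mul_pinfty// ge0_fin_numE.
congr product_measure1; apply/seteqP.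
have bK (x : T) (t : n.-tuple T) : [tuple of behead (tcons (x, t))] = t.
  exact: val_inj.
by split=> -[x t]; rewrite /= bK theadE.
Qed.

HB.instance Definition _ n mu :=
  Measure_isSigmaFinite.Build _ _ _ (@tcons_measure n mu)
    (@tcons_measure_sigma_finite n mu).

(* The n-fold product measure m x ... x m on n-tuples, the 0-fold product being
   the unit mass at the empty tuple. *)
Fixpoint tuple_measure n : {sigma_finite_measure set (n.-tuple T) -> \bar R} :=
  if n is n'.+1 then tcons_measure (tuple_measure n') else dirac [tuple].

End tuple_measure.

Section isometries.
Context {R : realType}.
Implicit Types U V W : espace R.

Definition isometric_iso V W (f : 'Hom(V, W)) : Prop :=
  bijective f /\ isometry (edot W) (edot V) f.

(* u |-> f u f^-1; inv_lfun is the two-sided inverse when f is bijective. *)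
Definition conjugation V W (f : 'Hom(V, W)) :
    'Hom(end_space V, end_space W) :=
  linfun (fun u : 'End(V) => (f \o u \o f^-1)%VF).

(* Transport along an equality of Euclidean spaces.  It is needed because
   F_e = F_(e^-1) and t(e^-1) = s(e) are propositional equalities only. *)
Definition espace_cast V W (eVW : V = W) : 'Hom(V, W) :=
  match eVW in _ = W' return 'Hom(V, W') with erefl => \1%VF end.

Lemma bij_lfunK V W (f : 'Hom(V, W)) : bijective f ->
  cancel f (f^-1)%VF /\ cancel (f^-1)%VF f.
Proof.
move=> [g fK gK]; have fV : cancel f (f^-1)%VF.
  by apply: lker0_lfunK; apply/lker0P; exact: can_inj fK.
by split=> // w; rewrite -{1}(gK w) fV gK.
Qed.

Lemma bij_lfunV V W (f : 'Hom(V, W)) : bijective f -> bijective (f^-1)%VF.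
Proof. by move=> /bij_lfunK[fK Kf]; exists f. Qed.

Lemma lfunV_eq V W (f : 'Hom(V, W)) (g : 'Hom(W, V)) :
  cancel f g -> cancel g f -> (f^-1)%VF = g.
Proof.
move=> fK gK; have [fVK _] := bij_lfunK (Bijective fK gK).
by apply/lfunP => w; rewrite -{1}(gK w) fVK.
Qed.

Lemma lfunV1 V : (\1^-1)%VF = \1%VF :> 'End(V).
Proof. by apply: lfunV_eq => x; rewrite !id_lfunE. Qed.

Lemma conjugationE V W (f : 'Hom(V, W)) (u : 'End(V)) :
  conjugation f u = (f \o u \o f^-1)%VF.
Proof.
have lin : linear (fun u : 'End(V) => (f \o u \o f^-1)%VF).
  by move=> k x y; rewrite comp_lfunDr comp_lfunDl -comp_lfunZr -comp_lfunZl.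
pose L := GRing.isLinear.Build _ _ _ _ _ lin.
pose g : {linear 'End(V) -> 'End(W)} :=
  HB.pack (fun u : 'End(V) => (f \o u \o f^-1)%VF) L.
exact: (lfunE g).
Qed.

Lemma conjugation1 V : conjugation (\1%VF : 'End(V)) = \1%VF.
Proof.
apply/lfunP => u.
by rewrite conjugationE lfunV1 comp_lfun1l comp_lfun1r id_lfunE.
Qed.

Lemma conjugation_comp U V W (f : 'Hom(V, W)) (g : 'Hom(U, V)) :
  bijective f -> bijective g ->
  conjugation (f \o g)%VF = (conjugation f \o conjugation g)%VF.
Proof.
move=> /bij_lfunK[fK Kf] /bij_lfunK[gK Kg].
have e : ((f \o g)^-1 = g^-1 \o f^-1)%VF.
  by apply: lfunV_eq => x; rewrite !comp_lfunE ?fK ?gK ?Kg ?Kf.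
by apply/lfunP => u; rewrite comp_lfunE !conjugationE e !comp_lfunA.
Qed.

Lemma conjugationV V W (f : 'Hom(V, W)) : bijective f ->
  cancel (conjugation f) (conjugation f^-1) /\
  cancel (conjugation f^-1) (conjugation f).
Proof.
move=> fb; have [fK Kf] := bij_lfunK fb; have fVb := bij_lfunV fb.
split=> u; rewrite -comp_lfunE -conjugation_comp //.
  rewrite (_ : (f^-1 \o f)%VF = \1%VF) ?conjugation1 ?id_lfunE //.
  by apply/lfunP => x; rewrite comp_lfunE fK id_lfunE.
rewrite (_ : (f \o f^-1)%VF = \1%VF) ?conjugation1 ?id_lfunE //.
by apply/lfunP => x; rewrite comp_lfunE Kf id_lfunE.
Qed.

Lemma conjugation_iso V W (f : 'Hom(V, W)) :
  isometric_iso f -> isometric_iso (conjugation f).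
Proof.
move=> [fb fi]; have [fK Kf] := bij_lfunK fb; split.
  by have [cK Kc] := conjugationV fb; exists (conjugation f^-1).
move=> u v; rewrite /= /end_dot !conjugationE.
have -> : adjoint (f \o u \o f^-1)%VF = (f \o adjoint u \o f^-1)%VF :> 'End(W).
  apply/lfunP => x; apply: edot_inj => w; rewrite edotC -adjointP !comp_lfunE.
  have fl a b : edot W (f a) b = edot V a ((f^-1)%VF b) by rewrite -{1}(Kf b) fi.
  by rewrite [RHS]fl fl [RHS]edotC -adjointP.
transitivity (lftrace (f \o ((adjoint u \o v) \o f^-1))%VF).
  by congr lftrace; apply/lfunP => x; rewrite !comp_lfunE fK.
rewrite [LHS]lftraceC; congr lftrace.
by apply/lfunP => x; rewrite !comp_lfunE !fK.
Qed.

Lemma espace_cast_bij V W (e : V = W) : bijective (espace_cast e).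
Proof. by case: W / e; exists id => x /=; rewrite id_lfunE. Qed.

Lemma espace_cast_end (T : Type) (F : T -> espace R) x y (e : x = y) :
  espace_cast (congr1 (fun z => end_space (F z)) e) =
  conjugation (espace_cast (congr1 F e)).
Proof. by case: y / e; rewrite /= conjugation1. Qed.

Lemma espace_cast_endV V W (e : V = W) :
  espace_cast (esym (congr1 (@end_space R) e)) =
  conjugation (espace_cast (esym e)).
Proof. by case: W / e; rewrite /= conjugation1. Qed.

End isometries.

(* edge is the set of oriented edges and einv the reversal of orientation;
   multiple edges and loop edges are allowed. *)
Record graph := Graph {
  vertex : finType;
  edge : finType;
  vertex_gt0 : (0 < #|vertex|)%N;
  edge_gt0 : (0 < #|edge|)%N;
  src : edge -> vertex;
  tgt : edge -> vertex;
  einv : edge -> edge;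
  einvK : involutive einv;
  einv_neq : forall e, einv e != e;
  tgt_einv : forall e, tgt (einv e) = src e }.

Definition adjacent (G : graph) : rel (vertex G) :=
  [rel x y | [exists e : edge G, (src e == x) && (tgt e == y)]].

Record wgraph (R : realType) := WGraph {
  wgraph_graph :> graph;
  wgraph_connected : forall x y, connect (@adjacent wgraph_graph) x y;
  well : {set vertex wgraph_graph};
  well_n0 : well != finset.set0;
  well_proper : well \proper [set: vertex wgraph_graph];
  cond : edge wgraph_graph -> R;
  cond_gt0 : forall e, 0 < cond e;
  cond_einv : forall e, cond (einv e) = cond e }.

Section bundles.
Context {R : realType} (G : graph) (r : nat).

Record bundle := Bundle {
  fibv :> vertex G -> espace R;
  fibe : edge G -> espace R;
  fibe_einv : forall e, fibe (einv e) = fibe e;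
  dim_fibv : forall x, \dim {:fibv x} = r;
  dim_fibe : forall e, \dim {:fibe e} = r }.

(* conn_in e : F_(s e) -> F_e and conn_out e : F_e -> F_(t e).  The field
   conn_einv says that conn_out (e^-1) : F_(e^-1) -> F_(t(e^-1)) is the inverse of
   conn_in e, modulo F_(e^-1) = F_e and t(e^-1) = s(e). *)
Record connection (B : bundle) := Connection {
  conn_in : forall e, 'Hom(B (src e), fibe B e);
  conn_out : forall e, 'Hom(fibe B e, B (tgt e));
  conn_in_iso : forall e, isometric_iso (conn_in e);
  conn_out_iso : forall e, isometric_iso (conn_out e);
  conn_einv : forall e,
    (espace_cast (congr1 (fibv B) (tgt_einv e)) \o conn_out (einv e)
       \o espace_cast (esym (fibe_einv B e)))%VF = ((conn_in e)^-1)%VF }.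

(* The isometry h_e : F_(s e) -> F_(t e). *)
Definition transport B (h : connection B) e : 'Hom(B (src e), B (tgt e)) :=
  (conn_out h e \o conn_in h e)%VF.

(* The identity of F_x if x = y, and 0 otherwise: this lets the holonomy be
   defined on arbitrary edge sequences. *)
Definition vertex_cast (B : bundle) x y : 'Hom(B x, B y) :=
  if x =P y is ReflectT exy then espace_cast (congr1 (fibv B) exy) else 0.

(* h_(e_n) o ... o h_(e_1) when es = [e_1; ...; e_n] is a walk from x to y, and 0
   otherwise. *)
Fixpoint holonomy B (h : connection B) x (es : seq (edge G)) y :
    'Hom(B x, B y) :=
  if es is e :: es' then
    (holonomy h (tgt e) es' y \o (transport h e \o vertex_cast B x (src e)))%VF
  else vertex_cast B x y.

End bundles.
Arguments bundle : clear implicits.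

Section end_bundle.
Context {R : realType} {G : graph} {r : nat} (B : bundle R G r).

Fact dim_end (V : espace R) : \dim {:V} = r -> \dim {:end_space V} = (r * r)%N.
Proof. by rewrite !dimvf => <-. Qed.

Definition end_bundle : bundle R G (r * r) := {|
  fibv := fun x => end_space (B x);
  fibe := fun e => end_space (fibe B e);
  fibe_einv := fun e => congr1 (@end_space R) (fibe_einv B e);
  dim_fibv := fun x => dim_end (dim_fibv B x);
  dim_fibe := fun e => dim_end (dim_fibe B e) |}.

Variable h : connection B.

Fact end_conn_einv e :
  (espace_cast (congr1 (fibv end_bundle) (tgt_einv e))
     \o conjugation (conn_out h (einv e))
     \o espace_cast (esym (fibe_einv end_bundle e)))%VF
  = ((conjugation (conn_in h e))^-1)%VF.
Proof.
have inb := (conn_in_iso h e).1; have outb := (conn_out_iso h (einv e)).1.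
rewrite (espace_cast_end (fibv B) (tgt_einv e) : espace_cast _ = _).
rewrite (espace_cast_endV (fibe_einv B e) : espace_cast _ = _).
rewrite -!conjugation_comp //; do ?exact: espace_cast_bij; last first.
  have [f' fK Kf] := espace_cast_bij (congr1 (fibv B) (tgt_einv e)).
  have [g' gK Kg] := outb.
  by exists (g' \o f') => x; rewrite /= comp_lfunE ?fK ?gK ?Kg ?Kf.
have [cK Kc] := conjugationV inb.
by rewrite (conn_einv h e) (lfunV_eq cK Kc).
Qed.

Definition end_connection : connection end_bundle := {|
  conn_in := (fun e => conjugation (conn_in h e)) :
    forall e, 'Hom(end_bundle (src e), fibe end_bundle e);
  conn_out := (fun e => conjugation (conn_out h e)) :
    forall e, 'Hom(fibe end_bundle e, end_bundle (tgt e));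
  conn_in_iso := fun e => conjugation_iso (conn_in_iso h e);
  conn_out_iso := fun e => conjugation_iso (conn_out_iso h e);
  conn_einv := end_conn_einv |}.

Lemma transport_end e :
  transport end_connection e = conjugation (transport h e).
Proof.
exact/esym/(conjugation_comp (conn_out_iso h e).1 (conn_in_iso h e).1).
Qed.

End end_bundle.

Section itineraries.
Context (R : realType) (G : graph).

(* The continuous path ((x_0, t_0), e_1, (x_1, t_1), ..., e_n, (x_n, t_n)) is
   encoded as (x_0, [(t_0, e_1); ...; (t_(n-1), e_n)], t_n); the vertices
   x_k = t(e_k), k >= 1, are not stored.  Itineraries also contain sequences which
   are not paths; the paths are those satisfying cpath. *)
Definition itinerary := (vertex G * seq (R * edge G) * \bar R)%type.

Definition itin_start (w : itinerary) : vertex G := w.1.1.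
Definition itin_jumps (w : itinerary) : seq (R * edge G) := w.1.2.
Definition itin_edges (w : itinerary) : seq (edge G) := map snd w.1.2.
Definition itin_times (w : itinerary) : seq R := map fst w.1.2.
Definition itin_last (w : itinerary) : \bar R := w.2.

HB.instance Definition _ := Choice.on itinerary.
HB.instance Definition _ := isPointed.Build itinerary
  (enum_val (Ordinal (vertex_gt0 G)), [::], 0%E).

(* Discrete path fixed, each holding time in a Borel set: these sets generate the
   sigma-field of a countable disjoint union of products of intervals. *)
Definition itin_cylinder : set (set itinerary) :=
  [set C | exists x es (B : nat -> set (measurableTypeR R)) (D : set (\bar R)),
    [/\ forall k, measurable (B k), measurable D &
        C = [set w | [/\ itin_start w = x, itin_edges w = es,
               forall k, (k < size es)%N -> B k (nth 0 (itin_times w) k) &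
               D (itin_last w)]]]].

HB.instance Definition _ := @isMeasurable.Build (sigma_display itin_cylinder)
  itinerary <<s itin_cylinder >> (@sigma_algebra0 _ setT itin_cylinder)
  (@sigma_algebraC itinerary itin_cylinder)
  (@sigma_algebra_bigcup _ setT itin_cylinder).

Fixpoint walk x (es : seq (edge G)) : bool :=
  if es is e :: es' then (src e == x) && walk (tgt e) es' else true.

Definition cpath : set itinerary := [set w |
  [/\ walk (itin_start w) (itin_edges w), all (fun t => 0 < t) (itin_times w)
    & (0 < itin_last w)%E]].

(* Continuous loops; the last holding time is allowed to be infinite. *)
Definition cloop : set itinerary := [set w |
  cpath w /\ last (itin_start w) (map (@tgt G) (itin_edges w)) = itin_start w].

(* The sequence (x_0, t_0), ..., (x_n, t_n). *)
Fixpoint visits_rec x (js : seq (R * edge G)) (s : \bar R) :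
    seq (vertex G * \bar R) :=
  if js is (t, e) :: js' then (x, t%:E) :: visits_rec (tgt e) js' s
  else [:: (x, s)].

Definition visits (w : itinerary) :=
  visits_rec (itin_start w) (itin_jumps w) (itin_last w).

(* gamma_t = x_k for t_0 + ... + t_(k-1) <= t < t_0 + ... + t_k. *)
Fixpoint position_rec x (js : seq (R * edge G)) (t : R) : vertex G :=
  if js is (s, e) :: js' then
    if t < s then x else position_rec (tgt e) js' (t - s)
  else x.

Definition position (w : itinerary) (t : R) : vertex G :=
  position_rec (itin_start w) (itin_jumps w) t.

(* The path restricted to [0, t), with the same convention for the vertex x_k at
   which it ends as in position_rec.  At a jump time the last holding time of the
   result is 0, hence the result is not a path, but almost surely this happens for
   countably many t only. *)
Fixpoint stop_rec (js : seq (R * edge G)) (t : R) : seq (R * edge G) * R :=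
  if js is (s, e) :: js' then
    if t < s then ([::], t)
    else let p := stop_rec js' (t - s) in ((s, e) :: p.1, p.2)
  else ([::], t).

Definition stop (w : itinerary) (t : R) : itinerary :=
  let p := stop_rec (itin_jumps w) t in (itin_start w, p.1, p.2%:E).

End itineraries.

Definition exponential1 {R : realType} : set (measurableTypeR R) -> \bar R :=
  exponential_prob 1.

HB.instance Definition _ (R : realType) := Probability.copy (@exponential1 R)
  (exponential_distribution_exponential_prob__canonical__probability_measure_Probability
     (@ltr01 R)).

Section random_walk.
Context {R : realType} (G : wgraph R).

(* lambda_x = sum of the conductances of the edges issued from x. *)
Definition lambda x : R := \sum_(e : edge G | src e == x) cond e.

(* The probability that the jump chain started at x and stopped at its first
   visit to the well follows exactly the edges es:
   prod_k cond e_k / lambda (src e_k) if es is a walk from x whose vertices are all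
   proper except the last one, and 0 otherwise. *)
Fixpoint walk_prob x (es : seq (edge G)) : R :=
  match x \in well G, es with
  | true, [::] => 1
  | false, e :: es' =>
      (if src e == x then cond e / lambda x else 0) * walk_prob (tgt e) es'
  | _, _ => 0
  end.

Fact lambda_ge0 x : 0 <= lambda x.
Proof. by apply: sumr_ge0 => e _; apply: ltW; exact: cond_gt0. Qed.

Fact walk_prob_ge0 x es : 0 <= walk_prob x es.
Proof.
elim: es x => [|e es IH] x /=; case: (x \in well G) => //.
by case: ifP => _; rewrite ?mul0r // mulr_ge0 // divr_ge0 ?lambda_ge0 // ltW // cond_gt0.
Qed.

(* Edges es, finite holding times t, and an infinite last holding time. *)
Definition well_path x es (t : (size es).-tuple (measurableTypeR R)) :
  itinerary R G := (x, zip t es, +oo%E).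

Fact measurable_well_path x es : measurable_fun setT (@well_path x es).
Proof.
apply: (@measurability _ _ _ _ _ _ (@itin_cylinder R G)) => //.
move=> _ [_ [y [es' [B [D [mB mD ->]]]]] <-]; rewrite setTI.
have [/and3P[/eqP xy /eqP ees /asboolP Doo]|nP] :=
  boolP [&& x == y, es == es' & `[< D +oo%E >]]; last first.
  rewrite (_ : _ @^-1` _ = set0) //; apply/seteqP; split=> // t [/= e1 e2 _ e3].
  move: nP; rewrite -e1 -e2 /itin_edges /= -/(unzip2 _) unzip2_zip ?size_tuple //.
  by rewrite !eqxx /=; case: asboolP.
rewrite (_ : _ @^-1` _ =
    \bigcap_k (if insub k is Some i then (fun t => tnth t i) @^-1` B k
               else [set: (size es).-tuple (measurableTypeR R)])).
  apply: bigcapT_measurable => k; case: insubP => [i _ _|_] //.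
  by rewrite -[X in measurable X]setTI; apply: measurable_tnth.
have times_es (t : (size es).-tuple R) : itin_times (@well_path x es t) = t.
  by rewrite /itin_times /= -/(unzip1 _) unzip1_zip ?size_tuple.
apply/seteqP; split=> t.
  move=> [_ _ + _] k _; rewrite times_es -ees => tB.
  by case: insubP => // i ik <-; have := tB i (ltn_ord i); rewrite -tnth_nth.
move=> tB; split=> //; rewrite ?times_es -?ees //.
  by rewrite /itin_edges /= -/(unzip2 _) unzip2_zip ?size_tuple.
move=> k kn; have := tB k Logic.I.
by case: insubP => [i _ <-|/negP//]; rewrite /= (tnth_nth 0).
Qed.

Definition walk_term x es : set (itinerary R G) -> \bar R :=
  mscale (NngNum (walk_prob_ge0 x es))
    (measure_function_pushforward__canonical__measure_function_Measure
      (tuple_measure exponential1 (size es)) (@measurable_well_path x es)).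

HB.instance Definition _ x es := Measure.on (walk_term x es).

(* The law P_x of the random walk started at x: the edge sequence es has
   probability walk_prob x es and, given es, the holding times at proper vertices
   are independent exponential variables of parameter 1.  The sum over all edge
   sequences is written as a sum over nat through pickle_inv, for which each es has
   exactly one preimage. *)
Definition walk_law x : set (itinerary R G) -> \bar R :=
  mseries (fun k => if @pickle_inv (seq (edge G)) k is Some es
                    then walk_term x es else mzero) 0.

HB.instance Definition _ x := Measure.on (walk_law x).

(* The integral of a nonnegative measurable function F with respect to the loop
   measure mu. *)
Definition loop_integral (F : itinerary R G -> \bar R) : \bar R :=
  (\sum_(x : vertex G | x \notin well G)
    \int[walk_law x]_w \int[lebesgue_measure]_(t in `]0%R, +oo[)
      (F (stop w t) * (if position w t == x then t^-1 else 0)%:E))%E.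

Definition local_time (x : vertex G) (w : itinerary R G) : \bar R :=
  ((lambda x)^-1%:E * \sum_(v <- visits w | v.1 == x) v.2)%E.

Definition occupation (L : set (itinerary R G)) (x : vertex G) : \bar R :=
  \esum_(w in L) local_time x w.

End random_walk.

Section gaussian_free_field.
Context {R : realType} {G : wgraph R}.

Definition proper_vertex := {x : vertex G | x \notin well G}.

Section energy.
Context {r : nat} (B : bundle R G r) (g : connection B).

(* The sum runs over oriented edges, so each geometric edge is counted twice. *)
Definition dirichlet_energy (f : forall x, B x) : R :=
  4^-1 * \sum_(e : edge G) cond e *
    (let v := f (src e) - ((transport g e)^-1)%VF (f (tgt e)) in
     edot (B (src e)) v v).

(* The sections of B vanishing on the well, parametrized linearly by their
   coordinates in the bases vbasis of the fibres at the proper vertices. *)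
Definition section_of_coord
    (c : #|{: proper_vertex * 'I_r}|.-tuple (measurableTypeR R)) x : B x :=
  if insub x is Some p then
    \sum_(k < r) tnth c (enum_rank (p : proper_vertex, k)) *: (vbasis {:B x})`_k
  else 0.

(* C is the vector of coordinates of the random section Phi.  A linear change of
   coordinates multiplies Lebesgue measure by a constant, which is absorbed by the
   normalizing constant z; hence the bases need not be orthonormal. *)
Definition gaussian_free_field d (Omega : measurableType d)
    (P : probability Omega R) (Phi : Omega -> forall x, B x) : Prop :=
  exists2 C : Omega -> #|{: proper_vertex * 'I_r}|.-tuple (measurableTypeR R),
    measurable_fun setT C /\
      (forall omega x, Phi omega x = section_of_coord (C omega) x) &
    exists z : R, forall A, measurable A ->
      P (C @^-1` A) = (z%:E * \int[tuple_measure lebesgue_measure _]_(c in A)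
        (expR (- dirichlet_energy (section_of_coord c)))%:E)%E.

End energy.

Section loop_intensity.
Context {r : nat} {B : bundle R G r} (h : connection B).

(* Tr(hol_h(w)); meaningful when w is a loop. *)
Definition loop_trace (w : itinerary R G) : R :=
  lftrace (holonomy h (itin_start w) (itin_edges w) (itin_start w)).

(* The measure (1/2) Tr(hol_h)^2 dmu evaluated at A. *)
Definition loop_intensity (A : set (itinerary R G)) : \bar R :=
  loop_integral (fun w => (\1_A w * (2^-1 * loop_trace w ^+ 2))%:E).

End loop_intensity.
End gaussian_free_field.
Arguments proper_vertex {R} G.

Section poisson.
Context {R : realType} d d' (Omega : measurableType d) (T : measurableType d').

Definition point_count (L : Omega -> set T) (A : set T) (omega : Omega) :
  \bar R := counting (L omega `&` A).

(* A random countable subset L of T; the definition is meant for intensities nu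
   without atoms, for which a Poisson process has no multiple points. *)
Record poisson_process (P : probability Omega R) (nu : set T -> \bar R)
    (L : Omega -> set T) : Prop := {
  poisson_countable : forall omega, countable (L omega);
  poisson_measurable : forall A, measurable A ->
    measurable_fun [set: Omega] (point_count L A);
  poisson_fin : forall A (k : nat), measurable A -> (nu A < +oo)%E ->
    P [set omega | point_count L A omega = k%:R%:E] =
    (fine (nu A) ^+ k / k`!%:R * expR (- fine (nu A)))%:E;
  poisson_infty : forall A, measurable A -> nu A = +oo%E ->
    P [set omega | point_count L A omega = +oo%E] = 1%E;
  poisson_indep : forall n (A : 'I_n -> set T) (D : 'I_n -> set (\bar R)),
    (forall i, measurable (A i)) -> (forall i, measurable (D i)) ->
    trivIset setT A ->
    P (\bigcap_i (point_count L (A i) @^-1` D i)) =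
    (\prod_(i < n) P (point_count L (A i) @^-1` D i))%E }.

End poisson.

Section same_law.
Context {R : realType} (I : Type).

(* Generators of the product sigma-field on (\bar R)^I. *)
Definition field_cylinder : set (set (I -> \bar R)) :=
  [set C | exists i (D : set (\bar R)),
    measurable D /\ C = [set f | D (f i)]].

Definition same_law d d' (Omega : measurableType d) (Omega' : measurableType d')
    (P : probability Omega R) (X : Omega -> I -> \bar R)
    (P' : probability Omega' R) (Y : Omega' -> I -> \bar R) : Prop :=
  forall A, <<s field_cylinder >> A ->
    [/\ measurable (X @^-1` A), measurable (Y @^-1` A) &
        P (X @^-1` A) = P' (Y @^-1` A)].

End same_law.

(* Main.v *)
Require Import Defs.
From HB Require Import structures.
From mathcomp Require Import all_boot all_order all_algebra.
From mathcomp Require Import all_classical all_reals all_analysis measurable_realfun.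
From mathcomp Require Import ring lra.
From mathcomp Require Import perm.

(** The two fields are compared through their Laplace transforms at natural exponents
    s_x, which determine a law on nonnegative fields (laplace_same_law).

    Let B be the bundle End(F) with its connection g by conjugation.  In coordinates on the
    sections of B vanishing on the well, let Q be the jump operator of the random walk
    twisted by g, and D_s the diagonal matrix with entries 1 + s_x / lambda_x.

    Gaussian side.  The Dirichlet energy is half the quadratic form of
    lambda (1 - Q) Gr, where Gr is the Gram matrix of the bases of the fibres; adding
    one half of the sum of s_x Tr(Psi_x^* Psi_x) replaces 1 by D_s (energy_mx_quad,
    energy_mxE).  The Gaussian integral (integral_gauss_quad) therefore gives the Laplace
    transform sqrt (det (1 - Q) / det (D_s - Q)) (gaussian_laplace).  Connectedness makes the
    energy positive definite, so that the determinants are positive.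

    Loop side.  By the Laplace functional of a Poisson process (laplace_poisson), the
    transform is exp (- int (1 - exp (- sum_x s_x l_x)) dnu) with nu the intensity of the
    loops.  The trace of the conjugation by an isometry is the square of its trace
    (lftrace_conjugation), so the density of nu is half the trace of the holonomy of g.
    Writing 1 / t as the integral of exp (- eps t) over eps > 0, the measure nu becomes an
    integral over eps of Green functions of the walk killed at rate eps + s_x / lambda_x
    and weighted by the holonomy.  A first-step decomposition shows that the trace of
    such a Green function is the trace of the Neumann series of (eps + D_s - Q)^-1
    (green_trace).  Hence the exponent is half the integral over eps > 0 of
    tr (eps + 1 - Q)^-1 - tr (eps + D_s - Q)^-1, which Jacobi's formula evaluates to
    ln (det (D_s - Q) / det (1 - Q)) (integral_trace_resolvent), and the two transforms
    agree. *)

Set Implicit Arguments.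
Unset Strict Implicit.
Unset Printing Implicit Defensive.

Import Order.TTheory GRing.Theory Num.Theory.
Import numFieldNormedType.Exports.

Local Open Scope classical_set_scope.
Local Open Scope ring_scope.

(** * The Laplace kernel on the extended half line *)

Section expNe.
Context (R : realType).
Local Open Scope ereal_scope.
Implicit Types x y : \bar R.

(** exp(- x), with the value 0 at +oo.  It is real-valued, so that products and
    powers of it carry no side condition. *)
Definition expNe x : R := fine (expeR (- x)).

Lemma expNe_EFin (r : R) : expNe r%:E = expR (- r). Proof. by []. Qed.
Lemma expNe_y : expNe +oo = 0%R. Proof. by []. Qed.

Lemma expNe_ge0 x : (0 <= expNe x)%R.
Proof. by case: x => //= r; rewrite /expNe /= expR_ge0. Qed.

Lemma expNe_itv x : 0 <= x -> (0 <= expNe x <= 1)%R.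
Proof.
case: x => [r| |] // r0; last by rewrite expNe_y lexx ler01.
by rewrite expNe_ge0 expNe_EFin -(@expR0 R) ler_expR oppr_le0.
Qed.

Lemma expNe_le1 x : 0 <= x -> (expNe x <= 1)%R.
Proof. by move=> /expNe_itv/andP[]. Qed.

Lemma expNe0 : expNe 0 = 1%R. Proof. by rewrite expNe_EFin oppr0 expR0. Qed.

Lemma expNeD x y : 0 <= x -> 0 <= y -> expNe (x + y) = (expNe x * expNe y)%R.
Proof.
case: x => [r| |] //; case: y => [s| |] // _ _;
  rewrite /= ?expNe_y ?mulr0 ?mul0r //.
by rewrite !expNe_EFin opprD expRD.
Qed.

Lemma expNe_sum (I : Type) (r : seq I) (P : pred I) (F : I -> \bar R) :
  (forall i, 0 <= F i) ->
  expNe (\sum_(i <- r | P i) F i) = (\prod_(i <- r | P i) expNe (F i))%R.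
Proof.
move=> F0; elim: r => [|i r IH]; first by rewrite !big_nil expNe0.
rewrite !big_cons; case: ifP => // _; rewrite expNeD ?IH //.
exact: sume_ge0.
Qed.

Lemma le_expNe x y : 0 <= x -> x <= y -> (expNe y <= expNe x)%R.
Proof.
case: x => [r| |] //; case: y => [s| |] // x0 xy.
- by rewrite !expNe_EFin ler_expR lerN2.
- by rewrite expNe_y expNe_ge0.
Qed.

Lemma measurable_expNe d (T : measurableType d) (f : T -> \bar R) :
  measurable_fun setT f -> measurable_fun setT (fun w => expNe (f w)).
Proof.
move=> mf; rewrite (_ : (fun w => _) = fine \o er_map expR \o (fun w => - f w)).
  apply: measurableT_comp; last exact: measurableT_comp.
  apply: measurableT_comp => //; exact: measurable_er_map.
by apply/funext => w /=; rewrite /expNe; case: (f w).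
Qed.

Lemma cvg_expNe (u : nat -> \bar R) (l : \bar R) : (forall n, 0 <= u n) ->
  u n @[n --> \oo] --> l -> expNe (u n) @[n --> \oo] --> expNe l.
Proof.
move=> u0 ul; have l0 : 0 <= l.
  have <- := cvg_lim (@ereal_hausdorff R) ul.
  by apply: lime_ge; [apply/cvg_ex; exists l|exact: nearW].
case: l ul l0 => [r| |] // ul _.
  have /fine_cvgP[fu cu] := ul; rewrite expNe_EFin.
  apply: (@cvg_trans _ (expR (- fine (u n)) @[n --> \oo])).
    apply: near_eq_cvg; near=> n; rewrite -expNe_EFin fineK //; near: n; exact: fu.
  by apply: continuous_cvg; [exact: continuous_expR|exact: cvgN].
rewrite expNe_y; apply/cvgrPdist_le => e e0; move/cvgeyPge: ul => ul.
near=> n; rewrite sub0r normrN ger0_norm ?expNe_ge0 //.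
rewrite -(lnK (x := e)) ?posrE // -[ln e]opprK -expNe_EFin.
rewrite (@le_trans _ _ (expNe (Num.max 0 (- ln e))%:E)) //.
  by rewrite le_expNe ?lee_fin ?le_max ?lexx //; near: n; exact: ul.
by rewrite !expNe_EFin ler_expR lerN2 le_max lexx orbT.
Unshelve. all: end_near. Qed.

End expNe.

(** * Layers, densities and translations *)

Section layers.
Context d (T : measurableType d) (R : realType).
Implicit Types f : T -> \bar R.

(** Greedy expansion: the n-th layer is the set of points where the part of f not
    yet accounted for is at least the n-th harmonic term.  Where f is finite and some
    positive part were never accounted for, all late layers would contain the point, and
    the harmonic series would converge.  Since the coefficients do not depend on f, a
    statement on indicator functions passes to nonnegative measurable functions by
    countable additivity. *)
Lemma harmonic_layers f : measurable_fun setT f -> (forall x, 0 <= f x)%E ->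
  exists A : nat -> set T, (forall n, measurable (A n)) /\
    forall x, f x = (\sum_(n <oo) (harmonic n * \1_(A n) x)%:E)%E.
Proof.
move=> mf f0.
pose S := fix S n : T -> R := if n is m.+1 then fun x => S m x + harmonic m *
  \1_[set y | ((S m y + harmonic m)%:E <= f y)%E] x else fun=> 0.
pose A n := [set y | ((S n y + harmonic n)%:E <= f y)%E].
have SS n x : S n.+1 x = S n x + harmonic n * \1_(A n) x by [].
have mA n : measurable_fun setT (S n) -> measurable (A n).
  move=> mS; rewrite -[A n]setTI; apply: measurable_lee => //.
  by apply/measurable_EFinP; apply: measurable_funD.
have mS n : measurable_fun setT (S n).
  elim: n => [|n IH]; first exact: measurable_cst.
  apply: measurable_funD => //; apply: measurable_funM => //.
  exact/measurable_indic/mA.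
exists A; split=> [n|x]; first exact/mA.
have SE n : (\sum_(0 <= k < n) (harmonic k * \1_(A k) x)%:E)%E = (S n x)%:E.
  elim: n => [|n IH]; first by rewrite big_geq.
  by rewrite big_nat_recr //= IH.
have t0 k : (0 <= (harmonic k * \1_(A k) x : R)%:E)%E.
  by rewrite lee_fin mulr_ge0 ?harmonic_ge0.
have Sf n : ((S n x)%:E <= f x)%E.
  elim: n => [|n IH]; first exact: f0.
  rewrite SS indicE; case: (boolP (x \in A n)) => [|_]; first by rewrite inE mulr1.
  by rewrite mulr0 addr0.
have cvS := @is_cvg_nneseries _ (fun k => (harmonic k * \1_(A k) x)%:E) xpredT 0%N (fun n _ _ => t0 n).
apply/eqP; rewrite eq_le; apply/andP; split; last first.
  by apply: lime_le => //; apply: nearW => n; rewrite SE.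
rewrite leNgt; apply/negP => lt.
set l := limn _ in lt.
have lf : l \is a fin_num.
  rewrite ge0_fin_numE ?(lt_le_trans lt) ?leey //.
  by apply: nneseries_ge0.
have Sl n : ((S n x)%:E <= l)%E.
  rewrite -SE; apply: nneseries_lim_ge => //.
have Sfl n : S n x <= fine l by rewrite -lee_fin fineK.
(* eventually the residual exceeds the step, so that every late layer contains x *)
have [e e0 le] : exists2 e : R, 0 < e & ((fine l + e)%:E <= f x)%E.
  move: lt; rewrite -(fineK lf); case: (f x) => [r| |] //; last first.
    by exists 1 => //; rewrite leey.
  by rewrite lte_fin => lr; exists (r - fine l); rewrite ?subr_gt0 // lee_fin addrC subrK.
have [N _ hN] : \forall n \near \oo, harmonic n < e :> R.
  exact: (near_infty_natSinv_lt (PosNum e0)).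
have xA n : (N <= n)%N -> \1_(A n) x = 1 :> R.
  move=> Nn; rewrite indicE mem_set //=; apply: le_trans le.
  by rewrite lee_fin lerD // ltW //; exact: hN.
have SN k : series harmonic (N + k)%N = series harmonic N + (S (N + k)%N x - S N x).
  elim: k => [|k IH]; first by rewrite addn0 subrr addr0.
  rewrite addnS SS xA ?leq_addr // mulr1 /series /= big_nat_recr //=.
  by move: IH; rewrite /series /= => ->; ring.
have S0 n : 0 <= S n x by rewrite -lee_fin -SE sume_ge0.
apply: (@dvg_harmonic R); apply: nondecreasing_is_cvgn.
  by apply/nondecreasing_seqP => n; rewrite /series /= big_nat_recr //= lerDl harmonic_ge0.
exists (series harmonic N + fine l) => _ [n _ <-].
have [nN|Nn] := leqP n N.
  apply: (@le_trans _ _ (series harmonic N)).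
    rewrite -(subnKC nN) -subr_ge0 sub_series_geq ?leq_addr //.
    by apply: sumr_ge0 => k _; exact: harmonic_ge0.
  by rewrite lerDl (le_trans (S0 0%N)).
rewrite -(subnKC (ltnW Nn)) SN lerD2l lerBlDr (le_trans (Sfl _)) // lerDl.
exact: S0.
Qed.

End layers.
Section image_density.
Context d d' (T : measurableType d) (Z : measurableType d') (R : realType).
Local Open Scope ereal_scope.

(** The hypothesis is the case of an indicator function; the layers of f reduce the
    general case to it. *)
Lemma integral_image_density (I : Type) (r : seq I) (P : pred I)
    (m : {measure set T -> \bar R}) (k : I -> {measure set Z -> \bar R})
    (phi : Z -> T) (rho : I -> Z -> R) :
  measurable_fun setT phi -> (forall i, measurable_fun setT (rho i)) ->
  (forall i z, (0 <= rho i z)%R) ->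
  (forall A, measurable A -> m A =
     \sum_(i <- r | P i) \int[k i]_z (\1_A (phi z) * rho i z)%:E) ->
  forall f : T -> \bar R, measurable_fun setT f -> (forall x, 0 <= f x) ->
  \int[m]_x f x = \sum_(i <- r | P i) \int[k i]_z (f (phi z) * (rho i z)%:E).
Proof.
move=> mphi mrho rho0 mE f mf f0; have [A [mA fE]] := harmonic_layers mf f0.
have h0 n : (0 <= harmonic n :> R)%R by exact: harmonic_ge0.
under eq_integral do rewrite fE.
rewrite integral_nneseries //; last 2 first.
- by move=> n; apply/measurable_EFinP; apply: measurable_funM.
- by move=> n x _; rewrite lee_fin mulr_ge0.
transitivity (\sum_(n <oo) \sum_(i <- r | P i)
   \int[k i]_z ((harmonic n)%:E * (\1_(A n) (phi z) * rho i z)%:E)).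
  apply: eq_eseriesr => n _.
  under eq_integral do rewrite EFinM.
  rewrite ge0_integralZl_EFin //; last exact/measurable_EFinP.
  rewrite integral_indic // setIT mE // ge0_sume_distrr; last first.
    by move=> i _; apply: integral_ge0 => z _; rewrite lee_fin mulr_ge0.
  apply: eq_bigr => i _; rewrite ge0_integralZl_EFin //.
    by move=> z _; rewrite lee_fin mulr_ge0.
  apply/measurable_EFinP; apply: measurable_funM => //.
  exact: (measurableT_comp (measurable_indic (mA n))).
rewrite nneseries_sum; last first.
  by move=> i n _; apply: integral_ge0 => z _; rewrite -EFinM lee_fin !mulr_ge0.
apply: eq_bigr => i _; rewrite -integral_nneseries //; last 2 first.
- move=> n; apply/measurable_EFinP; apply: measurable_funM => //.
  apply: measurable_funM => //.
  exact: (measurableT_comp (measurable_indic (mA n))).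
- by move=> n z _; rewrite -EFinM lee_fin !mulr_ge0.
apply: eq_integral => z _; rewrite fE muleC -nneseriesZl; last first.
  by move=> n _; rewrite lee_fin mulr_ge0.
by apply: eq_eseriesr => n _; rewrite -!EFinM; congr EFin; ring.
Qed.

End image_density.

Section translation.
Context (R : realType).
Local Open Scope ereal_scope.

Lemma lebesgue_measure_shift (a : R) (A : set R) : measurable A ->
  pushforward lebesgue_measure ((fun x => x + a)%R : _ -> measurableTypeR R) A =
  lebesgue_measure A.
Proof.
move=> mA; have ms : measurable_fun setT ((fun x => x + a)%R : _ -> measurableTypeR R).
  exact: measurable_funD.
apply/esym/(@lebesgue_measure_unique R
  (measure_function_pushforward__canonical__measure_function_Measure
    lebesgue_measure ms)) => //= _ [[b c]] _ <-.
rewrite /pushforward (_ : _ @^-1` _ = `](b - a)%R, (c - a)%R]%classic); last first.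
  by apply/seteqP; split => x /=; rewrite !in_itv /= ltrBlDr lerBrDr.
rewrite !lebesgue_measure_itv/= !lte_fin ltrBlDr subrK.
by rewrite -!EFinB opprB addrA subrK.
Qed.

Lemma integral_shift (a : R) (f : R -> \bar R) : measurable_fun setT f ->
  (forall x, 0 <= f x) ->
  \int[lebesgue_measure]_(x in `[a, +oo[) f (x - a)%R =
  \int[lebesgue_measure]_(x in `[0%R, +oo[) f x.
Proof.
move=> mf f0; have -> : `[a, +oo[%classic =
    ((fun x => x - a)%R : _ -> measurableTypeR R) @^-1` `[0%R, +oo[.
  by apply/seteqP; split => x /=; rewrite !in_itv /= !andbT subr_ge0.
have mg : measurable_fun setT
    ((fun x => x - a)%R : measurableTypeR R -> measurableTypeR R).
  exact: measurable_funB.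
have := @ge0_integral_pushforward _ _ _ _ _ _ mg lebesgue_measure `[0%R, +oo[ f.
move=> /(_ _ _ _)/esym -> //=; last exact: measurable_funS mf.
by apply: eq_measure_integral => //= A mA AS; exact: lebesgue_measure_shift.
Qed.

End translation.

(** * Uniqueness from Laplace transforms at natural exponents *)

Section threshold.
Context (R : realType).
Implicit Types u w x : R.

Lemma bernoulli_ge w n : -1 <= w -> 1 + n%:R * w <= (1 + w) ^+ n.
Proof.
rewrite -subr_ge0 opprK addrC => w0; elim: n => [|n IH]; first by rewrite mul0r addr0 expr0.
rewrite exprS -natr1 (le_trans _ (ler_wpM2l w0 IH)) //.
rewrite -subr_ge0 (_ : _ - _ = n%:R * w ^+ 2); last by ring.
by rewrite mulr_ge0 ?sqr_ge0.
Qed.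

(** A polynomial in u that converges to the indicator of u <= beta as m grows, also at
    u = beta.  With w = u^(m^2) and N the exponent, N w <= 2^-m if u <= beta, while
    N w tends to infinity if u > beta; the power (1 - w)^N then tends to 1, respectively
    to 0, by Bernoulli's inequality applied to - w and to w. *)
Definition threshold_poly (beta : R) (m : nat) : {poly R} :=
  (1 - 'X ^+ (m ^ 2)) ^+ Num.truncn (beta ^- (m ^ 2) * 2 ^- m).

Lemma horner_threshold_poly beta m u : (threshold_poly beta m).[u] =
  (1 - u ^+ (m ^ 2)) ^+ Num.truncn (beta ^- (m ^ 2) * 2 ^- m).
Proof. by rewrite /threshold_poly !hornerE. Qed.

Lemma threshold_poly_itv beta m u : 0 <= u <= 1 ->
  0 <= (threshold_poly beta m).[u] <= 1.
Proof.
move=> /andP[u0 u1]; rewrite horner_threshold_poly.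
have /andP[h0 h1] : 0 <= 1 - u ^+ (m ^ 2) <= 1.
  by rewrite subr_ge0 exprn_ile1 //= gerBl exprn_ge0.
by rewrite exprn_ge0 //= exprn_ile1.
Qed.

Lemma cvg_threshold_poly beta u : 0 < beta -> 0 <= u <= 1 ->
  (threshold_poly beta m).[u] @[m --> \oo] --> ((u <= beta)%R%:R : R).
Proof.
move=> b0 u01; have /andP[u0 u1] := u01.
have v0 m : 0 < beta ^- (m ^ 2) * 2 ^- m by rewrite mulr_gt0 // invr_gt0 exprn_gt0.
have half : ((2 : R)^-1 ^+ m) @[m --> \oo] --> (0 : R).
  by apply: cvg_expr; rewrite ger0_norm ?invf_lt1 ?ltr1n.
have w01 m : 0 <= u ^+ (m ^ 2) <= 1 by rewrite exprn_ge0 // exprn_ile1.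
(* u <= beta: the lower bound 1 - N w is at least 1 - 2^-m *)
have [ub|bu] := leP u beta.
  apply: (@squeeze_cvgr _ _ _ _ (fun m => 1 - 2^-1 ^+ m) (fun=> 1)).
  - apply: nearW => m; have /andP[_ ->] := threshold_poly_itv beta m u01.
    rewrite andbT horner_threshold_poly (@le_trans _ _
      (1 + (Num.truncn (beta ^- (m ^ 2) * 2 ^- m))%:R * - u ^+ (m ^ 2))) //; last first.
      by apply: bernoulli_ge; have /andP[_] := w01 m; rewrite lerN2.
    rewrite mulrN lerD2l lerN2 (@le_trans _ _ (beta ^- (m ^ 2) * 2 ^- m * beta ^+ (m ^ 2))) //.
      rewrite ler_pM ?exprn_ge0 //; first by rewrite truncn_le ltW.
      by rewrite lerXn2r // nnegrE ltW.
    by rewrite mulrAC mulVf ?mul1r ?exprVn // expf_neq0 // gt_eqF.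
  - by rewrite -[X in _ --> X](subr0 (1 : R)); apply: cvgB half; exact: cvg_cst.
  - exact: cvg_cst.
have u_gt0 : 0 < u by exact: lt_trans bu.
pose q := beta / u.
have q01 : 0 <= q < 1 by rewrite divr_ge0 ?ltW //= ltr_pdivrMr // mul1r.
have [q0 q1] := andP q01.
have qm : (q ^+ m) @[m --> \oo] --> (0 : R) by apply: cvg_expr; rewrite ger0_norm.
apply: (@squeeze_cvgr _ _ _ _ (fun=> 0) (fun m => 2^-1 ^+ m)) => //; last exact: cvg_cst.
near=> m; have /andP[-> _] := threshold_poly_itv beta m u01; rewrite horner_threshold_poly /=.
set N := Num.truncn _; set w := u ^+ (m ^ 2).
have w0 : 0 < w by rewrite exprn_gt0.
have /andP[_ w1] := w01 m.
(* u > beta: (1 - w)^N <= 1 / (1 + N w), and N w is at least about (u / beta)^(m^2) 2^-m *)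
have le1 : (1 - w) ^+ N * (1 + N%:R * w) <= 1.
  rewrite (@le_trans _ _ ((1 - w) ^+ N * (1 + w) ^+ N)) //.
    by rewrite ler_wpM2l ?exprn_ge0 ?subr_ge0 ?bernoulli_ge // (le_trans _ (ltW w0)) // lerN10.
  rewrite -exprMn -subr_sqr expr1n exprn_ile1 ?subr_ge0 ?gerBl ?sqr_ge0 //.
  by rewrite exprn_ile1 // ltW.
have le2 : w * (beta ^- (m ^ 2) * 2 ^- m) <= 1 + N%:R * w.
  rewrite (@le_trans _ _ (w * N.+1%:R)) //.
    by rewrite ler_pM2l // ltW // truncnS_gt.
  by rewrite -natr1 mulrDr mulr1 addrC mulrC lerD2r.
have : (1 - w) ^+ N * (w * (beta ^- (m ^ 2) * 2 ^- m)) <= 1.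
  by rewrite (le_trans _ le1) // ler_wpM2l // exprn_ge0 // subr_ge0.
have wv : 0 < w * (beta ^- (m ^ 2) * 2 ^- m) by rewrite mulr_gt0.
rewrite -ler_pdivlMr // => /le_trans; apply; rewrite div1r.
have -> : (w * (beta ^- (m ^ 2) * 2 ^- m))^-1 = (q ^+ m * 2) ^+ m.
  rewrite exprMn -exprM mulnn /q expr_div_n /w; field.
  by rewrite !expf_neq0 // gt_eqF.
rewrite lerXn2r ?nnegrE // ?mulr_ge0 ?exprn_ge0 //.
suff : q ^+ m <= 4^-1 by lra.
near: m; apply: (cvgr_le _ qm); by lra.
Unshelve. all: end_near. Qed.

End threshold.

Section moments.
Context (R : realType) (I : finType).
Local Open Scope ereal_scope.

Section one_law.
Context d (Omega : measurableType d) (P : probability Omega R).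
Variable u : Omega -> I -> R.
Hypothesis mu : forall i, measurable_fun setT (fun w => u w i).
Hypothesis u01 : forall w i, (0 <= u w i <= 1)%R.

Let prod01 (v : Omega -> I -> R) w : (forall i, 0 <= v w i <= 1)%R ->
  (0 <= \prod_i v w i <= 1)%R.
Proof.
move=> h; apply: (big_ind (fun x : R => 0 <= x <= 1)%R).
- by rewrite ler01 lexx.
- by move=> x y /andP[x0 x1] /andP[y0 y1]; rewrite mulr_ge0 //= mulr_ile1.
- by move=> i _; exact: h.
Qed.

Let integrable_prod (v : Omega -> I -> R) :
  (forall i, measurable_fun setT (fun w => v w i)) ->
  (forall w i, 0 <= v w i <= 1)%R ->
  P.-integrable setT (fun w => (\prod_i v w i)%:E).
Proof.
move=> mv h; apply: (@le_integrable _ _ _ _ _ _ _ (EFin \o cst 1%R)) => //.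
- by apply/measurable_EFinP; apply: measurable_prod => i _; exact: mv.
- move=> w _ /=; rewrite lee_fin normr1; have /andP[p0 p1] := prod01 (h w).
  by rewrite ger0_norm.
- exact: finite_measure_integrable_cst.
Qed.

(** On the right-hand side the law of u enters through its mixed moments only. *)
Lemma integral_prod_poly (q : I -> {poly R}) (n : nat) :
  (forall i, (size (q i) <= n)%N) ->
  \int[P]_w (\prod_i (q i).[u w i])%:E =
  \sum_(f : {ffun I -> 'I_n}) (\prod_i (q i)`_(f i))%:E *
     \int[P]_w (\prod_i u w i ^+ f i)%:E.
Proof.
move=> sq.
have pow01 (f : {ffun I -> 'I_n}) w i : (0 <= u w i ^+ f i <= 1)%R.
  by have /andP[u0 u1] := u01 w i; rewrite exprn_ge0 //= exprn_ile1.
have ip (f : {ffun I -> 'I_n}) : P.-integrable setT (fun w => (\prod_i u w i ^+ f i)%:E).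
  by apply: integrable_prod => // i; apply: measurable_funX.
transitivity (\int[P]_w \sum_(f : {ffun I -> 'I_n})
    ((\prod_i (q i)`_(f i))%:E * (\prod_i u w i ^+ f i)%:E)).
  apply: eq_integral => w _.
  under [X in _ = X]eq_bigr do rewrite -EFinM -big_split.
  rewrite sumEFin -(bigA_distr_bigA (fun i (j : 'I_n) => (q i)`_j * u w i ^+ j)%R).
  by congr EFin; apply: eq_bigr => i _; exact: horner_coef_wide.
rewrite integral_sum //; last by move=> f; apply: integrableZl.
by apply: eq_bigr => f _; rewrite integralZl.
Qed.

Lemma cvg_integral_threshold (beta : I -> R) : (forall i, 0 < beta i)%R ->
  \int[P]_w (\prod_i (threshold_poly (beta i) m).[u w i])%:E @[m --> \oo] -->
  P [set w | forall i, (u w i <= beta i)%R].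
Proof.
move=> b0; set A := [set w | _].
have AE : A = \bigcap_(i in [set: I]) [set w | (u w i <= beta i)%R].
  by apply/seteqP; split => [w h i _|w h i]; [exact: h|exact: (h i Logic.I)].
have mA : measurable A.
  rewrite AE; apply: fin_bigcap_measurable => // i _.
  rewrite -[X in measurable X]setTI; apply: measurable_fun_le => //.
have -> : P A = \int[P]_w (\1_A w)%:E by rewrite integral_indic // setIT.
apply: (@dominated_cvg _ _ _ _ _ _ _ _ (fun=> 1)) => //.
- move=> m; apply/measurable_EFinP/measurable_prod => i _.
  rewrite (_ : (fun w => _) = (fun x => (threshold_poly (beta i) m).[x]) \o u^~ i) //.
  apply: measurableT_comp => //; apply: continuous_measurable_fun.
  exact: continuous_horner.
- move=> w _; apply/cvg_EFin; first exact: nearW.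
  rewrite (_ : \1_A w = \prod_i ((u w i <= beta i)%R%:R : R))%R; last first.
    rewrite indicE; have [/set_mem/= wA|/negP wA] := boolP (w \in A).
      by rewrite big1 // => i _; rewrite wA.
    have /existsNP[i /negP ui] : ~ A w by move=> wA'; apply: wA; exact: mem_set.
    by rewrite (bigD1 i) //= (negPf ui) mul0r.
  rewrite /comp /=; elim: (index_enum I) => [|i s IH].
    by rewrite big_nil; under eq_fun do rewrite big_nil; exact: cvg_cst.
  rewrite big_cons; under eq_fun do rewrite big_cons.
  by apply: cvgM => //; exact: cvg_threshold_poly.
- exact: finite_measure_integrable_cst.
- move=> m w _; rewrite lee_fin.
  have h i : (0 <= (threshold_poly (beta i) m).[u w i] <= 1)%R.
    exact: threshold_poly_itv.
  by have /andP[p0 p1] := prod01 (v := fun w i => (threshold_poly (beta i) m).[u w i]) h;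
    rewrite ger0_norm.
Qed.

End one_law.
End moments.

Section uniqueness.
Context (R : realType) (I : finType).
Local Open Scope ereal_scope.

Lemma measurable_cylinder d (Omega : measurableType d) (X : Omega -> I -> \bar R) :
  (forall i, measurable_fun setT (fun w => X w i)) ->
  forall A, <<s @field_cylinder R I >> A -> measurable (X @^-1` A).
Proof.
move=> mX A; pose S := [set B | measurable (X @^-1` B)].
suff : <<s @field_cylinder R I >> `<=` S by apply.
apply: smallest_sub.
  split=> [|B mB|F mF]; rewrite /S /=.
  - by rewrite preimage_set0.
  - rewrite setTD preimage_setC; exact: measurableC.
  - rewrite preimage_bigcup; apply: bigcup_measurable => k _; exact: mF.
move=> _ [i [D [mD ->]]]; rewrite /S /= -[X in measurable X]setTI.
exact: (mX i).
Qed.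

Definition orthant (b : I -> \bar R) : set (I -> \bar R) :=
  [set f | forall i, b i <= f i].

(** Bounds smaller than +oo generate the sigma-field, and they keep exp(- b i) positive,
    as cvg_threshold_poly demands. *)
Definition orthants : set (set (I -> \bar R)) :=
  [set orthant b | b in [set b | forall i, b i < +oo]].

Lemma orthants_generate : <<s @field_cylinder R I >> = <<s orthants >>.
Proof.
apply/seteqP; split; apply: smallest_sub; try exact: smallest_sigma_algebra.
  move=> _ [i [D [mD ->]]].
  pose S := [set B : set (\bar R) | <<s orthants >> [set f | B (f i)]].
  suff : (@ErealGenCInfty.G R).-sigma.-measurable `<=` S.
    by move=> h; apply: h; rewrite -ErealGenCInfty.measurableE.
  have [s0 sC sU] := smallest_sigma_algebra setT orthants.
  apply: smallest_sub.
    split=> [|B SB|F SF]; rewrite /S /=.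
    - by rewrite (_ : [set f | _] = set0).
    - rewrite (_ : [set f | _] = setT `\` [set f | B (f i)]); first exact: sC.
      by apply/seteqP; split.
    - rewrite (_ : [set f | _] = \bigcup_n [set f | F n (f i)]); first exact: sU.
      by [].
  move=> _ [r ->]; rewrite /S /=; apply: sub_sigma_algebra.
  (* the bound -oo puts no constraint on the other coordinates *)
  exists (fun j => if j == i then r%:E else -oo).
    by move=> j; case: eqP; rewrite ?ltry ?ltNyr.
  apply/seteqP; split => f /=; rewrite in_itv /= andbT.
    by move=> /(_ i); rewrite eqxx.
  by move=> rf j; case: eqP => [->|_] //; rewrite leNye.
move=> _ [b _ <-].
rewrite (_ : orthant b = \bigcap_(i in [set: I]) [set f | b i <= f i]); last first.
  by apply/seteqP; split => [w h i _|w h i]; [exact: h|exact: (h i Logic.I)].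
apply: (@fin_bigcap_measurable _ (g_sigma_algebraType (@field_cylinder R I))) => // i _.
apply: sub_sigma_algebra; exists i, `[b i, +oo[%classic; split.
  exact: emeasurable_itv.
by apply/seteqP; split => f /=; rewrite in_itv /= andbT.
Qed.

Lemma orthantsI : setI_closed orthants.
Proof.
move=> _ _ [b bo <-] [c co <-]; exists (fun i => maxe (b i) (c i)).
  by move=> i; rewrite gt_max bo co.
apply/seteqP; split => [f h|f [h1 h2] i]; last by rewrite ge_max h1 h2.
by split => i; have := h i; rewrite ge_max => /andP[].
Qed.

Context d d' (Omega : measurableType d) (Omega' : measurableType d').
Context (P : probability Omega R) (P' : probability Omega' R).
Context (X : Omega -> I -> \bar R) (Y : Omega' -> I -> \bar R).
Hypothesis mX : forall i, measurable_fun setT (fun w => X w i).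
Hypothesis mY : forall i, measurable_fun setT (fun w => Y w i).
Hypothesis X0 : forall w i, 0 <= X w i.
Hypothesis Y0 : forall w i, 0 <= Y w i.

Lemma eq_orthants_same_law :
  (forall b, orthants b -> P (X @^-1` b) = P' (Y @^-1` b)) ->
  same_law P X P' Y.
Proof.
move=> PP' A mA; split; try exact: measurable_cylinder.
pose T := g_sigma_algebraType (@field_cylinder R I).
have mXT : measurable_fun setT (X : Omega -> T).
  by move=> _ B mB; rewrite setTI; exact: measurable_cylinder.
have mYT : measurable_fun setT (Y : Omega' -> T).
  by move=> _ B mB; rewrite setTI; exact: measurable_cylinder.
pose m1 := measure_function_pushforward__canonical__measure_function_Measure P mXT.
pose m2 := measure_function_pushforward__canonical__measure_function_Measure P' mYT.
apply: (@measure_unique _ R T orthants (fun=> setT) _ _ _ _ m1 m2) => //.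
- exact: orthants_generate.
- exact: orthantsI.
- move=> _; exists (fun=> -oo); first by [].
  by apply/seteqP; split => // f _ i; exact: leNye.
- by apply/seteqP; split => // f _; exists 0%N.
- move=> _; rewrite (_ : m1 setT = P setT) // probability_setT; exact: ltry.
Qed.

(** In terms of u_i = exp(- X_i) an orthant is a set of the form u <= beta, whose
    indicator is the limit of products of threshold polynomials.  The expectation of such
    a product is a combination of the Laplace transforms at natural exponents. *)
Lemma laplace_same_law :
  (forall s : I -> nat,
    \int[P]_w (\prod_i expNe (X w i) ^+ s i)%:E =
    \int[P']_w (\prod_i expNe (Y w i) ^+ s i)%:E) ->
  same_law P X P' Y.
Proof.
move=> PP'; apply: eq_orthants_same_law => _ [b boo <-].
pose beta i := expNe (maxe 0 (b i)).
have beta0 i : (0 < beta i)%R.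
  rewrite /beta; move: (boo i); case: (b i) => [r| |] // _.
    by rewrite -EFin_max expNe_EFin expR_gt0.
  by rewrite max_l ?leNye // expNe0.
have orthantE (x : \bar R) i : 0 <= x -> (b i <= x) = (expNe x <= beta i)%R.
  move=> x0; rewrite /beta; move: (boo i); case: (b i) => [r| |] // _.
    rewrite -EFin_max; move: x x0 => [x| |] // x0.
      rewrite !expNe_EFin ler_expR lerN2 lee_fin ge_max.
      by move: x0; rewrite lee_fin => ->.
    by rewrite leey expNe_y expNe_ge0.
  by rewrite leNye max_l ?leNye // expNe0 expNe_le1.
have XE : X @^-1` orthant b = [set w | forall i, (expNe (X w i) <= beta i)%R].
  by apply/seteqP; split => w h i; have := h i; rewrite orthantE.
have YE : Y @^-1` orthant b = [set w | forall i, (expNe (Y w i) <= beta i)%R].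
  by apply/seteqP; split => w h i; have := h i; rewrite orthantE.
rewrite XE YE.
have cX := @cvg_integral_threshold R I _ _ P (fun w i => expNe (X w i))
  (fun i => measurable_expNe (mX i)) (fun w i => expNe_itv (X0 w i)) beta beta0.
have cY := @cvg_integral_threshold R I _ _ P' (fun w i => expNe (Y w i))
  (fun i => measurable_expNe (mY i)) (fun w i => expNe_itv (Y0 w i)) beta beta0.
rewrite -(cvg_lim _ cX) // -(cvg_lim _ cY) //; congr (lim (_ @ \oo)).
apply/funext => m.
pose n := \max_i size (threshold_poly (beta i) m).
have sn i : (size (threshold_poly (beta i) m) <= n)%N by exact: leq_bigmax.
rewrite (integral_prod_poly _ _ _ sn); last first.
- by move=> w i; exact: expNe_itv.
- by move=> i; exact: measurable_expNe.
rewrite (integral_prod_poly _ _ _ sn); last first.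
- by move=> w i; exact: expNe_itv.
- by move=> i; exact: measurable_expNe.
by apply: eq_bigr => f _; rewrite PP'.
Qed.

End uniqueness.

(** * Sums over the points of a Poisson process *)

Section esum_extra.
Context (R : realType).
Local Open Scope ereal_scope.

Lemma esum_exchange (I J : choiceType) (A : set I) (B : set J)
    (a : I -> J -> \bar R) : (forall i j, 0 <= a i j) ->
  \esum_(i in A) \esum_(j in B) a i j = \esum_(j in B) \esum_(i in A) a i j.
Proof.
move=> a0; rewrite !esum_esum //.
rewrite (reindex_esum (A `*`` fun=> B) (B `*`` fun=> A) (fun p => (p.2, p.1))) //.
split=> //=.
- by move=> [i j] [].
- by move=> [i j] [i' j'] _ _ [-> ->].
- by move=> [j i] [Bj Ai]; exists (i, j).
Qed.

Lemma esum_indic d (T : measurableType d) (L A : set T) :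
  \esum_(w in L) (\1_A w)%:E = counting (L `&` A) :> \bar R.
Proof.
transitivity (\esum_(w in L `&` A) (1 : \bar R)).
  rewrite esum_mkcondr; apply: eq_esum => w _.
  by rewrite indicE; case: (w \in A).
rewrite /counting; case: ifPn => [/asboolP fin|/asboolP inf]; last first.
  rewrite -(@infinite_card_dirac _ _ R _ inf); apply: eq_esum => w LAw.
  by rewrite diracE mem_set.
rewrite esum_fset // fsbig_finite //=.
by elim: (finmap.enum_fset _) => [|x s IH] /=; rewrite ?big_nil // big_cons IH -natr1 addrC.
Qed.

Lemma esumZl (T : choiceType) (L : set T) (c : R) (a : T -> \bar R) :
  (0 <= c)%R -> (forall w, 0 <= a w) ->
  \esum_(w in L) (c%:E * a w) = c%:E * \esum_(w in L) a w.
Proof.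
move=> c0 a0; rewrite /esum -ereal_supZl //; last first.
  by apply/set0P; exists 0, set0; [exact: fsets_set0|rewrite fsbig_set0].
congr ereal_sup; rewrite image_comp.
apply: eq_imagel => F [finF _] /=.
by rewrite !fsbig_finite //= ge0_sume_distrr.
Qed.

End esum_extra.

Section poisson_functional.
Context (R : realType) d d' (Omega : measurableType d) (T : measurableType d').
Context (P : probability Omega R) (nu : set T -> \bar R) (L : Omega -> set T).
Hypothesis PP : poisson_process P nu L.
Local Open Scope ereal_scope.

Lemma esum_layers (f : T -> \bar R) (A : nat -> set T) :
  (forall x, f x = \sum_(n <oo) (harmonic n * \1_(A n) x)%:E) ->
  forall w, \esum_(t in L w) f t =
    \sum_(n <oo) (harmonic n)%:E * point_count L (A n) w.
Proof.
move=> fE w.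
have h0 n : (0 <= harmonic n :> R)%R by exact: harmonic_ge0.
transitivity (\esum_(t in L w) \esum_(n in [set: nat]) (harmonic n * \1_(A n) t : R)%:E).
  apply: eq_esum => t _; rewrite fE nneseries_esumT // => n.
  by rewrite lee_fin mulr_ge0.
rewrite esum_exchange; last by move=> t n; rewrite lee_fin mulr_ge0.
rewrite -nneseries_esumT; last first.
  by move=> n; apply: esum_ge0 => t _; rewrite lee_fin mulr_ge0.
apply: eq_eseriesr => n _; under eq_esum do rewrite EFinM.
by rewrite esumZl ?esum_indic // => t; rewrite lee_fin.
Qed.

Lemma point_count_ge0 A w : 0 <= point_count L A w :> \bar R.
Proof. by rewrite /point_count /counting; case: ifP; rewrite ?leey ?lee_fin. Qed.

Lemma measurable_esum (f : T -> \bar R) : measurable_fun setT f ->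
  (forall x, 0 <= f x) -> measurable_fun setT (fun w => \esum_(t in L w) f t).
Proof.
move=> mf f0; have [A [mA fE]] := harmonic_layers mf f0.
under eq_fun do rewrite (esum_layers fE).
apply: ge0_emeasurable_sum => [n w _ _|n _].
  by rewrite mule_ge0 ?point_count_ge0 // lee_fin harmonic_ge0.
by apply: measurable_funeM; exact: (poisson_measurable PP).
Qed.

Lemma prod_indic (I : finType) (U : Type) (B : I -> set U) u :
  (\prod_i \1_(B i) u = \1_(\bigcap_i B i) u :> R)%R.
Proof.
rewrite indicE; have [/set_mem/= wA|/negP wA] := boolP (u \in \bigcap_i B i).
  by rewrite big1 // => i _; rewrite indicE mem_set //; exact: wA.
have /existsNP[i Bi] : ~ forall i, B i u.
  by move=> wA'; apply: wA; apply: mem_set => i _; exact: wA'.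
by rewrite (bigD1 i) //= indicE memNset ?mul0r.
Qed.

Section indep.
Variables (n : nat) (A : 'I_n -> set T).
Hypotheses (mA : forall i, measurable (A i)) (tA : trivIset setT A).
Let N i := point_count L (A i) : Omega -> \bar R.

Let mN i : measurable_fun setT (N i).
Proof. exact: (poisson_measurable PP). Qed.

Let mND i D : measurable D -> measurable (N i @^-1` D).
Proof. by move=> mD; rewrite -[X in measurable X]setTI; exact: mN. Qed.

Variable g : 'I_n -> \bar R -> R.
Hypotheses (mg : forall i, measurable_fun setT (g i)) (g01 : forall i y, (0 <= g i y <= 1)%R).

(** Independence is known for events.  It extends to functions one factor at a time: the
    family f k uses the function g i for i < k and the indicator of an event for the other
    factors, and the layers of g k lead from k to k + 1. *)
Lemma integral_prod_point_count :
  \int[P]_w (\prod_i g i (N i w))%:E = \prod_(i < n) \int[P]_w (g i (N i w))%:E.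
Proof.
pose f k (D : 'I_n -> set (\bar R)) (i : 'I_n) w : R :=
  if (i < k)%N then g i (N i w) else \1_(N i @^-1` D i) w.
have g0 i y : (0 <= g i y)%R by have /andP[] := g01 i y.
have f01 k D i w : (0 <= f k D i w <= 1)%R.
  rewrite /f; case: ifP => // _; rewrite indicE; case: (_ \in _); by rewrite ?lexx ?ler01.
have f0 k D i w : (0 <= f k D i w)%R by have /andP[] := f01 k D i w.
have mf k (D : 'I_n -> set (\bar R)) i : (forall i, measurable (D i)) ->
    measurable_fun setT (f k D i).
  move=> mD; rewrite /f; case: (i < k)%N; first exact: measurableT_comp.
  by apply: measurable_indic; exact: mND.
have main k : (k <= n)%N -> forall D, (forall i, measurable (D i)) ->
    \int[P]_w (\prod_i f k D i w)%:E = \prod_i \int[P]_w (f k D i w)%:E.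
  elim: k => [_|k IH kn] D mD.
    rewrite /f; under eq_integral do rewrite prod_indic.
    rewrite integral_indic ?setIT //; last by apply: fin_bigcap_measurable => // i _; exact: mND.
    apply: (etrans (poisson_indep PP mA mD tA)); apply: eq_bigr => i _ /=.
    by rewrite integral_indic ?setIT //; exact: mND.
  pose j := Ordinal kn.
  have [B [mB gE]] := @harmonic_layers _ _ R (EFin \o g j)
    (proj2 (measurable_EFinP _ _) (mg j)) (fun y => g0 j y).
  pose D' m i := if i == j then B m else D i.
  have mD' m i : measurable (D' m i) by rewrite /D'; case: eqP.
  have fj m w : f k (D' m) j w = \1_(B m) (N j w).
    by rewrite /f ltnn /D' eqxx.
  have fi m i w : i != j -> f k.+1 D i w = f k (D' m) i w.
    move=> ij; rewrite /f /D' (negPf ij) ltnS leq_eqVlt.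
    by rewrite (negPf (ij : (i != k :> nat))).
  have fj' w : f k.+1 D j w = g j (N j w) by rewrite /f ltnSn.
  have h0 m : (0 <= harmonic m :> R)%R by exact: harmonic_ge0.
  have intg : \int[P]_w (g j (N j w))%:E =
      \sum_(m <oo) (harmonic m)%:E * \int[P]_w (f k (D' m) j w)%:E.
    under eq_integral do rewrite [_%:E]gE.
    rewrite integral_nneseries //; last 2 first.
    - move=> m; apply/measurable_EFinP/measurable_funM => //.
      by apply: measurableT_comp => //; exact: measurable_indic.
    - by move=> m w _; rewrite lee_fin mulr_ge0.
    apply: eq_eseriesr => m _; under eq_integral do rewrite EFinM -fj.
    rewrite ge0_integralZl_EFin //; last exact/measurable_EFinP/mf.
    by move=> w _; rewrite lee_fin.
  transitivity (\int[P]_w \sum_(m <oo) ((harmonic m)%:E * (\prod_i f k (D' m) i w)%:E)).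
    apply: eq_integral => w _; rewrite (bigD1 j) //= fj' mulrC EFinM [X in _ * X]gE.
    rewrite -nneseriesZl; last by move=> m _; rewrite lee_fin mulr_ge0.
    apply: eq_eseriesr => m _; rewrite [in RHS](bigD1 j) // fj -!EFinM; congr EFin.
    rewrite mulrCA mulrA mulrAC -mulrA; congr (_ * (_ * _))%R.
    by apply: eq_bigr => i ij; rewrite (fi m).
  rewrite integral_nneseries //; last 2 first.
  - move=> m; apply: measurable_funeM; apply/measurable_EFinP.
    by apply: measurable_prod => i _; exact: mf.
  - by move=> m w _; rewrite -EFinM lee_fin mulr_ge0 ?prodr_ge0.
  rewrite [RHS](bigD1 j) //=; under [X in _ = X * _]eq_integral do rewrite fj'.
  rewrite intg; set c := \prod_(i | i != j) _.
  have cfin : c \is a fin_num.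
    apply: (big_ind (fun x => x \is a fin_num)) => // [x y|i _]; first exact: fin_numM.
    rewrite ge0_fin_numE; last by apply: integral_ge0 => w _; rewrite lee_fin.
    apply: (@le_lt_trans _ _ (\int[P]_w (cst 1) w)); last first.
      by rewrite integral_cst // mul1e (le_lt_trans (probability_le1 P measurableT)) // ltry.
    apply: ge0_le_integral => //=.
    - by move=> w _; rewrite lee_fin.
    - by apply/measurable_EFinP; exact: mf.
    - by move=> w _; rewrite lee_fin; have /andP[] := f01 k.+1 D i w.
  rewrite -(fineK cfin) muleC -nneseriesZl; last first.
    move=> m _; rewrite mule_ge0 ?lee_fin //.
    by apply: integral_ge0 => w _; rewrite lee_fin.
  apply: eq_eseriesr => m _; rewrite ge0_integralZl_EFin //; last 2 first.
  - by move=> w _; rewrite lee_fin prodr_ge0.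
  - by apply/measurable_EFinP/measurable_prod => i _; exact: mf.
  rewrite IH ?(ltnW kn) // muleCA; congr (_ * _); rewrite (bigD1 j) //= muleC.
  congr (_ * _); rewrite fineK //; apply: eq_bigr => i ij.
  by apply: eq_integral => w _; rewrite (fi m).
have := main n (leqnn n) (fun=> setT) (fun=> measurableT).
rewrite /f; under eq_integral do under eq_bigr do rewrite ltn_ord.
by move=> ->; apply: eq_bigr => i _; under eq_integral do rewrite ltn_ord.
Qed.

End indep.
End poisson_functional.

(** * The Laplace functional of a Poisson process *)

Section laplace_functional.
Context (R : realType) d d' (Omega : measurableType d) (T : measurableType d').
Context (P : probability Omega R) (m : {measure set T -> \bar R})
  (nu : set T -> \bar R) (L : Omega -> set T).
Hypothesis PP : poisson_process P nu L.
Hypothesis nuE : forall A, measurable A -> nu A = m A.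
Local Open Scope ereal_scope.

Lemma expR_nneseries (x : R) : \sum_(k <oo) (exp_coeff x k)%:E = (expR x)%:E.
Proof.
rewrite /expR -EFin_lim; last exact: is_cvg_series_exp_coeff.
by congr (lim (_ @ \oo)); apply/funext => n; rewrite /= sumEFin.
Qed.

(** If A has finite intensity this is the generating function of the Poisson law;
    otherwise A almost surely contains infinitely many points, and both sides vanish
    unless y = 0. *)
Lemma laplace_point_count A (y : R) : measurable A -> (0 <= y)%R ->
  \int[P]_w (expNe (y%:E * point_count L A w))%:E =
  (expNe ((1 - expR (- y))%:E * m A))%:E.
Proof.
move=> mA; rewrite le_eqVlt => /predU1P[<-|y0].
  rewrite oppr0 expR0 subrr mul0e expNe0.
  under eq_integral do rewrite mul0e expNe0.
  by rewrite integral_cst // mul1e; exact: probability_setT.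
set N := point_count L A.
have N0 w : 0 <= N w by exact: point_count_ge0.
have mN : measurable_fun setT N by exact: (poisson_measurable PP).
have mNB D : measurable D -> measurable (N @^-1` D).
  by move=> mD; rewrite -[X in measurable X]setTI; exact: mN.
have yN w : 0 <= y%:E * N w by rewrite mule_ge0 // lee_fin ltW.
have ey1 : (0 < 1 - expR (- y))%R by rewrite subr_gt0 -(@expR0 R) ltr_expR oppr_lt0.
have [nuoo|nufin] := eqVneq (nu A) +oo.
  rewrite -nuE // nuoo gt0_muley ?lte_fin // expNe_y.
  apply/eqP; rewrite eq_le integral_ge0 ?andbT; last by move=> w _; rewrite lee_fin expNe_ge0.
  have mB : measurable (N @^-1` [set +oo]) by exact: mNB.
  have -> : 0%:E = P (~` (N @^-1` [set +oo])).
    rewrite probability_setC // [X in 1 - X](_ : _ = 1) ?subee //.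
    exact: (poisson_infty PP mA nuoo).
  rewrite -[X in _ <= P X]setIT -integral_indic //; last exact: measurableC.
  apply: ge0_le_integral => //=.
  - by move=> w _; rewrite lee_fin expNe_ge0.
  - by apply/measurable_EFinP/measurable_expNe/measurable_funeM.
  - by apply/measurable_EFinP/measurable_indic; exact: measurableC.
  move=> w _; rewrite lee_fin indicE; have [Nw|Nw] := eqVneq (N w) +oo.
    by rewrite Nw gt0_muley ?lte_fin // expNe_y.
  by rewrite mem_set ?expNe_le1 //= => /eqP; rewrite (negPf Nw).
have nuA : nu A \is a fin_num.
  by rewrite ge0_fin_numE ?ltey // nuE.
pose B k := [set w | N w = k%:R%:E].
have mB k : measurable (B k) by exact: (mNB [set k%:R%:E]).
pose l := fine (nu A).
transitivity (\int[P]_w \sum_(k <oo) (expR (- (y * k%:R)) * \1_(B k) w)%:E).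
  apply: eq_integral => w _.
  have [[k Nk]|Nk] := pselect (exists k : nat, N w = k%:R%:E).
    rewrite (@nneseriesD1 _ _ k) //.
    rewrite eseries0 ?adde0; last first.
      move=> j _ jk; rewrite indicE memNset ?mulr0 //= /B /= Nk => -[/eqP].
      by rewrite eqr_nat eq_sym (negPf jk).
    by rewrite indicE mem_set // mulr1 Nk -EFinM expNe_EFin.
  rewrite eseries0; last first.
    move=> j _ _; rewrite indicE memNset ?mulr0 //= /B /= => Nj; apply: Nk.
    by exists j.
  suff -> : N w = +oo by rewrite gt0_muley ?lte_fin // expNe_y.
  move: Nk; rewrite /N /point_count /counting; case: ifP => // _ Nk.
  by exfalso; apply: Nk; exists (size (finmap.enum_fset (fset_set (L w `&` A)))).
rewrite integral_nneseries //; last first.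
  by move=> k; apply/measurable_EFinP/measurable_funM => //; exact: measurable_indic.
transitivity (\sum_(k <oo) (expR (- l))%:E * (exp_coeff (l * expR (- y)) k)%:E).
  apply: eq_eseriesr => k _; under eq_integral do rewrite EFinM.
  rewrite ge0_integralZl_EFin ?expR_ge0 //; last exact/measurable_EFinP/measurable_indic.
  have -> : \int[P]_w (\1_(B k) w)%:E = (l ^+ k / k`!%:R * expR (- l))%:E.
    rewrite integral_indic // setIT.
    by apply: (poisson_fin PP) => //; rewrite ltey_eq nuA.
  rewrite -!EFinM /exp_coeff /= exprMn -expRM_natr mulNr; congr EFin; ring.
rewrite nneseriesZl; last first.
  move=> k _; rewrite lee_fin exp_coeff_ge0 // mulr_ge0 ?expR_ge0 //.
  by rewrite /l fine_ge0 // nuE.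
rewrite expR_nneseries -EFinM -expRD -(nuE mA) -(fineK nuA) -EFinM expNe_EFin.
by congr (expR _)%:E; rewrite /l /=; ring.
Qed.

Import HBNNSimple.

(** The level sets of f are finitely many and disjoint, so their point counts are
    independent. *)
Lemma laplace_simple (f : {nnsfun T >-> R}) :
  \int[P]_w (expNe (\esum_(t in L w) (f t)%:E))%:E =
  (expNe (\int[m]_t (1 - expR (- f t))%:E))%:E.
Proof.
pose s := finmap.enum_fset (fset_set (range f)).
pose y (i : 'I_(size s)) : R := (s`_i)%R; pose A i := f @^-1` [set y i].
have ys i : range f (y i).
  have : y i \in s by exact: mem_nth.
  by rewrite in_fset_set ?inE.
have y0 i : (0 <= y i)%R by have [t _ <-] := ys i.
have mA i : measurable (A i) by exact: measurable_sfunP.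
have tA : trivIset setT A.
  move=> i j _ _ [t [/= fi fj]]; apply/val_inj/eqP; have yij : y i = y j by rewrite -fi.
  by rewrite -(nth_uniq 0%R (ltn_ord i) (ltn_ord j)) ?finmap.fset_uniq //; apply/eqP.
have sumA (phi : R -> R) t : phi (f t) = (\sum_i phi (y i) * \1_(A i) t)%R.
  have fs : f t \in s by rewrite in_fset_set // inE; exists t.
  have lt : (index (f t) s < size s)%N by rewrite index_mem.
  rewrite (bigD1 (Ordinal lt)) //= indicE mem_set /A /y /= ?nth_index // mulr1.
  rewrite big1 ?addr0 // => i ine; rewrite indicE memNset ?mulr0 //= => fy.
  move/negP: ine; apply; apply/eqP/val_inj => /=.
  by rewrite fy index_uniq ?finmap.fset_uniq.
(* the absolute value keeps the values of g in the unit interval for every z *)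
pose g (i : 'I_(size s)) (z : \bar R) := expNe ((y i)%:E * `|z|).
have esumE w : \esum_(t in L w) (f t)%:E = \sum_i (y i)%:E * point_count L (A i) w.
  under eq_esum do rewrite (sumA id) -sumEFin.
  rewrite esum_sum; last by move=> t i _ _; rewrite lee_fin mulr_ge0.
  apply: eq_bigr => i _; under eq_esum do rewrite EFinM.
  by rewrite esumZl ?esum_indic // => t; rewrite lee_fin.
transitivity (\int[P]_w (\prod_i g i (point_count L (A i) w))%:E).
  apply: eq_integral => w _; rewrite esumE expNe_sum; last first.
    by move=> i; rewrite mule_ge0 ?lee_fin ?point_count_ge0.
  by congr EFin; apply: eq_bigr => i _; rewrite /g gee0_abs ?point_count_ge0.
rewrite (integral_prod_point_count PP mA tA); last 2 first.
- by move=> i; apply/measurable_expNe/measurable_funeM; exact: abse_measurable.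
- by move=> i z; apply: expNe_itv; rewrite mule_ge0 ?lee_fin ?abse_ge0.
transitivity (\prod_i (expNe ((1 - expR (- y i))%:E * m (A i)))%:E).
  apply: eq_bigr => i _; rewrite -laplace_point_count //.
  by apply: eq_integral => w _; rewrite /g gee0_abs ?point_count_ge0.
have ey i : (0 <= 1 - expR (- y i))%R by rewrite subr_ge0 -(@expR0 R) ler_expR oppr_le0.
rewrite prodEFin -expNe_sum; last by move=> i; rewrite mule_ge0 ?lee_fin.
congr (expNe _)%:E; under [RHS]eq_integral do rewrite (sumA (fun r => 1 - expR (- r)))%R -sumEFin.
rewrite ge0_integral_sum //; last 2 first.
- by move=> i; apply/measurable_EFinP/measurable_funM => //; exact: measurable_indic.
- by move=> i t _; rewrite lee_fin mulr_ge0.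
apply: eq_bigr => i _; under eq_integral do rewrite EFinM.
rewrite ge0_integralZl_EFin //; last exact/measurable_EFinP/measurable_indic.
by rewrite integral_indic // setIT.
Qed.

(** Both sides are limits along the increasing sequence of partial sums of layers, by
    dominated convergence on the left and by monotone convergence on the right. *)
Lemma laplace_poisson (f : T -> \bar R) : measurable_fun setT f ->
  (forall t, 0 <= f t) ->
  \int[P]_w (expNe (\esum_(t in L w) f t))%:E =
  (expNe (\int[m]_t (1 - expNe (f t))%:E))%:E.
Proof.
move=> mf f0; have [A [mA fE]] := harmonic_layers mf f0.
have h0 n : (0 <= harmonic n :> R)%R by exact: harmonic_ge0.
pose F n := sum_nnsfun (fun k => scale_nnsfun (indic_nnsfun R (mA k)) (h0 k)) n.
have FE n t : (F n t)%:E = \sum_(0 <= k < n) (harmonic k * \1_(A k) t)%:E.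
  by rewrite /F sum_nnsfunE -sumEFin big_mkord.
have cF t : (F n t)%:E @[n --> \oo] --> f t.
  rewrite fE; under eq_fun do rewrite FE.
  by apply: is_cvg_nneseries => n _ _; rewrite lee_fin mulr_ge0.
have ndF t n k : (n <= k)%N -> (F n t <= F k t)%R.
  move=> nk; rewrite -lee_fin !FE; apply: lee_sum_nneg_natr => // i _ _.
  by rewrite lee_fin mulr_ge0.
have ceL w : \esum_(t in L w) (F n t)%:E @[n --> \oo] --> \esum_(t in L w) f t.
  rewrite (esum_layers L fE).
  under eq_fun => n.
    under eq_esum do rewrite FE.
    rewrite esum_sum; last by move=> t i _ _; rewrite lee_fin mulr_ge0.
    under eq_bigr => k _.
      under eq_esum do rewrite EFinM.
      rewrite esumZl ?esum_indic //.
      over.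
    over.
  apply: is_cvg_nneseries => n _ _.
  by rewrite mule_ge0 ?lee_fin // point_count_ge0.
have lhs : \int[P]_w (expNe (\esum_(t in L w) (F n t)%:E))%:E @[n --> \oo] -->
    \int[P]_w (expNe (\esum_(t in L w) f t))%:E.
  have mE (h : T -> \bar R) : measurable_fun setT h -> (forall t, 0 <= h t) ->
      measurable_fun setT (fun w => (expNe (\esum_(t in L w) h t))%:E).
    move=> mh hh0; apply/measurable_EFinP/measurable_expNe. exact: (measurable_esum PP mh hh0).
  have eF0 n w : 0 <= \esum_(t in L w) (F n t)%:E.
    by apply: esum_ge0 => t _; rewrite lee_fin.
  apply: (@dominated_cvg _ _ _ _ _ _ _ _ (cst 1)) => //.
  - by move=> n; apply: mE => [|t]; [exact/measurable_EFinP|rewrite lee_fin].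
  - move=> w _; apply/cvg_EFin; first exact: nearW.
    exact: cvg_expNe.
  - exact: (@finite_measure_integrable_cst _ _ _ P _ 1%R).
  - by move=> n w _; rewrite lee_fin ger0_norm ?expNe_ge0 // expNe_le1.
have rhs : (expNe (\int[m]_t (1 - expR (- F n t))%:E))%:E @[n --> \oo] -->
    (expNe (\int[m]_t (1 - expNe (f t))%:E))%:E.
  have i0 n t : (0 <= 1 - expR (- F n t))%R.
    by rewrite subr_ge0 -(@expR0 R) ler_expR oppr_le0.
  apply/cvg_EFin; first exact: nearW.
  apply: cvg_expNe => [n|]; first by apply: integral_ge0 => t _; rewrite lee_fin.
  have -> : \int[m]_t (1 - expNe (f t))%:E =
      \int[m]_t (limn (fun n => (1 - expR (- F n t))%:E)).
    apply: eq_integral => t _; apply/esym/cvg_lim => //.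
    apply/cvg_EFin; first exact: nearW.
    apply: cvgB; first exact: cvg_cst.
    by under eq_fun do rewrite -expNe_EFin; apply: cvg_expNe => // n; rewrite lee_fin.
  apply: cvg_monotone_convergence => //.
  - move=> n; apply/measurable_EFinP/measurable_funB => //.
    by apply: measurableT_comp => //; exact: measurableT_comp.
  - by move=> n t _; rewrite lee_fin.
  - by move=> t _ n k nk; rewrite lee_fin lerD2l lerN2 ler_expR lerN2 ndF.
rewrite -(cvg_lim _ lhs) // -(cvg_lim _ rhs) //; congr (lim (_ @ \oo)).
by apply/funext => n; rewrite laplace_simple.
Qed.

End laplace_functional.

(** * Measurability of path functionals *)

Section pieces.
Context d d' (Z : measurableType d) (T : measurableType d').

Lemma measurable_fun_pieces (S : countType) (sk : Z -> S) (f : Z -> T) :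
  (forall s, measurable (sk @^-1` [set s])) ->
  (forall s, measurable_fun (sk @^-1` [set s]) f) -> measurable_fun setT f.
Proof.
move=> msk mf; pose E k := if unpickle k is Some s then sk @^-1` [set s] else set0.
rewrite (_ : setT = \bigcup_k E k).
  apply/measurable_fun_bigcup => k; rewrite /E; first by case: unpickle.
  by case: unpickle => [s|]; [exact: mf|exact: measurable_fun_set0].
apply/seteqP; split=> // z _; exists (pickle (sk z)) => //.
by rewrite /E pickleK.
Qed.

End pieces.

Section itinerary_measurability.
Context (R : realType) (G : graph).
Local Notation itinerary := (itinerary R G).
Implicit Types (w : itinerary) (x : vertex G) (es : seq (edge G)).

(** There are countably many skeletons, and on a fibre of the skeleton a functional
    depends on finitely many real coordinates; this is how measurability is proved below. *)
Definition skeleton w : vertex G * seq (edge G) := (itin_start w, itin_edges w).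

Lemma measurable_cyl x es (B : nat -> set (measurableTypeR R)) (D : set (\bar R)) :
  (forall k, measurable (B k)) -> measurable D ->
  measurable [set w : itinerary | [/\ itin_start w = x, itin_edges w = es,
               forall k, (k < size es)%N -> B k (nth 0 (itin_times w) k) &
               D (itin_last w)]].
Proof. by move=> mB mD; apply: sub_sigma_algebra; exists x, es, B, D. Qed.

Lemma measurable_skeleton s : measurable (skeleton @^-1` [set s]).
Proof.
case: s => x es; have := @measurable_cyl x es (fun=> setT) setT (fun=> measurableT) measurableT.
congr measurable; apply/seteqP; split => w /=; first by case=> <- <-.
by move=> [-> ->].
Qed.

Definition itin_time k w : R := nth 0 (itin_times w) k.

Lemma measurable_itin_time k : measurable_fun setT (itin_time k).
Proof.
apply: (measurable_fun_pieces measurable_skeleton) => -[x es] mS B mB.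
have [ks|ks] := ltnP k (size es).
  have := @measurable_cyl x es (fun j => if j == k then B else setT) setT _ measurableT.
  rewrite (_ : [set w | _] = skeleton @^-1` [set (x, es)] `&` itin_time k @^-1` B).
    by apply=> j; case: ifP.
  apply/seteqP; split => w /=.
    case=> xE eE h _; split; first by rewrite /skeleton xE eE.
    by have := h k ks; rewrite eqxx.
  move=> [[-> ->] kB]; split=> // j jes; case: eqP => // ->; exact: kB.
have t0 w : skeleton w = (x, es) -> itin_time k w = 0.
  move=> [_ ees]; rewrite /itin_time nth_default //.
  by move: ks; rewrite -ees !size_map.
have [B0|B0] := pselect (B 0).
  rewrite (_ : _ `&` _ = skeleton @^-1` [set (x, es)]) //.
  by apply/seteqP; split => w /= => [[]|h] //; split=> //; rewrite t0.
rewrite (_ : _ `&` _ = set0) //.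
by apply/seteqP; split => w //= -[/t0 ->].
Qed.

Lemma measurable_itin_last : measurable_fun setT (@itin_last R G).
Proof.
apply: (measurable_fun_pieces measurable_skeleton) => -[x es] mS D mD.
have := @measurable_cyl x es (fun=> setT) D (fun=> measurableT) mD.
congr measurable; apply/seteqP; split => w /=; first by case=> <- <- _.
by move=> [[-> ->]].
Qed.

Lemma measurable_fun_skeleton d (T : measurableType d) (q : vertex G * seq (edge G) -> T) :
  measurable_fun setT (fun w => q (skeleton w)).
Proof.
apply: (measurable_fun_pieces measurable_skeleton) => s mS B mB.
have [Bq|Bq] := pselect (B (q s)).
  rewrite (_ : _ `&` _ = skeleton @^-1` [set s]) //.
  by apply/seteqP; split => w /= => [[]|h] //; split=> //; rewrite h.
rewrite (_ : _ `&` _ = set0) //.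
by apply/seteqP; split => w //= -[->].
Qed.

Definition itin_cons x (e : edge G) (p : measurableTypeR R * itinerary) : itinerary :=
  (x, (p.1, e) :: itin_jumps p.2, itin_last p.2).

Lemma measurable_itin_cons x e : measurable_fun setT (itin_cons x e).
Proof.
apply: (@measurability _ _ _ _ _ _ (@itin_cylinder R G)) => //.
move=> _ [_ [y [es' [B [D [mB mD ->]]]]] <-]; rewrite setTI.
have [->|xy] := eqVneq y x; last first.
  by rewrite (_ : _ @^-1` _ = set0) //; apply/seteqP; split=> // -[s w] /= [xy']; move: xy; rewrite -xy' eqxx.
case: es' => [|e' es].
  by rewrite (_ : _ @^-1` _ = set0) //; apply/seteqP; split=> // -[s w] /= [].
have [->|ee] := eqVneq e' e; last first.
  rewrite (_ : _ @^-1` _ = set0) //; apply/seteqP; split=> // -[s w] /= [_ [ee']].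
  by move: ee; rewrite ee' eqxx.
rewrite (_ : _ @^-1` _ = \bigcup_(z in [set: vertex G]) (B 0%N `*`
   [set w | [/\ itin_start w = z, itin_edges w = es,
               forall k, (k < size es)%N -> B k.+1 (nth 0 (itin_times w) k) &
               D (itin_last w)]])).
  apply: fin_bigcup_measurable => // z _; apply: measurableX => //.
  exact: (@measurable_cyl z es (fun k => B k.+1)).
apply/seteqP; split=> -[s w] /=.
  move=> [_ [es'] h Dw]; exists (itin_start w) => //; split; first exact: (h 0%N).
  by split=> // k ks; exact: (h k.+1).
move=> [z _ [/= Bs [_ <- h Dw]]]; split=> //.
by case=> [|k] ks //; exact: h.
Qed.

Lemma measurable_itin_nil d (Z : measurableType d) x (t : Z -> \bar R) :
  measurable_fun setT t -> measurable_fun setT (fun z => (x, [::], t z) : itinerary).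
Proof.
move=> mt; apply: (@measurability _ _ _ _ _ _ (@itin_cylinder R G)) => //.
move=> _ [_ [y [es' [B [D [mB mD ->]]]]] <-].
have [/andP[/eqP xy /eqP es0]|nP] := boolP ((x == y) && (es' == [::])).
  rewrite (_ : _ `&` _ = setT `&` t @^-1` D); first exact: mt.
  by apply/seteqP; split=> z /= => [[_ []]|[_ Dz]] //; rewrite es0.
rewrite (_ : _ `&` _ = set0) //; apply/seteqP; split=> // z /= [_ [e1 e2 _ _]].
by move: nP; rewrite -e1 -e2 !eqxx.
Qed.

(** On a fibre of the skeleton, the jumps are rebuilt from a sequence t of measurable
    holding times; this allows an induction on the edges es. *)
Fixpoint jumps_from (t : nat -> R) k es : seq (R * edge G) :=
  if es is e :: es' then (t k, e) :: jumps_from t k.+1 es' else [::].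

Lemma itin_jumpsE w : itin_jumps w = jumps_from (itin_time^~ w) 0 (itin_edges w).
Proof.
case: w => -[x js] l; rewrite /itin_jumps /=.
suff h k (t : nat -> R) : (forall j, t (k + j)%N = nth 0 (map fst js) j) ->
  js = jumps_from t k (map snd js) by exact: h.
elim: js k => [|[s e] js IH] k // h /=; congr ((_, _) :: _).
  by have := h 0%N; rewrite addn0.
by apply: IH => j; rewrite addSnnS h.
Qed.

Section stop.
Context d (Z : measurableType d) (tau : nat -> Z -> R).
Hypothesis mtau : forall k, measurable_fun setT (tau k).

Lemma measurable_stop_jumps es k x (t : Z -> R) : measurable_fun setT t ->
  measurable_fun setT (fun z => let p := stop_rec (jumps_from (tau^~ z) k es) (t z) in
    (x, p.1, p.2%:E) : itinerary).
Proof.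
elim: es k x t => [|e es IH] k x t mt /=.
  by apply: measurable_itin_nil; exact/measurable_EFinP.
pose f z : itinerary := (x, [::], (t z)%:E).
pose g z := itin_cons x e (tau k z,
  let p := stop_rec (jumps_from (tau^~ z) k.+1 es) (t z - tau k z) in
  (x, p.1, p.2%:E) : itinerary).
rewrite (_ : (fun z => _) = fun z => if t z < tau k z then f z else g z).
  apply: measurable_fun_ifT.
  - exact: measurable_fun_ltr.
  - by apply: measurable_itin_nil; exact/measurable_EFinP.
  - apply: (measurableT_comp (measurable_itin_cons x e)).
    apply/measurable_fun_pairP; split => //.
      exact: mtau.
    by apply: (IH k.+1 x (fun z => t z - tau k z)); apply: measurable_funB.
by apply/funext => z; case: ifP.
Qed.

Lemma measurable_visits_jumps (y : vertex G) es k x (l : Z -> \bar R) : measurable_fun setT l ->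
  measurable_fun setT (fun z =>
    (\sum_(v <- visits_rec x (jumps_from (tau^~ z) k es) (l z) | v.1 == y) v.2)%E).
Proof.
move=> ml; elim: es k x => [|e es IH] k x /=.
  under eq_fun do rewrite big_cons big_nil /=.
  by case: (x == y); [under eq_fun do rewrite addr0|exact: measurable_cst].
under eq_fun do rewrite big_cons /=.
have [_|_] := eqVneq x y; last exact: IH.
by apply: emeasurable_funD; [exact/measurable_EFinP|exact: IH].
Qed.

End stop.

Lemma measurable_stop :
  measurable_fun setT (fun p : itinerary * measurableTypeR R => stop p.1 p.2).
Proof.
have msk s : measurable ((fun p : itinerary * measurableTypeR R => skeleton p.1) @^-1` [set s]).
  rewrite (_ : _ @^-1` _ = (skeleton @^-1` [set s]) `*` setT).
    by apply: measurableX => //; exact: measurable_skeleton.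
  by apply/seteqP; split => -[w t] //= [].
apply: (measurable_fun_pieces msk) => -[x es].
apply: (@eq_measurable_fun _ _ _ _ _ (fun p : itinerary * measurableTypeR R =>
   let q := stop_rec (jumps_from (itin_time^~ p.1) 0 es) p.2 in (x, q.1, q.2%:E) : itinerary)).
  by move=> p; rewrite inE /= => -[<- <-]; rewrite /stop itin_jumpsE.
apply: measurable_funTS; apply: (measurable_stop_jumps (tau := fun k p => itin_time k p.1)) => //.
by move=> k; apply: measurableT_comp => //; exact: measurable_itin_time.
Qed.

End itinerary_measurability.

Lemma measurable_local_time (R : realType) (G : wgraph R) (x : vertex G) :
  measurable_fun setT (@local_time R G x).
Proof.
apply: measurable_funeM.
apply: (measurable_fun_pieces (@measurable_skeleton R G)) => -[y es].
have E : {in (@skeleton R G) @^-1` [set (y, es)], (fun w : itinerary R G =>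
     \sum_(v <- visits_rec y (jumps_from (fun k => @itin_time R G k w) 0 es) (itin_last w) | v.1 == x) v.2)%E =1
   (fun w => \sum_(v <- visits w | v.1 == x) v.2)%E}.
  by move=> w; rewrite inE /= => -[<- <-]; rewrite /visits itin_jumpsE.
apply: (eq_measurable_fun _ E).
apply: measurable_funTS; apply: (measurable_visits_jumps (tau := @itin_time R G)) => //.
- exact: measurable_itin_time.
- exact: measurable_itin_last.
Qed.

(** * The law of the random walk *)

Lemma esum_finType (R : realType) (I : finType) (a : I -> \bar R) :
  (forall i, 0 <= a i)%E -> \esum_(i in [set: I]) a i = \sum_i a i.
Proof.
move=> a0; have -> : [set: I] = [set` index_enum I].
  by apply/seteqP; split => // i _ /=; rewrite mem_index_enum.
rewrite esum_fset //.
by rewrite -fsbig_seq ?index_enum_uniq.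
Qed.

Section walk.
Context (R : realType) (G : wgraph R).
Implicit Types (x : vertex G) (es : seq (edge G)).
Local Notation itinerary := (itinerary R G).

Lemma tuple_measure_walk_ge0 x es (H : itinerary -> \bar R) : (forall w, (0 <= H w)%E) ->
  (0 <= (walk_prob x es)%:E *
    \int[tuple_measure exponential1 (size es)]_t H (@well_path R G x es t))%E.
Proof.
move=> H0; rewrite mule_ge0 ?lee_fin ?walk_prob_ge0 //.
by apply: integral_ge0 => t _; exact: H0.
Qed.

Lemma integral_walk_law x (H : itinerary -> \bar R) :
  measurable_fun setT H -> (forall w, (0 <= H w)%E) ->
  (\int[walk_law x]_w H w)%E = (\esum_(es in [set: seq (edge G)]) ((walk_prob x es)%:E *
    \int[tuple_measure exponential1 (size es)]_t H (@well_path R G x es t)))%E.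
Proof.
move=> mH H0; rewrite /walk_law ge0_integral_measure_series //.
pose a es := ((walk_prob x es)%:E *
  \int[tuple_measure exponential1 (size es)]_t H (@well_path R G x es t))%E.
have a0 es : (0 <= a es)%E by exact: tuple_measure_walk_ge0.
transitivity (\sum_(k <oo) (if @pickle_inv (seq (edge G)) k is Some es then a es else 0))%E.
  apply: eq_eseriesr => k _; case: pickle_inv => [es|]; last exact: integral_measure_zero.
  rewrite /walk_term ge0_integral_mscale //; congr (_ * _)%E.
  exact: (etrans (ge0_integral_pushforward (measurable_well_path x (es:=es)) _ measurableT mH _)).
rewrite nneseries_esumT; last by move=> k; case: pickle_inv.
transitivity (\esum_(k in (pickle : seq (edge G) -> nat) @` setT)
    (if @pickle_inv (seq (edge G)) k is Some es then a es else 0%E)).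
  rewrite [RHS]esum_mkcond; apply: eq_esum => k _.
  case: ifPn => // /negP; rewrite inE => nk.
  case ek: (pickle_inv k) => [es|] //; exfalso; apply: nk; exists es => //.
  by have := @pickle_invK (seq (edge G)) k; rewrite /ocancel ek.
rewrite esum_image; first by apply: eq_esum => es _; rewrite pickleK_inv.
by move=> es es' _ _; exact: (pcan_inj pickleK).
Qed.

Lemma esum_walk_prob_proper x (a : seq (edge G) -> \bar R) : x \notin well G ->
  (forall es, 0 <= a es)%E ->
  (\esum_(es in [set: seq (edge G)]) ((walk_prob x es)%:E * a es) =
   \sum_(e | src e == x) (cond e / lambda x)%:E *
     \esum_(es in [set: seq (edge G)]) ((walk_prob (tgt e) es)%:E * a (e :: es)))%E.
Proof.
move=> xW a0.
have b0 y es c : (0 <= (walk_prob y es)%:E * a c)%E.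
  by rewrite mule_ge0 ?lee_fin ?walk_prob_ge0.
have c0 e : 0 <= cond e / lambda x.
  by rewrite divr_ge0 ?lambda_ge0 // ltW // cond_gt0.
transitivity (\esum_(p in [set: edge G * seq (edge G)])
    ((walk_prob x (p.1 :: p.2))%:E * a (p.1 :: p.2)))%E.
  rewrite -(esum_image setT (fun p : edge G * seq (edge G) => p.1 :: p.2)
     (fun es => (walk_prob x es)%:E * a es)%E); last by move=> [e es] [e' es'] _ _ [-> ->].
  rewrite [RHS]esum_mkcond; apply: eq_esum => -[|e es] _; last first.
    by rewrite mem_set //; exists (e, es).
  by case: ifP => // _; rewrite /= (negPf xW) mul0e.
rewrite (_ : [set: edge G * seq (edge G)] = [set: edge G] `*`` (fun=> setT)); last first.
  by apply/seteqP; split.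
rewrite -(@esum_esum _ _ _ setT (fun=> setT) (fun e es =>
   (walk_prob x (e :: es))%:E * a (e :: es))%E) //.
rewrite esum_finType; last by move=> e; apply: esum_ge0.
rewrite [RHS]big_mkcond; apply: eq_bigr => e _ /=; rewrite (negPf xW).
case: ifPn => exs; last by rewrite esum1 // => es _; rewrite mul0r mul0e.
rewrite -esumZl //; apply: eq_esum => es _.
by rewrite EFinM muleA.
Qed.

Lemma esum_walk_prob_well x (a : seq (edge G) -> \bar R) : x \in well G ->
  (forall es, 0 <= a es)%E ->
  (\esum_(es in [set: seq (edge G)]) ((walk_prob x es)%:E * a es) = a [::])%E.
Proof.
move=> xW a0; rewrite (esumID [set [::]]) // ?setTI ?setTC; last first.
  by move=> es _; rewrite mule_ge0 ?lee_fin ?walk_prob_ge0.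
rewrite esum_set1 /= ?xW ?mul1e // esum1 ?adde0 // => -[/(_ erefl)|e es _] //=.
by rewrite xW mul0e.
Qed.

Lemma lambda_gt0 x : 0 < lambda x.
Proof.
suff [e ex] : exists e : edge G, src e = x.
  rewrite /lambda (bigD1 e) ?ex //= ltr_wpDr ?cond_gt0 // sumr_ge0 // => e' _.
  exact/ltW/cond_gt0.
have [y xy] : exists y, y != x.
  have /set0Pn[w wW] := well_n0 G.
  have /properP[_ [v _ vW]] := well_proper G.
  have [->|wx] := eqVneq x w; last by exists w; rewrite eq_sym.
  by exists v; apply: contraNneq vW => ->.
have /connectP[p] := wgraph_connected x y.
case: p => [|z p] /=; first by move=> _ yx; move: xy; rewrite yx eqxx.
by move=> /andP[/existsP[e /andP[/eqP ex _]] _] _; exists e.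
Qed.

Lemma sum_jump_prob x : \sum_(e : edge G | src e == x) cond e / lambda x = 1.
Proof. by rewrite -mulr_suml divff // gt_eqF // lambda_gt0. Qed.

Lemma jump_prob_ge0 (e : edge G) x : 0 <= cond e / lambda x.
Proof. by rewrite divr_ge0 ?lambda_ge0 // ltW // cond_gt0. Qed.

Definition hit_prob x : \bar R := (\esum_(es in [set: seq (edge G)]) (walk_prob x es)%:E)%E.

Lemma hit_prob_well x : x \in well G -> hit_prob x = 1%E.
Proof.
move=> xW; rewrite -[RHS](esum_walk_prob_well xW (fun=> lee01)).
by apply: eq_esum => es _; rewrite mule1.
Qed.

Lemma hit_prob_proper x : x \notin well G ->
  hit_prob x = (\sum_(e | src e == x) (cond e / lambda x)%:E * hit_prob (tgt e))%E.
Proof.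
move=> xW; transitivity (\esum_(es in [set: seq (edge G)]) ((walk_prob x es)%:E * 1))%E.
  by apply: eq_esum => es _; rewrite mule1.
rewrite esum_walk_prob_proper //; apply: eq_bigr => e _; congr (_ * _)%E.
by apply: eq_esum => es _; rewrite mule1.
Qed.

Lemma hit_prob_ge0 x : (0 <= hit_prob x)%E.
Proof. by apply: esum_ge0 => es _; rewrite lee_fin walk_prob_ge0. Qed.

(** Walks with fewer than n edges have total probability at most 1, by induction on n,
    and any finite set of walks has bounded length. *)
Lemma hit_prob_le1 x : (hit_prob x <= 1)%E.
Proof.
pose h n y := (\esum_(es in [set: seq (edge G)])
  ((walk_prob y es)%:E * ((size es < n)%N%:R : R)%:E))%E.
have h1 n y : (h n y <= 1)%E.
  elim: n y => [|n IH] y.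
    rewrite /h esum1 // => es _; exact: mule0.
  have [yW|yW] := boolP (y \in well G).
    by rewrite /h esum_walk_prob_well // => es; rewrite lee_fin.
  rewrite /h esum_walk_prob_proper //.
  rewrite -[leRHS](congr1 EFin (sum_jump_prob y)) -sumEFin; apply: lee_sum => e _.
  rewrite -[leRHS]mule1; apply: lee_wpmul2l; first by rewrite lee_fin jump_prob_ge0.
  exact: IH.
apply: ge_ereal_sup => _ [F [finF _] <-].
pose n := (\max_(es <- finmap.enum_fset (fset_set F)) size es).+1.
apply: le_trans (h1 n x); apply: esum_ge; exists F => //.
rewrite !fsbig_finite //= big_seq [leRHS]big_seq; apply: lee_sum => es esF.
have -> : (size es < n)%N by rewrite ltnS (leq_bigmax_seq _ esF).
by rewrite mule1.
Qed.

(** Maximum principle: the probability u of never reaching the well is harmonic at the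
    proper vertices, so that the set A of its maximum points is stable under adjacency as
    long as the maximum is positive.  By connectedness A would meet the well, where u
    vanishes. *)
Lemma hit_prob1 x : hit_prob x = 1%E.
Proof.
have hfin y : hit_prob y \is a fin_num.
  by rewrite ge0_fin_numE ?hit_prob_ge0 // (le_lt_trans (hit_prob_le1 y)) // ltry.
pose u y : R := 1 - fine (hit_prob y).
have u0 y : 0 <= u y.
  by rewrite subr_ge0 -lee_fin fineK // hit_prob_le1.
have uW y : y \in well G -> u y = 0 by move=> yW; rewrite /u hit_prob_well // subrr.
have uP y : y \notin well G -> u y = \sum_(e | src e == y) cond e / lambda y * u (tgt e).
  move=> yW; rewrite /u hit_prob_proper // -[X in X - _](sum_jump_prob y).
  have -> : (\sum_(e | src e == y) (cond e / lambda y)%:E * hit_prob (tgt e) =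
      (\sum_(e | src e == y) cond e / lambda y * fine (hit_prob (tgt e)))%:E)%E.
    by rewrite -sumEFin; apply: eq_bigr => e _; rewrite [RHS]EFinM fineK.
  rewrite -sumrB; apply: eq_bigr => e _.
  by rewrite mulrBr mulr1.
pose M := u [arg max_(y > x) u y]%O.
have uM y : u y <= M by rewrite /M; case: arg_maxP => // z _; apply.
have M0 : M = 0.
  pose A := [pred y | u y == M].
  have MA : u [arg max_(y > x) u y]%O = M by [].
  have stepA y z : Defs.adjacent y z -> y \in A -> 0 < M -> z \in A.
    move=> /existsP[e0 /andP[/eqP se te]]; rewrite !inE => /eqP yM Mgt0.
    have yW : y \notin well G by apply/negP => /uW uy; move: Mgt0; rewrite -yM uy ltxx.
    have : \sum_(e | src e == y) cond e / lambda y * (M - u (tgt e)) = 0.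
      under eq_bigr do rewrite mulrBr.
      by rewrite sumrB -mulr_suml sum_jump_prob mul1r -uP // yM subrr.
    move/eqP; rewrite psumr_eq0; last first.
      by move=> e _; rewrite mulr_ge0 ?jump_prob_ge0 // subr_ge0.
    move/allP => /(_ e0 (mem_index_enum _)); rewrite se eqxx /= mulf_eq0.
    have -> : (cond e0 / lambda y == 0) = false.
      by rewrite gt_eqF // divr_gt0 ?cond_gt0 ?lambda_gt0.
    by rewrite /= subr_eq0 (eqP te) eq_sym.
  have [M0|//] := leP M 0; first by apply/eqP; rewrite eq_le M0 (le_trans (u0 x)).
  move=> Mgt0; have /set0Pn[w wW] := well_n0 G.
  have /connectP[p] := wgraph_connected [arg max_(y > x) u y]%O w.
  have : [arg max_(y > x) u y]%O \in A by rewrite inE MA.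
  elim: p ([arg max_(y > x) u y]%O) => [|z p IH] y yA /=.
    by move=> _ wy; rewrite -(eqP yA) -wy uW.
  by move=> /andP[yz zp]; apply: IH => //; exact: stepA yz yA Mgt0.
have ux : u x = 0 by apply/eqP; rewrite eq_le u0 andbT -M0.
by rewrite -(fineK (hfin x)); congr EFin; apply/eqP; rewrite eq_sym -subr_eq0; apply/eqP.
Qed.

End walk.

(** * Exponential holding times *)

Section tuple_integral.
Context d (T : measurableType d) (R : realType).
Variable m : {sigma_finite_measure set T -> \bar R}.
Local Open Scope ereal_scope.

Lemma integral_tupleS n (H : n.+1.-tuple T -> \bar R) :
  measurable_fun setT H -> (forall t, 0 <= H t) ->
  \int[tuple_measure m n.+1]_t H t = \int[m \x tuple_measure m n]_p H (tcons p).
Proof.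
move=> mH H0.
by rewrite (ge0_integral_pushforward (@measurable_tcons _ _ n)).
Qed.

End tuple_integral.

Section exponential_times.
Context (R : realType).
Local Notation E1 := (@exponential1 R).
Local Notation leb := (@lebesgue_measure R).
Local Open Scope ereal_scope.

Lemma integral_exponential1 (f : measurableTypeR R -> \bar R) :
  measurable_fun setT f -> (forall t, 0 <= f t) ->
  \int[E1]_t f t = \int[leb]_(t in `[0%R, +oo[) (f t * (expR (- t))%:E).
Proof.
move=> mf f0.
have := @integral_image_density _ _ (measurableTypeR R) (measurableTypeR R) R unit [:: tt] xpredT
  E1 (fun=> leb) idfun (fun=> exponential_pdf 1).
move=> -> //.
- rewrite big_seq1 /= [RHS]integral_mkcond; apply: eq_integral => t _ /=.
  rewrite patchE /exponential_pdf patchE; case: ifP => _; last by rewrite mule0.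
  by rewrite mul1r mulN1r.
- exact: measurable_id.
- by move=> _; exact: measurable_exponential_pdf.
- by move=> _ t; exact: exponential_pdf_ge0.
- move=> A mA; rewrite big_seq1.
  transitivity (\int[leb]_(t in A) (exponential_pdf 1 t)%:E); first by [].
  rewrite [LHS]integral_mkcond; apply: eq_integral => t _; rewrite patchE indicE.
  by case: (t \in A); rewrite ?mul1r ?mul0r.
Qed.

Lemma integral_expR_0y (c : R) : (0 < c)%R ->
  \int[leb]_(t in `[0%R, +oo[) (expR (- (c * t)))%:E = (c^-1)%:E.
Proof.
move=> c0; have := integral_exponential_pdf c0.
rewrite (_ : (fun t => _) = ((fun t => c%:E * (expR (- (c * t)))%:E) \_ `[0%R, +oo[)); last first.
  apply/funext => t; rewrite patchE /exponential_pdf patchE; case: ifP => // _.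
  by rewrite mulNr.
rewrite -integral_mkcond ge0_integralZl_EFin ?ltW //; last first.
  by apply/measurable_EFinP; apply: measurable_funTS; do 3 apply: measurableT_comp => //.
set I := \int[leb]_(t in _) _ => cI.
by rewrite -[I]mul1e -(@mulVf _ c) ?gt_eqF // EFinM -muleA cI mule1.
Qed.

Lemma measurable_expR_lin (c : R) D : measurable_fun D (fun t : measurableTypeR R => expR (- (c * t))).
Proof. by apply: measurable_funTS; do 3 apply: measurableT_comp => //. Qed.

Lemma integral_expR_exp (c : R) : (0 < c)%R ->
  \int[leb]_(t in `[0%R, +oo[) (expR (- (c * t)) * expR (- t))%:E = ((1 + c)^-1)%:E.
Proof.
move=> c0; rewrite -integral_expR_0y ?addr_gt0 //; apply: eq_integral => t _.
by rewrite -expRD; congr (expR _)%:E; ring.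
Qed.

Lemma integral_expR_0itv (c a : R) : (0 < c)%R -> (0 <= a)%R ->
  \int[leb]_(t in `[0%R, a[) (expR (- (c * t)))%:E = ((1 - expR (- (c * a))) / c)%:E.
Proof.
move=> c0 a0; have e0 t : 0 <= (expR (- (c * t)))%:E by rewrite lee_fin expR_ge0.
have me D : measurable_fun D (fun t : measurableTypeR R => (expR (- (c * t)))%:E).
  by apply/measurable_EFinP; exact: measurable_expR_lin.
have tail : \int[leb]_(t in `[a, +oo[) (expR (- (c * t)))%:E = (expR (- (c * a)) / c)%:E.
  transitivity (\int[leb]_(t in `[a, +oo[) (expR (- (c * a)) * expR (- (c * (t - a))))%:E).
    by apply: eq_integral => t _; rewrite -expRD; congr (expR _)%:E; ring.
  rewrite (@integral_shift _ a (fun t => (expR (- (c * a)) * expR (- (c * t)))%:E)); last 2 first.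
  - by apply/measurable_EFinP/measurable_funM => //; exact: measurable_expR_lin.
  - by move=> t; rewrite lee_fin mulr_ge0 ?expR_ge0.
  under eq_integral do rewrite EFinM.
  by rewrite ge0_integralZl_EFin ?expR_ge0 // integral_expR_0y.
have : \int[leb]_(t in `[0%R, +oo[) (expR (- (c * t)))%:E = (c^-1)%:E by exact: integral_expR_0y.
have -> : `[0%R, +oo[%classic = `[0%R, a[%classic `|` `[a, +oo[%classic.
  by rewrite -itv_bndbnd_setU ?bnd_simp.
rewrite ge0_integral_setU //=; last first.
  rewrite disj_set2E; apply/eqP/seteqP; split => // t [] /=.
  by rewrite !in_itv /= => /andP[_ ta] /andP[at_ _]; move: (lt_le_trans ta at_); rewrite ltxx.
rewrite tail => /esym/eqP; rewrite -sube_eq ?fin_num_adde_defl // => /eqP <-.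
by rewrite -EFinB; congr EFin; rewrite mulrBl mul1r.
Qed.

Lemma onem_expR_ge0 (c s : R) : (0 < c)%R -> (0 <= s)%R ->
  (0 <= (1 - expR (- (c * s))) / c)%R.
Proof.
move=> c0 s0; apply: divr_ge0; last exact: ltW.
by rewrite subr_ge0 -(@expR0 R) ler_expR oppr_le0 mulr_ge0 // ltW.
Qed.

Lemma integral_onem_expR_exp (c : R) : (0 < c)%R ->
  \int[leb]_(t in `[0%R, +oo[) ((1 - expR (- (c * t))) / c * expR (- t))%:E =
  ((1 + c)^-1)%:E.
Proof.
move=> c0; have e1 D : measurable_fun D (fun t : measurableTypeR R => expR (- t)).
  by have := @measurable_expR_lin 1 D; under eq_fun do rewrite mul1r.
have mc D : measurable_fun D (fun t : measurableTypeR R => (c^-1 * (expR (- (c * t)) * expR (- t)))%:E).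
  by apply/measurable_EFinP; do 2 apply: measurable_funM => //; exact: measurable_expR_lin.
have mB D : measurable_fun D (fun t : measurableTypeR R => ((1 - expR (- (c * t))) / c * expR (- t))%:E).
  apply/measurable_EFinP; do 2 apply: measurable_funM => //.
  by apply: measurable_funB => //; exact: measurable_expR_lin.
have tot : \int[leb]_(t in `[0%R, +oo[)
    (((1 - expR (- (c * t))) / c * expR (- t))%:E +
     (c^-1 * (expR (- (c * t)) * expR (- t)))%:E) = (c^-1)%:E.
  transitivity (\int[leb]_(t in `[0%R, +oo[) ((c^-1)%:E * (expR (- (1 * t)))%:E)).
    by apply: eq_integral => t _; rewrite -EFinD -EFinM mul1r; congr EFin; ring.
  rewrite ge0_integralZl_EFin ?invr_ge0 ?ltW //.
  - by rewrite integral_expR_0y // invr1 mule1.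
  - by apply/measurable_EFinP; exact: measurable_expR_lin.
move: tot; rewrite ge0_integralD //=; last 2 first.
- move=> t; rewrite in_itv /= andbT => t0; rewrite lee_fin mulr_ge0 ?expR_ge0 //.
  exact: onem_expR_ge0.
- move=> t _; rewrite lee_fin; apply: mulr_ge0; first by rewrite invr_ge0 ltW.
  by rewrite mulr_ge0 ?expR_ge0.
under [X in _ + X]eq_integral do rewrite EFinM.
rewrite ge0_integralZl_EFin ?invr_ge0 ?ltW //; last first.
  by apply/measurable_EFinP; apply: measurable_funM => //; exact: measurable_expR_lin.
rewrite integral_expR_exp // -EFinM => /esym/eqP.
rewrite -sube_eq ?fin_num_adde_defl // => /eqP <-.
rewrite -EFinB; congr EFin; field; rewrite ?gt_eqF //= ?addr_gt0 //.
Qed.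

End exponential_times.

(** * The stopped walk, weighted by its edges *)

Section exponential_tuple.
Context (R : realType).
Local Notation E1 := (@exponential1 R).
Local Open Scope ereal_scope.

Lemma tuple_measure_setT n : tuple_measure E1 n setT = 1.
Proof.
elim: n => [|n IH]; first by rewrite /= diracT.
rewrite /= /tcons_measure /pushforward preimage_setT -setXTT.
by rewrite product_measure1E // IH mule1; exact: probability_setT.
Qed.

Lemma integral_exponential_tupleS n (H : n.+1.-tuple (measurableTypeR R) -> \bar R) :
  measurable_fun setT H -> (forall t, 0 <= H t) ->
  \int[tuple_measure E1 n.+1]_t H t =
  \int[E1]_s \int[tuple_measure E1 n]_t H (tcons (s, t)).
Proof.
move=> mH H0; rewrite integral_tupleS //.
rewrite (fubini_tonelli1 (fun p => H (tcons p))) //.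
by apply: measurableT_comp => //; exact: measurable_tcons.
Qed.

End exponential_tuple.

Section stopped.
Context (R : realType) (G : wgraph R).
Local Notation itinerary := (itinerary R G).
Local Notation leb := (@lebesgue_measure R).
Implicit Types (x y : vertex G) (es : seq (edge G)) (w : itinerary) (q : seq (edge G) -> R)
  (theta : vertex G -> R).

(** The time spent at y; local_time is this divided by lambda y. *)
Definition occ y w : \bar R := (\sum_(v <- visits w | v.1 == y) v.2)%E.

Definition cost theta w : R := \sum_y theta y * fine (occ y w).

Lemma measurable_occ y : measurable_fun setT (occ y).
Proof.
have := measurable_funeM (lambda y)%:E (@measurable_local_time R G y).
congr measurable_fun; apply/funext => w.
by rewrite /local_time muleA -EFinM divff ?mul1e // gt_eqF // lambda_gt0.
Qed.

Lemma measurable_cost theta : measurable_fun setT (cost theta).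
Proof.
apply: measurable_sum => y; apply: measurable_funM => //.
by apply: measurableT_comp => //; exact: measurable_occ.
Qed.

Lemma occ_nil y x (s : R) : occ y (x, [::], s%:E) = (if x == y then s else 0)%:E.
Proof. by rewrite /occ /visits big_cons big_nil /=; case: eqP; rewrite ?addr0. Qed.

Lemma occ_cons y x (s : R) (e : edge G) js (l : \bar R) :
  occ y (x, (s, e) :: js, l) = ((if x == y then s else 0)%:E + occ y (tgt e, js, l))%E.
Proof. by rewrite /occ /visits big_cons /=; case: eqP; rewrite ?add0e. Qed.

Lemma occ_fin y x js (s : R) : occ y (x, js, s%:E) \is a fin_num.
Proof.
by elim: js x => [|[t e] js IH] x; rewrite ?occ_nil // occ_cons fin_numD IH.
Qed.

Lemma cost_nil theta x (s : R) : cost theta (x, [::], s%:E) = theta x * s.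
Proof.
rewrite /cost (bigD1 x) //= occ_nil eqxx big1 ?addr0 // => y yx.
by rewrite occ_nil eq_sym (negPf yx) mulr0.
Qed.

Lemma cost_cons theta x (s : R) (e : edge G) js (l : R) :
  cost theta (x, (s, e) :: js, l%:E) = theta x * s + cost theta (tgt e, js, l%:E).
Proof.
rewrite /cost; under eq_bigr do rewrite occ_cons fineD ?occ_fin // mulrDr.
rewrite big_split /=; congr (_ + _); rewrite (bigD1 x) //= eqxx big1 ?addr0 // => y yx.
by rewrite eq_sym (negPf yx) mulr0.
Qed.

(** For theta x = eps + s x / lambda x and a path stopped at time t, the exponential is the
    product of exp(- eps t) and of exp(- sum_x s x l_x), where l_x is the local time; q
    stands for the holonomy factor, which depends on the edges only. *)
Definition weight theta q w : R := expR (- cost theta w) * q (itin_edges w).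

Lemma weight_ge0 theta q w : (forall es, 0 <= q es) -> 0 <= weight theta q w.
Proof. by move=> q0; rewrite mulr_ge0 ?expR_ge0. Qed.

Lemma measurable_weight theta q : measurable_fun setT (weight theta q).
Proof.
apply: measurable_funM.
  by apply: measurableT_comp => //; apply: measurableT_comp => //; exact: measurable_cost.
exact: (measurable_fun_skeleton (fun s => q s.2)).
Qed.

Lemma weight_stop_cons theta q x (s : R) (e : edge G) js (l : \bar R) (t : R) :
  weight theta q (stop (x, (s, e) :: js, l) t) =
  if t < s then expR (- (theta x * t)) * q [::] else
    expR (- (theta x * s)) * weight theta (q \o cons e) (stop (tgt e, js, l) (t - s)).
Proof.
rewrite /stop /=; case: ifP => _ /=; first by rewrite /weight cost_nil.
by rewrite /weight cost_cons opprD expRD mulrA.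
Qed.

Definition stopped_weight theta q x es : \bar R :=
  (\int[tuple_measure exponential1 (size es)]_tt
    \int[leb]_(t in `]0%R, +oo[) (weight theta q (stop (@well_path R G x es tt) t))%:E)%E.

Lemma measurable_weight_stop theta q d (Z : measurableType d) (w : Z -> itinerary)
    (t : Z -> measurableTypeR R) : measurable_fun setT w -> measurable_fun setT t ->
  measurable_fun setT (fun z => weight theta q (stop (w z) (t z))).
Proof.
move=> mw mt; apply: (measurableT_comp (measurable_weight theta q)).
apply: (measurableT_comp (f := fun p : itinerary * measurableTypeR R => stop p.1 p.2)
   (@measurable_stop R G) (g := fun z => (w z, t z))).
exact/measurable_fun_pairP.
Qed.

Section positive.
Variables (theta : vertex G -> R).
Hypotheses (theta0 : forall x, 0 < theta x).

Lemma stopped_weight_nil q x : q [::] = 0 -> stopped_weight theta q x [::] = 0%E.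
Proof.
move=> q0; apply: integral0_eq => tt _; apply: integral0_eq => t _.
by rewrite (tuple0 tt) /weight /stop /itin_edges /= q0 mulr0.
Qed.

Lemma measurable_integral_lebesgue d (Z : measurableType d)
    (F : Z * measurableTypeR R -> \bar R) (D : set (measurableTypeR R)) :
  measurable D -> measurable_fun setT F -> (forall z, 0 <= F z)%E ->
  measurable_fun setT (fun z => \int[leb]_(t in D) F (z, t))%E.
Proof.
move=> mD mF F0; under eq_fun do rewrite integral_mkcond.
apply: (measurable_fun_fubini_tonelli_F (m2 := leb)
  (fun p => ((fun t => F (p.1, t)) \_ D) p.2)); last first.
  by move=> p; rewrite patchE; case: ifP.
rewrite (_ : (fun p => _) = (fun p => if p.2 \in D then F p else 0%E)); last first.
  by apply/funext => -[z t]; rewrite patchE.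
apply: measurable_fun_ifT => //.
apply: (measurable_fun_bool true); rewrite setTI.
rewrite (_ : _ @^-1` _ = [set: Z] `*` D); first exact: measurableX.
apply/seteqP; split => -[z t] /= => [tD|[_ tD]]; last exact: mem_set.
by split=> //; exact: set_mem.
Qed.

(** The integral is split at the first jump time s.  The later part is the integral for
    the path that starts at the first jump, because Lebesgue measure is invariant under
    translations. *)
Lemma weight_cons_integral q x (s : R) (e : edge G) js :
  (forall es, 0 <= q es) -> 0 <= s ->
  (\int[leb]_(t in `]0%R, +oo[) (weight theta q (stop (x, (s, e) :: js, +oo%E) t))%:E =
  ((1 - expR (- (theta x * s))) / theta x * q [::])%:E + (expR (- (theta x * s)))%:E *
  \int[leb]_(t in `]0%R, +oo[) (weight theta (q \o cons e) (stop (tgt e, js, +oo%E) t))%:E)%E.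
Proof.
move=> q0 s0.
have mw q' w D : measurable_fun D (fun t : measurableTypeR R => (weight theta q' (stop w t))%:E).
  apply/measurable_EFinP; apply: measurable_funTS.
  by apply: measurable_weight_stop => //; exact: measurable_cst.
have q0' : forall es, 0 <= (q \o cons e) es by move=> es'; exact: q0.
rewrite integral_itv_obnd_cbnd; last exact: mw.
rewrite [in RHS]integral_itv_obnd_cbnd; last exact: mw.
have E : `[0%R, +oo[%classic = `[0%R, s[%classic `|` `[s, +oo[%classic.
  by rewrite -itv_bndbnd_setU ?bnd_simp.
rewrite [in LHS]E ge0_integral_setU //=; last 2 first.
- by move=> t _; rewrite lee_fin weight_ge0.
- rewrite disj_set2E; apply/eqP/seteqP; split => // t [] /=.
  by rewrite !in_itv /= => /andP[_ ta] /andP[at_ _]; move: (lt_le_trans ta at_); rewrite ltxx.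
congr (_ + _)%E.
  transitivity (\int[leb]_(t in `[0%R, s[) ((q [::])%:E * (expR (- (theta x * t)))%:E))%E.
    apply: eq_integral => t; rewrite inE /= in_itv /= => /andP[_ ts].
    by rewrite weight_stop_cons ts -EFinM mulrC.
  rewrite ge0_integralZl_EFin //; last by apply/measurable_EFinP; exact: measurable_expR_lin.
  by rewrite integral_expR_0itv // -EFinM mulrC.
transitivity (\int[leb]_(t in `[s, +oo[) ((expR (- (theta x * s)))%:E *
    (weight theta (q \o cons e) (stop (tgt e, js, +oo%E) (t - s)))%:E))%E.
  apply: eq_integral => t; rewrite inE /= in_itv /= andbT => st.
  by rewrite weight_stop_cons ltNge st /= -EFinM.
rewrite (@integral_shift _ s (fun t => (expR (- (theta x * s)))%:E *
    (weight theta (q \o cons e) (stop (tgt e, js, +oo%E) t))%:E)%E) //; last 2 first.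
- by apply: measurable_funeM; exact: mw.
- by move=> t; rewrite -EFinM lee_fin mulr_ge0 ?expR_ge0 // weight_ge0.
rewrite ge0_integralZl_EFin ?expR_ge0 // => t _.
by rewrite lee_fin weight_ge0.
Qed.

(** The first holding time is integrated out in weight_cons_integral; both terms acquire
    the same factor (1 + theta x)^-1. *)
Lemma stopped_weight_cons q x (e : edge G) es : (forall es, 0 <= q es) ->
  stopped_weight theta q x (e :: es) = (((1 + theta x)^-1)%:E *
    ((q [::])%:E + stopped_weight theta (q \o cons e) (tgt e) es))%E.
Proof.
move=> q0; set n := size es.
pose H es' y q' (tt : (size es').-tuple (measurableTypeR R)) :=
  (\int[leb]_(t in `]0%R, +oo[) (weight theta q' (stop (@well_path R G y es' tt) t))%:E)%E.
have q0' : forall es, 0 <= (q \o cons e) es by move=> es'; exact: q0.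
have H0 es' y q' (tt : (size es').-tuple (measurableTypeR R)) : (forall es, 0 <= q' es) -> (0 <= H es' y q' tt)%E.
  by move=> h; apply: integral_ge0 => t _; rewrite lee_fin weight_ge0.
have mH es' y q' : (forall es, 0 <= q' es) -> measurable_fun setT (H es' y q').
  move=> h; apply: (@measurable_integral_lebesgue _ _
    (fun p => (weight theta q' (stop (@well_path R G y es' p.1) p.2))%:E)) => //.
    apply/measurable_EFinP; apply: measurable_weight_stop => //.
    exact: measurableT_comp (@measurable_well_path R G y es') _.
  by move=> z; rewrite lee_fin weight_ge0.
have mHt : measurable_fun setT (fun p => H (e :: es) x q (tcons p)).
  apply: (measurableT_comp (mH _ x q q0)); exact: measurable_tcons.
pose J := (\int[tuple_measure exponential1 n]_tt H es (tgt e) (q \o cons e) tt)%E.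
have -> : stopped_weight theta (q \o cons e) (tgt e) es = J by [].
have J0 : (0 <= J)%E by apply: integral_ge0 => tt _; exact: H0.
transitivity (\int[exponential1]_s \int[tuple_measure exponential1 n]_tt
    H (e :: es) x q (tcons (s, tt)))%E.
  exact: (integral_exponential_tupleS (n := n) (mH (e :: es) x q q0) (fun tt => H0 _ _ _ _ q0)).
rewrite integral_exponential1; last 2 first.
- apply: (measurable_fun_fubini_tonelli_F (m2 := tuple_measure exponential1 n)
    (fun p => H (e :: es) x q (tcons p))) => //.
  by move=> p; exact: H0.
- by move=> s; apply: integral_ge0 => tt _; exact: H0.
transitivity (\int[leb]_(s in `[0%R, +oo[)
   ((q [::])%:E * ((1 - expR (- (theta x * s))) / theta x * expR (- s))%:E +
     J * (expR (- (theta x * s)) * expR (- s))%:E))%E.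
  apply: eq_integral => s; rewrite inE /= in_itv /= andbT => s0.
  have -> : (\int[tuple_measure exponential1 n]_tt H (e :: es) x q (tcons (s, tt)) =
     ((1 - expR (- (theta x * s))) / theta x * q [::])%:E + (expR (- (theta x * s)))%:E * J)%E.
    transitivity (\int[tuple_measure exponential1 n]_tt
      (((1 - expR (- (theta x * s))) / theta x * q [::])%:E +
       (expR (- (theta x * s)))%:E * H es (tgt e) (q \o cons e) tt))%E.
      by apply: eq_integral => tt _; exact: weight_cons_integral.
    have a0 : (0 <= (1 - expR (- (theta x * s))) / theta x * q [::]).
      by rewrite mulr_ge0 // onem_expR_ge0.
    rewrite ge0_integralD //=; last 2 first.
    - by move=> tt _; rewrite mule_ge0 ?lee_fin ?expR_ge0 ?H0.
    - by apply: measurable_funeM; exact: mH.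
    congr (_ + _)%E.
      rewrite integral_cst //; apply: (etrans _ (mule1 _)); congr (_ * _)%E.
      exact: tuple_measure_setT.
    rewrite ge0_integralZl_EFin ?expR_ge0 //; [by move=> tt _; exact: H0|exact: mH].
  have a0 : (0 <= (1 - expR (- (theta x * s))) / theta x * q [::]).
    by rewrite mulr_ge0 // onem_expR_ge0.
  rewrite ge0_muleDl; last 2 first.
  - by rewrite lee_fin.
  - by rewrite mule_ge0 // lee_fin expR_ge0.
  congr (_ + _)%E.
    by rewrite -!EFinM; congr EFin; ring.
  by rewrite EFinM muleA (muleC J) -!muleA; congr (_ * _)%E; rewrite muleC.
have e1 D : measurable_fun D (fun t : measurableTypeR R => expR (- t)).
  by have := @measurable_expR_lin R 1 D; under eq_fun do rewrite mul1r.
have ec (s : R) : 0 <= s -> 0 <= (1 - expR (- (theta x * s))) / theta x * expR (- s).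
  by move=> s0; rewrite mulr_ge0 ?expR_ge0 // onem_expR_ge0.
have m1 D : measurable_fun D (fun s : measurableTypeR R =>
    ((1 - expR (- (theta x * s))) / theta x * expR (- s))%:E).
  apply/measurable_EFinP; do 2 apply: measurable_funM => //.
  by apply: measurable_funB => //; exact: measurable_expR_lin.
have m2 D : measurable_fun D (fun s : measurableTypeR R =>
    (expR (- (theta x * s)) * expR (- s))%:E).
  by apply/measurable_EFinP; apply: measurable_funM => //; exact: measurable_expR_lin.
rewrite ge0_integralD //=; last 4 first.
- move=> s; rewrite in_itv /= andbT => s0.
  by rewrite -EFinM lee_fin mulr_ge0 ?ec.
- by apply: measurable_funeM; exact: m1.
- by move=> s _; rewrite mule_ge0 // lee_fin mulr_ge0 ?expR_ge0.
- by apply: measurable_funeM; exact: m2.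
rewrite ge0_integralZl ?lee_fin //; last first.
  by move=> s; rewrite /= in_itv /= andbT => s0; rewrite lee_fin ec.
rewrite integral_onem_expR_exp // ge0_integralZl //.
by rewrite integral_expR_exp // ge0_muleDr ?lee_fin // !(muleC _ ((1 + theta x)^-1)%:E).
Qed.

End positive.
End stopped.

(** * The Green function as a sum over paths *)

Section green.
Context (R : realType) (G : wgraph R).
Local Notation leb := (@lebesgue_measure R).
Implicit Types (x y : vertex G) (es : seq (edge G)) (q : seq (edge G) -> R).
Variables (theta : vertex G -> R) (eps : R).
Hypotheses (eps0 : 0 < eps) (theta_ge : forall x, eps <= theta x).

Let theta0 x : 0 < theta x. Proof. exact: lt_le_trans (theta_ge x). Qed.

(** The Green function, started at x, of the walk killed at rate theta, in which each
    path is weighted by q. *)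
Definition green q x : \bar R := (\int[walk_law x]_w
  \int[leb]_(t in `]0%R, +oo[) (weight theta q (stop w t))%:E)%E.

Lemma greenE q x : (forall es, 0 <= q es) -> green q x =
  (\esum_(es in [set: seq (edge G)]) ((walk_prob x es)%:E * stopped_weight theta q x es))%E.
Proof.
move=> q0; rewrite /green integral_walk_law //; last first.
  by move=> w; apply: integral_ge0 => t _; rewrite lee_fin weight_ge0.
apply: (@measurable_integral_lebesgue _ _ _
    (fun p => (weight theta q (stop p.1 p.2))%:E)) => //.
  apply/measurable_EFinP; exact: measurable_weight_stop.
by move=> z; rewrite lee_fin weight_ge0.
Qed.

Lemma stopped_weight_ge0 q x es : (forall es, 0 <= q es) -> (0 <= stopped_weight theta q x es)%E.
Proof.
move=> q0; apply: integral_ge0 => tt _; apply: integral_ge0 => t _.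
by rewrite lee_fin weight_ge0.
Qed.

Lemma green_well q x : (forall es, 0 <= q es) -> x \in well G -> q [::] = 0 -> green q x = 0%E.
Proof.
move=> q0 xW q00; rewrite greenE // esum_walk_prob_well ?stopped_weight_nil // => es.
exact: stopped_weight_ge0.
Qed.

(** First-step decomposition.  The term q [::] has coefficient 1 because the walk reaches
    the well with probability 1. *)
Lemma green_proper q x : (forall es, 0 <= q es) -> x \notin well G ->
  green q x = (((1 + theta x)^-1)%:E * ((q [::])%:E +
    \sum_(e | src e == x) (cond e / lambda x)%:E * green (q \o cons e) (tgt e)))%E.
Proof.
move=> q0 xW; have q0' e es : 0 <= (q \o cons e) es by exact: q0.
rewrite greenE // esum_walk_prob_proper //; last by move=> es; exact: stopped_weight_ge0.
have d0 : 0 <= (1 + theta x)^-1 by rewrite invr_ge0 addr_ge0 // ltW.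
have g0 e : (0 <= green (q \o cons e) (tgt e))%E.
  by rewrite greenE //; apply: esum_ge0 => es _; rewrite mule_ge0 ?lee_fin ?walk_prob_ge0 ?stopped_weight_ge0.
transitivity (\sum_(e | src e == x) (cond e / lambda x)%:E *
  (((1 + theta x)^-1)%:E * ((q [::])%:E + green (q \o cons e) (tgt e))))%E.
  apply: eq_bigr => e _; congr (_ * _)%E; rewrite greenE //.
  transitivity (\esum_(es in [set: seq (edge G)]) (((1 + theta x)^-1)%:E *
     ((q [::])%:E * (walk_prob (tgt e) es)%:E +
      (walk_prob (tgt e) es)%:E * stopped_weight theta (q \o cons e) (tgt e) es)))%E.
    apply: eq_esum => es _; rewrite stopped_weight_cons // muleCA; congr (_ * _)%E.
    by rewrite ge0_muleDr ?lee_fin ?stopped_weight_ge0 // muleC.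
  rewrite esumZl //; last first.
    move=> es; rewrite adde_ge0 // mule_ge0 ?lee_fin ?walk_prob_ge0 //.
    exact: stopped_weight_ge0.
  rewrite esumD; last 2 first.
  - by move=> es _; rewrite mule_ge0 ?lee_fin ?walk_prob_ge0.
  - by move=> es _; rewrite mule_ge0 ?lee_fin ?walk_prob_ge0 ?stopped_weight_ge0.
  rewrite esumZl //; last by move=> es; rewrite lee_fin walk_prob_ge0.
  by rewrite -/(hit_prob _) hit_prob1 mule1.
under eq_bigr do rewrite muleCA.
rewrite -ge0_sume_distrr; last first.
  by move=> e _; rewrite mule_ge0 ?lee_fin ?jump_prob_ge0 // adde_ge0 ?lee_fin.
congr (_ * _)%E; under eq_bigr do rewrite ge0_muleDr ?lee_fin //.
rewrite big_split /=; congr (_ + _)%E.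
under eq_bigr do rewrite -EFinM.
by rewrite sumEFin -mulr_suml sum_jump_prob mul1r.
Qed.

(** The bound C / eps reproduces itself in the recursion: C + C / eps is at most
    (1 + theta x) (C / eps). *)
Lemma stopped_weight_le (C : R) q x es : 0 <= C -> (forall es, 0 <= q es <= C) ->
  (forall es, last x (map (@tgt G) es) \in well G -> q es = 0) ->
  last x (map (@tgt G) es) \in well G ->
  (stopped_weight theta q x es <= (C / eps)%:E)%E.
Proof.
move=> C0; elim: es q x => [|e es IH] q x qC qW xW.
  by rewrite stopped_weight_nil ?lee_fin ?divr_ge0 ?(ltW eps0) // qW.
rewrite (stopped_weight_cons theta0); last by move=> es'; have /andP[] := qC es'.
have d0 : 0 < 1 + theta x by rewrite addr_gt0.
have := IH (q \o cons e) (tgt e) (fun es => qC (e :: es)) (fun es => qW (e :: es)) xW.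
set J := stopped_weight _ _ _ _ => JC.
rewrite muleC lee_pdivrMr // -EFinM.
have /andP[_ qn] := qC [::].
apply: (@le_trans _ _ (C%:E + (C / eps)%:E)%E); first by rewrite leeD ?lee_fin.
rewrite -EFinD lee_fin mulrDr mulr1 addrC lerD2l mulrAC -mulrA.
by rewrite ler_peMr // ler_pdivlMr // mul1r.
Qed.

Lemma walk_prob_end x es : last x (map (@tgt G) es) \notin well G -> walk_prob x es = 0.
Proof.
elim: es x => [|e es IH] x /=; first by move/negPf => ->.
by move=> h; case: (x \in well G) => //; rewrite IH ?mulr0.
Qed.

Lemma green_le (C : R) q x : 0 <= C -> (forall es, 0 <= q es <= C) ->
  (forall es, last x (map (@tgt G) es) \in well G -> q es = 0) ->
  (green q x <= (C / eps)%:E)%E.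
Proof.
move=> C0 qC qW; rewrite greenE; last by move=> es; have /andP[] := qC es.
have Ce : 0 <= C / eps by rewrite divr_ge0 // ltW.
rewrite -[leRHS]mule1 -(hit_prob1 x) /hit_prob -esumZl //; last first.
  by move=> es; rewrite lee_fin walk_prob_ge0.
apply: le_esum => es _; have [xW|xW] := boolP (last x (map (@tgt G) es) \in well G).
  by rewrite muleC lee_wpmul2r ?lee_fin ?walk_prob_ge0 // stopped_weight_le.
by rewrite walk_prob_end // mul0e mule0.
Qed.

(** The contribution to the Green function of the paths stopped after n jumps.  Unlike
    the Green function it is defined for signed q, hence for the coordinates of the
    holonomy. *)
Fixpoint path_sum n q x : R :=
  if x \in well G then 0 else (1 + theta x)^-1 *
  if n is n'.+1 then
    \sum_(e | src e == x) cond e / lambda x * path_sum n' (q \o cons e) (tgt e)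
  else q [::].

Let d_itv x : 0 <= (1 + theta x)^-1 <= (1 + eps)^-1.
Proof.
by rewrite invr_ge0 addr_ge0 ?(ltW (theta0 x)) //= lef_pV2 ?posrE ?addr_gt0 // lerD2l.
Qed.

Lemma path_sum_le (C : R) n q x : 0 <= C -> (forall es, `|q es| <= C) ->
  `|path_sum n q x| <= C * (1 + eps)^-1 ^+ n.
Proof.
have r0 : 0 <= (1 + eps)^-1 by rewrite invr_ge0 addr_ge0 // ltW.
move=> C0; elim: n q x => [|n IH] q x qC /=; case: ifP => _; rewrite ?normr0 ?mulr_ge0 ?exprn_ge0 //.
  have /andP[d0 d1] := d_itv x; rewrite normrM ger0_norm // expr0 mulr1.
  rewrite -[leRHS]mul1r ler_pM // (le_trans d1) // invf_le1 ?addr_gt0 //.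
  by rewrite lerDl ltW.
have /andP[d0 d1] := d_itv x; rewrite normrM ger0_norm // exprS mulrCA ler_pM //.
rewrite (le_trans (ler_norm_sum _ _ _)) // -[leRHS]mul1r -[X in _ <= X * _](sum_jump_prob x) mulr_suml.
apply: ler_sum => e _; rewrite normrM ger0_norm ?jump_prob_ge0 //.
by rewrite ler_wpM2l ?jump_prob_ge0 // IH // => es; exact: qC.
Qed.

(** Each step of the first-step expansion multiplies the remainder by at most
    (1 + eps)^-1. *)
Lemma green_path_sum (C : R) n q x : 0 <= C -> (forall es, 0 <= q es <= C) ->
  (forall es, last x (map (@tgt G) es) \in well G -> q es = 0) ->
  `|fine (green q x) - \sum_(k < n) path_sum k q x| <= C / eps * (1 + eps)^-1 ^+ n.
Proof.
have r0 : 0 <= (1 + eps)^-1 by rewrite invr_ge0 addr_ge0 // ltW.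
move=> C0; elim: n q x => [|n IH] q x qC qW.
all: have q0 es : 0 <= q es by have /andP[] := qC es.
all: have g0 y q' : (forall es, 0 <= q' es) -> (0 <= green q' y)%E by
  move=> h; apply: integral_ge0 => w _; apply: integral_ge0 => t _; rewrite lee_fin weight_ge0.
all: have Ce : 0 <= C / eps by rewrite divr_ge0 // ltW.
  rewrite big_ord0 subr0 expr0 mulr1 ger0_norm ?fine_ge0 ?g0 //.
  by rewrite -lee_fin fineK ?green_le // ge0_fin_numE ?g0 // (le_lt_trans (green_le C0 qC qW)) ?ltry.
rewrite big_ord_recl; have [xW|xW] := boolP (x \in well G).
  have ps0 k : path_sum k q x = 0 by case: k => [|k] /=; rewrite xW.
  rewrite green_well ?qW // ps0 big1 => [|i _]; last exact: ps0.
  by rewrite addr0 subrr normr0 mulr_ge0 ?exprn_ge0.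
have gfin e : green (q \o cons e) (tgt e) \is a fin_num.
  rewrite ge0_fin_numE ?g0 // => [|es]; last exact: q0.
  rewrite (le_lt_trans (@green_le C _ _ C0 _ _)) ?ltry // => es; first exact: qC.
  exact: (qW (e :: es)).
rewrite green_proper //.
have -> : (\sum_(e | src e == x) (cond e / lambda x)%:E * green (q \o cons e) (tgt e) =
   (\sum_(e | src e == x) cond e / lambda x * fine (green (q \o cons e) (tgt e)))%:E)%E.
  by rewrite -sumEFin; apply: eq_bigr => e _; rewrite [RHS]EFinM fineK.
have -> : path_sum 0 q x = (1 + theta x)^-1 * q [::] by rewrite /= (negPf xW).
have -> : \sum_(i < n) path_sum (lift ord0 i) q x = (1 + theta x)^-1 *
    \sum_(e | src e == x) cond e / lambda x * \sum_(i < n) path_sum i (q \o cons e) (tgt e).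
  transitivity (\sum_(i < n) ((1 + theta x)^-1 * \sum_(e | src e == x) cond e / lambda x *
      path_sum i (q \o cons e) (tgt e))).
    by apply: eq_bigr => i _; rewrite /= (negPf xW).
  by rewrite -mulr_sumr exchange_big /=; congr (_ * _); apply: eq_bigr => e _; rewrite mulr_sumr.
rewrite /= mulrDr opprD addrACA subrr add0r -mulrBr -sumrB.
have /andP[d0 d1] := d_itv x; rewrite normrM ger0_norm // exprS mulrCA ler_pM //.
rewrite (le_trans (ler_norm_sum _ _ _)) // -[leRHS]mul1r -[X in _ <= X * _](sum_jump_prob x) mulr_suml.
apply: ler_sum => e _; rewrite -mulrBr normrM ger0_norm ?jump_prob_ge0 //.
rewrite ler_wpM2l ?jump_prob_ge0 // IH // => es; first exact: qC.
exact: (qW (e :: es)).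
Qed.

End green.

(** * Integration of the trace of a resolvent *)

Section jacobi.
Context (R : comNzRingType).

Lemma deriv_prod (I : eqType) (r : seq I) (F : I -> {poly R}) : uniq r ->
  (\prod_(i <- r) F i)^`() = \sum_(i <- r) (F i)^`() * \prod_(j <- r | j != i) F j.
Proof.
elim: r => [|i r IH] /=; first by rewrite !big_nil derivC.
move=> /andP[ir ur]; rewrite !big_cons derivM IH // eqxx /=; congr (_ * _ + _).
  rewrite big_seq [RHS]big_seq_cond; apply: eq_bigl => j.
  by case jr: (j \in r) => //=; apply/esym/eqP => ji; rewrite -ji jr in ir.
rewrite mulr_sumr; apply: eq_big_seq => j jr; rewrite big_cons.
case: eqP => [ij|_]; first by rewrite ij jr in ir.
by rewrite mulrCA.
Qed.

(** Jacobi's formula.  Differentiating row i turns it into the i-th unit row, and the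
    determinant of the result is the i-th diagonal cofactor. *)
Lemma deriv_det n (B : 'M[{poly R}]_n) :
  (forall i j, (B i j)^`() = (i == j)%:R) -> (\det B)^`() = \tr (\adj B).
Proof.
move=> dB; rewrite /determinant raddf_sum /=.
have d s : ((-1) ^+ odd_perm s * \prod_i B i (s i))^`() =
    \sum_i (-1) ^+ odd_perm s * ((i == s i)%:R * \prod_(j | j != i) B j (s j)).
  rewrite derivM; have -> : ((-1) ^+ odd_perm s : {poly R})^`() = 0.
    by case: (odd_perm s); rewrite ?expr0 ?expr1 ?derivN derivC ?oppr0.
  rewrite mul0r add0r (deriv_prod _ (index_enum_uniq _)) mulr_sumr.
  by apply: eq_bigr => i _; rewrite dB.
under eq_bigr do rewrite d; rewrite exchange_big /=; apply: eq_bigr => i _.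
pose Bi := \matrix_(k, l) if k == i then (k == l)%:R else B k l.
transitivity (\det Bi).
  apply: eq_bigr => s _; congr (_ * _); rewrite [RHS](bigD1 i) //= mxE eqxx.
  by congr (_ * _); apply: eq_bigr => j ji; rewrite mxE (negPf ji).
rewrite (expand_det_row _ i) (bigD1 i) //= mxE !eqxx mul1r big1 ?addr0; last first.
  by move=> j ji; rewrite mxE eqxx eq_sym (negPf ji) mul0r.
rewrite mxE /cofactor; congr (_ * \det _); apply/matrixP => k l; rewrite !mxE.
by rewrite eq_sym (negPf (neq_lift _ _)).
Qed.

End jacobi.

Section logdet.
Context (R : realType) (n : nat).
Implicit Types A : 'M[R]_n.

Definition shift_poly A : {poly R} := \det ('X%:M + map_mx polyC A).

Lemma horner_shift_mx A e :
  map_mx (horner_eval e) ('X%:M + map_mx polyC A) = e%:M + A.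
Proof.
apply/matrixP => i j; rewrite !mxE /= horner_evalE !hornerE.
by case: (i == j); rewrite ?mulr1n ?mulr0n ?hornerX ?horner0.
Qed.

Lemma horner_shift_poly A e : (shift_poly A).[e] = \det (e%:M + A).
Proof. by rewrite /shift_poly -horner_evalE -det_map_mx horner_shift_mx. Qed.

Lemma deriv_shift_poly A e : e%:M + A \in unitmx ->
  (shift_poly A)^`().[e] = \det (e%:M + A) * \tr (invmx (e%:M + A)).
Proof.
move=> uA; rewrite /shift_poly deriv_det; last first.
  by move=> i j; rewrite !mxE derivD derivC addr0; case: (i == j); rewrite ?derivX ?derivC.
rewrite /invmx uA mxtraceZ mulrA divff ?mul1r; last by rewrite -unitfE -unitmxE.
rewrite -horner_evalE /mxtrace rmorph_sum /= -(horner_shift_mx A e) -map_mx_adj.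
by apply: eq_bigr => i _; rewrite [RHS]mxE.
Qed.

(** At u = 1 / e this is det (e + A) / e^n, whose limit at infinity is thus the value of
    a polynomial at 0. *)
Definition reversed_poly A : {poly R} := \det (1%:M + 'X *: map_mx polyC A).

Lemma horner_reversed_poly A u : (reversed_poly A).[u] = \det (1%:M + u *: A).
Proof.
rewrite /reversed_poly -horner_evalE -det_map_mx; congr (\det _).
apply/matrixP => i j; rewrite !mxE /= horner_evalE !hornerE.
by case: (i == j); rewrite ?mulr1n ?mulr0n ?hornerE ?horner0.
Qed.

Lemma shift_reversed_poly A e : e != 0 ->
  (shift_poly A).[e] = e ^+ n * (reversed_poly A).[e^-1].
Proof.
move=> e0; rewrite horner_shift_poly horner_reversed_poly -detZ; congr (\det _).
by rewrite scalerDr scalerA divff // scale1r scalemx1.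
Qed.

Lemma cvg_reversed_poly A : (reversed_poly A).[e^-1] @[e --> +oo] --> (1 : R).
Proof.
have -> : (1 : R) = (reversed_poly A).[0] by rewrite horner_reversed_poly scale0r addr0 det1.
apply: continuous_cvg; first exact: continuous_horner.
apply/(gtr0_cvgV0 (f := idfun)); last exact: cvg_id.
exact: nbhs_pinfty_gt.
Qed.

Section two_matrices.
Variables A B : 'M[R]_n.
Hypothesis dA : forall e : R, 0 <= e -> 0 < \det (e%:M + A).
Hypothesis dB : forall e : R, 0 <= e -> 0 < \det (e%:M + B).
Hypothesis AB : forall e : R, 0 < e -> \tr (invmx (e%:M + B)) <= \tr (invmx (e%:M + A)).

Let unit_shift (C : 'M[R]_n) : (forall e : R, 0 <= e -> 0 < \det (e%:M + C)) ->
  forall e, 0 <= e -> e%:M + C \in unitmx.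
Proof. by move=> dC e e0; rewrite unitmxE unitfE gt_eqF // dC. Qed.

Let F e := ln (shift_poly A).[e] - ln (shift_poly B).[e].
Let f e := (shift_poly A)^`().[e] / (shift_poly A).[e] -
           (shift_poly B)^`().[e] / (shift_poly B).[e].

Let fE (e : R) : 0 <= e -> f e = \tr (invmx (e%:M + A)) - \tr (invmx (e%:M + B)).
Proof.
move=> e0; rewrite /f !deriv_shift_poly ?unit_shift // !horner_shift_poly.
by rewrite [_ * \tr _]mulrC mulfK ?gt_eqF ?dA // [_ * \tr _]mulrC mulfK ?gt_eqF ?dB.
Qed.

Let dF (e : R) : 0 <= e -> is_derive e (1 : R) F (f e).
Proof.
move=> e0; have lnD (C : 'M[R]_n) : 0 < (shift_poly C).[e] ->
    is_derive e (1 : R) (fun u => ln (shift_poly C).[u])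
      ((shift_poly C)^`().[e] / (shift_poly C).[e]).
  move=> C0; have dl := is_derive1_ln C0; have dp := is_derive_poly (shift_poly C) e.
  by have := is_derive1_comp dl dp; rewrite mulrC.
have A0 : 0 < (shift_poly A).[e] by rewrite horner_shift_poly dA.
have B0 : 0 < (shift_poly B).[e] by rewrite horner_shift_poly dB.
have d1 := lnD A A0; have d2 := lnD B B0.
exact: is_deriveB.
Qed.

Let cont_f (e : R) : 0 <= e -> {for e, continuous f}.
Proof.
move=> e0; apply: cvgB; apply: cvgM; try exact: continuous_horner.
  by apply: cvgV; [rewrite horner_shift_poly gt_eqF ?dA|exact: continuous_horner].
by apply: cvgV; [rewrite horner_shift_poly gt_eqF ?dB|exact: continuous_horner].
Qed.

(** By Jacobi's formula the integrand is the derivative of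
    ln det (e + A) - ln det (e + B), which vanishes at infinity since both determinants
    are equivalent to e^n.  The comparison AB of the traces makes the integrand
    nonnegative, as needed for the fundamental theorem of calculus on a half line. *)
Lemma integral_trace_resolvent :
  (\int[lebesgue_measure]_(e in `]0%R, +oo[)
     (\tr (invmx (e%:M + A)) - \tr (invmx (e%:M + B)))%:E =
   (ln (\det B / \det A))%:E)%E.
Proof.
have f_gt0 (e : R) : 0 < e -> 0 <= f e by move=> e0; rewrite fE ?subr_ge0 ?AB // ltW.
have f0 : 0 <= f 0.
  have c0 : f e @[e --> 0^'+] --> f 0 by apply: cvg_at_right_filter; exact: cont_f.
  rewrite -(cvg_lim _ c0) //; apply: limr_ge; first by apply/cvg_ex; exists (f 0).
  by near=> e; apply: f_gt0; near: e; exact: nbhs_right_gt.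
have f_ge0 (e : R) : 0 <= e -> 0 <= f e by rewrite le_eqVlt => /predU1P[<-|/f_gt0].
have contF (e : R) : 0 <= e -> {for e, continuous F}.
  move=> e0; apply: differentiable_continuous; apply/derivable1_diffP.
  by have [] := dF e0.
have Fy : F e @[e --> +oo] --> (0 : R).
  have c1 : ((reversed_poly A).[e^-1] / (reversed_poly B).[e^-1]) @[e --> +oo] --> (1 : R).
    rewrite -[X in _ --> X](mulr1 (1 : R)) -{2}(invr1 R); apply: cvgM.
      exact: cvg_reversed_poly.
    by apply: cvgV; [rewrite oner_eq0|exact: cvg_reversed_poly].
  have c2 : ln ((reversed_poly A).[e^-1] / (reversed_poly B).[e^-1]) @[e --> +oo] --> ln (1 : R).
    by apply: continuous_cvg c1; exact: continuous_ln.
  rewrite ln1 in c2; apply: cvg_trans c2; apply: near_eq_cvg; near=> e.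
  have e0 : 0 < e by near: e; exact: nbhs_pinfty_gt.
  have A0 := dA (ltW e0); have B0 := dB (ltW e0).
  rewrite /F -!horner_shift_poly in A0 B0 *; rewrite -ln_div ?posrE //.
  rewrite !shift_reversed_poly ?gt_eqF // -mulf_div divff ?mul1r //.
  by rewrite expf_neq0 // gt_eqF.
transitivity (\int[lebesgue_measure]_(e in `[0%R, +oo[) (f e)%:E)%E.
  rewrite -integral_itv_obnd_cbnd; last first.
    apply/measurable_EFinP; apply: open_continuous_measurable_fun => // e.
    by rewrite inE /= in_itv /= andbT => e0; apply: cont_f; exact: ltW.
  apply: eq_integral => e; rewrite inE /= in_itv /= andbT => e0.
  by rewrite fE // ltW.
rewrite (ge0_continuous_FTC2y (F := F) (l := 0)) //.
- have s0 (C : 'M[R]_n) : 0%:M + C = C by rewrite raddf0 add0r.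
  rewrite -EFinB sub0r; congr EFin; rewrite /F opprB !horner_shift_poly !s0.
  by rewrite ln_div // posrE -[X in \det X]s0 ?dA ?dB.
- apply/continuous_within_itvcyP; split.
    by move=> e; rewrite in_itv /= andbT => e0; apply: cont_f; exact: ltW.
  by apply: cvg_at_right_filter; exact: cont_f.
- by move=> e e0; have [] := dF (ltW e0).
- by apply: cvg_at_right_filter; exact: contF.
- move=> e; rewrite in_itv /= andbT => e0; rewrite derive1E.
  by have [_ ->] := dF (ltW e0).
Unshelve. all: end_near. Qed.

End two_matrices.
End logdet.

(** * Neumann series and Gaussian integrals *)

Section neumann.
Context (R : realType) (n : nat).
Variables (D N Q : 'M[R]_n).
Hypothesis ND : N *m D = 1%:M.
Hypothesis uDQ : D - Q \in unitmx.

Fixpoint neumann_term k : 'M[R]_n := if k is k'.+1 then N *m Q *m neumann_term k' else N.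

Lemma neumann_partial m :
  (\sum_(k < m) neumann_term k) *m (D - Q) = 1%:M - neumann_term m *m D.
Proof.
have comm k : neumann_term k *m Q *m N = N *m Q *m neumann_term k.
  by elim: k => [|k IH] //=; rewrite -!mulmxA; congr (_ *m (_ *m _)); rewrite !mulmxA.
elim: m => [|m IH]; first by rewrite big_ord0 mul0mx /= ND subrr.
rewrite big_ord_recr /= mulmxDl IH mulmxBr addrA subrK; congr (_ - _).
by rewrite -comm -!mulmxA ND mulmx1.
Qed.

(** The partial sums telescope against D - Q, with a remainder governed by the entries
    of the last term. *)
Lemma cvg_trace_neumann :
  (forall i j, neumann_term k i j @[k --> \oo] --> (0 : R)) ->
  \sum_(k < m) \tr (neumann_term k) @[m --> \oo] --> \tr (invmx (D - Q)).
Proof.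
move=> N0; set G := invmx _.
have E m : \sum_(k < m) \tr (neumann_term k) =
    \tr G - \sum_i \sum_j neumann_term m i j * (D *m G) j i.
  transitivity (\tr (\sum_(k < m) neumann_term k)); first by rewrite raddf_sum.
  rewrite -[X in \tr X = _](mulmxK uDQ) neumann_partial mulmxBl mul1mx raddfB /=.
  by congr (_ - _); rewrite -mulmxA; apply: eq_bigr => i _; rewrite mxE.
have c0 : (\sum_i \sum_j neumann_term m i j * (D *m G) j i) @[m --> \oo] -->
    \sum_(i < n) \sum_(j < n) (0 : R) * (D *m G) j i.
  apply: cvg_big => [|i _]; first exact: add_continuous.
  apply: cvg_big => [|j _]; first exact: add_continuous.
  by apply: cvgM; [exact: N0|exact: cvg_cst].
have z : \sum_(i < n) \sum_(j < n) (0 : R) * (D *m G) j i = 0.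
  by rewrite big1 // => i _; rewrite big1 // => j _; rewrite mul0r.
rewrite (_ : (fun m => _) = (fun m =>
    \tr G - \sum_i \sum_j neumann_term m i j * (D *m G) j i)); last exact/funext.
rewrite z in c0; rewrite -[X in _ --> X](subr0 (\tr G)).
by apply: cvgB c0; exact: cvg_cst.
Qed.

End neumann.

Section gauss.
Context (R : realType).
Local Notation leb := (@lebesgue_measure R).

Lemma integral_gauss (m b : R) : 0 < m ->
  (\int[leb]_s (expR (- (2^-1 * (m * s ^+ 2 + 2 * s * b))))%:E =
   (Num.sqrt (2 * pi / m) * expR (2^-1 * (b ^+ 2 / m)))%:E)%E.
Proof.
move=> m0; pose sg := (Num.sqrt m)^-1; have sm : 0 < Num.sqrt m by rewrite sqrtr_gt0.
have sg0 : sg != 0 by rewrite invr_eq0 gt_eqF.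
have sg2 : sg ^+ 2 = m^-1 by rewrite exprVn sqr_sqrtr // ltW.
have E s : expR (- (2^-1 * (m * s ^+ 2 + 2 * s * b))) =
    Num.sqrt (2 * pi / m) * expR (2^-1 * (b ^+ 2 / m)) * normal_pdf (- (b / m)) sg s.
  rewrite normal_pdfE // /normal_peak /normal_fun sg2.
  have -> : (m^-1 * pi *+ 2) = 2 * pi / m by rewrite -mulr_natr; ring.
  rewrite mulrACA divff ?mul1r; last by rewrite gt_eqF // sqrtr_gt0 !mulr_gt0 ?invr_gt0 // pi_gt0.
  rewrite -expRD; congr expR; field; rewrite ?gt_eqF //.
under eq_integral do rewrite E EFinM.
rewrite ge0_integralZl_EFin //.
- by rewrite integral_normal_pdf // mule1.
- by move=> s _; rewrite lee_fin normal_pdf_ge0.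
- by apply/measurable_EFinP; exact: measurable_normal_pdf.
Qed.

Definition quad n (M : 'M[R]_n) (c : 'I_n -> R) : R :=
  \sum_i \sum_j M i j * (c i * c j).

Definition schur n (M : 'M[R]_n.+1) : 'M[R]_n :=
  \matrix_(i, j) (M (lift ord0 i) (lift ord0 j) -
    M (lift ord0 i) ord0 * M ord0 (lift ord0 j) / M ord0 ord0).

(** The first coordinate is separated from the others, so that the square in it can be
    completed in integral_gauss. *)
Lemma quad_schur n (M : 'M[R]_n.+1) (c : 'I_n.+1 -> R) :
  (forall i j, M i j = M j i) -> M ord0 ord0 != 0 ->
  let b := \sum_j M ord0 (lift ord0 j) * c (lift ord0 j) in
  quad M c = M ord0 ord0 * c ord0 ^+ 2 + 2 * c ord0 * b +
    (quad (schur M) (c \o lift ord0) + b ^+ 2 / M ord0 ord0).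
Proof.
move=> symM m0 b; rewrite /quad big_ord_recl big_ord_recl.
have -> : \sum_(j < n) M ord0 (lift ord0 j) * (c ord0 * c (lift ord0 j)) = c ord0 * b.
  by rewrite /b mulr_sumr; apply: eq_bigr => j _; ring.
under [X in _ + X = _]eq_bigr do rewrite big_ord_recl.
rewrite big_split /=.
have -> : \sum_(i < n) M (lift ord0 i) ord0 * (c (lift ord0 i) * c ord0) = c ord0 * b.
  by rewrite /b mulr_sumr; apply: eq_bigr => j _; rewrite symM; ring.
have bb : b ^+ 2 / M ord0 ord0 = \sum_i \sum_j M (lift ord0 i) ord0 * M ord0 (lift ord0 j) / M ord0 ord0 *
    (c (lift ord0 i) * c (lift ord0 j)).
  rewrite expr2 {1}/b -mulrA mulr_suml; apply: eq_bigr => i _.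
  rewrite [b / _]mulrC mulrA /b mulr_sumr; apply: eq_bigr => j _.
  by rewrite (symM _ ord0); ring.
rewrite bb -big_split /=.
under [X in _ = _ + X]eq_bigr => i _.
  rewrite -big_split /=; under eq_bigr do rewrite mxE -mulrDl subrK.
  over.
rewrite expr2; ring.
Qed.

Lemma det_schur n (M : 'M[R]_n.+1) : M ord0 ord0 != 0 ->
  \det M = M ord0 ord0 * \det (schur M).
Proof.
move=> m0; pose A : 'M[R]_(1 + n) := M.
pose L : 'M[R]_(1 + n) := block_mx 1%:M 0 (- (M ord0 ord0)^-1 *: dlsubmx A) 1%:M.
have dL : \det L = 1 by rewrite det_lblock !det1 mulr1.
have ulE : ulsubmx A = (M ord0 ord0)%:M.
  by rewrite [ulsubmx A]mx11_scalar !mxE; congr (M _ _)%:M; apply/val_inj.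
rewrite -[LHS]mul1r -dL -det_mulmx -[X in L *m X](submxK A) mulmx_block.
rewrite !mul1mx !mul0mx !addr0 ulE mul_mx_scalar scalerA mulrN divff //.
rewrite scaleN1r addNr det_ublock det_scalar expr1; congr (_ * \det _).
apply/matrixP => i j; rewrite !mxE big_ord1 !mxE /=.
have e0 : lshift n (ord0 : 'I_1) = ord0 by exact: val_inj.
have er k : rshift 1 k = lift ord0 k by exact: val_inj.
by rewrite !e0 !er /A; ring.
Qed.

Lemma measurable_quad n (M : 'M[R]_n) :
  measurable_fun setT (fun c : n.-tuple (measurableTypeR R) => quad M (tnth c)).
Proof.
apply: measurable_sum => i; apply: measurable_sum => j.
by do 2 apply: measurable_funM => //; exact: measurable_tnth.
Qed.

(** Induction on the dimension: integrating out the first coordinate leaves the quadratic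
    form of the Schur complement, which is the minimum of the original form over the first
    coordinate and hence still positive definite. *)
Lemma integral_gauss_quad n (M : 'M[R]_n) : (forall i j, M i j = M j i) ->
  (forall c, (exists i, c i != 0) -> 0 < quad M c) ->
  0 < \det M /\
  (\int[tuple_measure leb n]_c (expR (- (2^-1 * quad M (tnth c))))%:E =
   (Num.sqrt (2 * pi) ^+ n / Num.sqrt (\det M))%:E)%E.
Proof.
elim: n M => [|n IH] M symM posM.
  rewrite det_mx00 sqrtr1 expr0 divr1; split=> //.
  rewrite /= integral_dirac //; last first.
    apply/measurable_EFinP; do 3 apply: measurableT_comp => //; exact: measurable_quad.
  by rewrite diracT mul1e /quad big_ord0 mulr0 oppr0 expR0.
have m0 : 0 < M ord0 ord0.
  pose c (i : 'I_n.+1) : R := (i == ord0)%:R.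
  have := posM c; rewrite /quad (bigD1 ord0) //= (bigD1 ord0) //= big1; last first.
    by move=> j j0; rewrite /c (negPf j0) !mulr0.
  rewrite big1 ?addr0; last first.
    by move=> i i0; rewrite big1 // => j _; rewrite /c (negPf i0) mul0r mulr0.
  by rewrite /c eqxx !mulr1; apply; exists ord0; rewrite eqxx oner_eq0.
have mN0 : M ord0 ord0 != 0 by rewrite gt_eqF.
have symS i j : schur M i j = schur M j i.
  by rewrite !mxE (symM (lift ord0 i)) (symM (lift ord0 i) ord0) (symM ord0 (lift ord0 j)); ring.
have posS c : (exists i, c i != 0) -> 0 < quad (schur M) c.
  move=> [i0 ci0]; pose b := \sum_j M ord0 (lift ord0 j) * c j.
  (* the minimizing value of the first coordinate *)
  pose c' (i : 'I_n.+1) : R := if unlift ord0 i is Some j then c j else - (b / M ord0 ord0).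
  have cl j : c' (lift ord0 j) = c j by rewrite /c' liftK.
  have c0 : c' ord0 = - (b / M ord0 ord0) by rewrite /c' unlift_none.
  have : 0 < quad M c' by apply: posM; exists (lift ord0 i0); rewrite cl.
  rewrite quad_schur //= c0; under [X in 2 * _ * X]eq_bigr do rewrite cl.
  under [X in _ + X ^+ 2 / _]eq_bigr do rewrite cl.
  rewrite -/b; have -> : c' \o lift ord0 = c by apply/funext => j; rewrite /= cl.
  by congr (0 < _); field.
have [dS iS] := IH _ symS posS; have dM := det_schur mN0.
split; first by rewrite dM mulr_gt0.
rewrite integral_tupleS; last 2 first.
- by apply/measurable_EFinP; do 3 apply: measurableT_comp => //; exact: measurable_quad.
- by move=> c; rewrite lee_fin expR_ge0.
rewrite fubini_tonelli2 //=; last first.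
  apply/measurable_EFinP; do 3 apply: measurableT_comp => //.
  by apply: (measurableT_comp (@measurable_quad _ M)); exact: measurable_tcons.
transitivity (\int[tuple_measure leb n]_c ((Num.sqrt (2 * pi / M ord0 ord0))%:E *
   (expR (- (2^-1 * quad (schur M) (tnth c))))%:E))%E.
  apply: eq_integral => t _; rewrite /fubini_G.
  pose b := \sum_j M ord0 (lift ord0 j) * tnth t j.
  transitivity (\int[leb]_s ((expR (- (2^-1 * (quad (schur M) (tnth t) + b ^+ 2 / M ord0 ord0))))%:E *
      (expR (- (2^-1 * (M ord0 ord0 * s ^+ 2 + 2 * s * b))))%:E))%E.
    apply: eq_integral => s _; rewrite -EFinM -expRD; congr (expR _)%:E.
    have tl j : tnth (tcons (s, t)) (lift ord0 j) = tnth t j.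
      by rewrite !(tnth_nth 0).
    rewrite quad_schur //=; under [X in 2 * _ * X]eq_bigr do rewrite tl.
    under [X in X ^+ 2 / _]eq_bigr do rewrite tl.
    have -> : tnth (tcons (s, t)) \o lift ord0 = tnth t by apply/funext => j; exact: tl.
    have -> : tnth (tcons (s, t)) ord0 = s by [].
    by rewrite -/b; ring.
  rewrite ge0_integralZl_EFin ?expR_ge0 //.
  - rewrite integral_gauss // -!EFinM mulrCA -expRD; congr (_ * expR _)%:E; ring.
  - apply/measurable_EFinP; do 3 apply: measurableT_comp => //.
    by apply: measurable_funD; apply: measurable_funM => //; exact: measurable_funM.
rewrite ge0_integralZl_EFin ?sqrtr_ge0 //.
- rewrite iS -EFinM dM; congr EFin.
  have pi2 : 0 <= 2 * pi :> R by rewrite mulr_ge0 // pi_ge0.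
  rewrite [Num.sqrt (2 * pi / _)]sqrtrM // sqrtrV ?ltW //.
  by rewrite [Num.sqrt (M ord0 ord0 * _)]sqrtrM ?ltW // exprS invfM; ring.
- by apply/measurable_EFinP; do 3 apply: measurableT_comp => //; exact: measurable_quad.
Qed.

End gauss.

(** * Matrices indexed by a finite type, and fibre coordinates *)

Section indexed_matrices.
Context (R : realType) (I : finType).
Local Notation N := #|{: I}|.
Implicit Types phi psi : I -> I -> R.

Definition index_mx phi : 'M[R]_N := \matrix_(a, b) phi (enum_val a) (enum_val b).

Lemma sum_enum_val (F : I -> R) : \sum_(a < N) F (enum_val a) = \sum_p F p.
Proof.
rewrite (reindex (@enum_rank I)) /=; last exact/onW_bij/enum_rank_bij.
by apply: eq_bigr => p _; rewrite enum_rankK.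
Qed.

Lemma index_mxM phi psi :
  index_mx phi *m index_mx psi = index_mx (fun p q => \sum_k phi p k * psi k q).
Proof.
apply/matrixP => a b; rewrite !mxE -sum_enum_val.
by apply: eq_bigr => k _; rewrite !mxE.
Qed.

Lemma trace_index_mx phi : \tr (index_mx phi) = \sum_p phi p p.
Proof. by rewrite -sum_enum_val; apply: eq_bigr => a _; rewrite mxE. Qed.

Definition diag_index (u : I -> R) p q : R := (p == q)%:R * u p.

Lemma index_mx_diagM u phi :
  index_mx (diag_index u) *m index_mx phi = index_mx (fun p q => u p * phi p q).
Proof.
rewrite index_mxM; congr index_mx; apply/funext => p; apply/funext => q.
rewrite (bigD1 p) //= big1 ?addr0 => [|k kp]; first by rewrite /diag_index eqxx mul1r.
by rewrite /diag_index eq_sym (negPf kp) !mul0r.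
Qed.

Lemma det_index_diag u : \det (index_mx (diag_index u)) = \prod_p u p.
Proof.
rewrite (_ : index_mx _ = diag_mx (\row_a u (enum_val a))); last first.
  apply/matrixP => a b; rewrite !mxE /diag_index (inj_eq enum_val_inj).
  by case: eqP; rewrite ?mul1r ?mul0r.
rewrite det_diag (reindex (@enum_rank I)) /=; last exact/onW_bij/enum_rank_bij.
by apply: eq_bigr => p _; rewrite mxE enum_rankK.
Qed.

Lemma index_mx_scalar (c : R) : index_mx (diag_index (fun=> c)) = c%:M.
Proof.
apply/matrixP => a b; rewrite !mxE /diag_index (inj_eq enum_val_inj).
by case: eqP; rewrite ?mul1r ?mul0r ?mulr1n ?mulr0n.
Qed.

Lemma quad_index_mx phi (c : 'I_N -> R) : quad (index_mx phi) c =
  \sum_p \sum_q phi p q * (c (enum_rank p) * c (enum_rank q)).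
Proof.
rewrite /quad (reindex (@enum_rank I)) /=; last exact/onW_bij/enum_rank_bij.
apply: eq_bigr => p _; rewrite (reindex (@enum_rank I)) /=; last exact/onW_bij/enum_rank_bij.
by apply: eq_bigr => q _; rewrite mxE !enum_rankK.
Qed.

End indexed_matrices.

Section fibre_coordinates.
Context (R : realType) (G : graph) (r : nat) (B : bundle R G r).
Implicit Types (x y : vertex G) (i : 'I_r).

Definition fib_basis x i : B x := (vbasis {:B x})`_i.

Definition fib_coord x i : B x -> R :=
  coord (vbasis {:B x}) (cast_ord (esym (dim_fibv B x)) i).

Lemma fib_coordZ x i k (v : B x) : fib_coord i (k *: v) = k * fib_coord i v.
Proof. exact: linearZ. Qed.

Lemma fib_coord0 x i : fib_coord i (0 : B x) = 0.
Proof. exact: linear0. Qed.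

Lemma fib_coord_sum (T : Type) (s : seq T) x i (f : T -> B x) :
  fib_coord i (\sum_(k <- s) f k) = \sum_(k <- s) fib_coord i (f k).
Proof. exact: linear_sum. Qed.

Lemma fib_basisE x (v : B x) : v = \sum_i fib_coord i v *: fib_basis x i.
Proof.
rewrite [LHS](coord_vbasis (memvf v)).
rewrite (reindex (cast_ord (esym (dim_fibv B x)))) //=.
by exists (cast_ord (dim_fibv B x)) => k _; apply: val_inj.
Qed.

Lemma fib_coord_basis x i j : fib_coord i (fib_basis x j) = (i == j)%:R.
Proof.
rewrite /fib_coord /fib_basis -[nat_of_ord j]/(nat_of_ord (cast_ord (esym (dim_fibv B x)) j)).
rewrite coord_free; last exact/basis_free/vbasisP.
by rewrite eq_sym (inj_eq (@cast_ord_inj _ _ _)).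
Qed.

Lemma lftrace_fib x (f : 'End(B x)) : lftrace f = \sum_i fib_coord i (f (fib_basis x i)).
Proof.
rewrite /lftrace (reindex (cast_ord (esym (dim_fibv B x)))) //=.
by exists (cast_ord (dim_fibv B x)) => k _; apply: val_inj.
Qed.

(** The bound is uniform over the vectors of bounded norm, hence over the images of one
    vector under all holonomies. *)
Lemma fib_coord_bounded x i (m : R) : 0 <= m -> exists2 C : R, 0 <= C &
  forall v : B x, edot (B x) v v <= m -> `|fib_coord i v| <= C.
Proof.
move=> m0; have [b [b0 bE]] := orthobasisT (B x).
pose c k := fib_coord i (tnth b k) / edot (B x) (tnth b k) (tnth b k).
exists (\sum_k `|c k| * (m + edot (B x) (tnth b k) (tnth b k))).
  by apply: sumr_ge0 => k _; rewrite mulr_ge0 // addr_ge0 // edot_ge0.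
move=> v vm; rewrite [in fib_coord _ v](bE v) fib_coord_sum.
rewrite (le_trans (ler_norm_sum _ _ _)) //; apply: ler_sum => k _.
rewrite fib_coordZ mulrAC -mulrA -/(c k) normrM mulrC ler_wpM2l //.
set t := tnth b k; have p1 := edot_ge0 (v + t); have p2 := edot_ge0 (v + (-1) *: t).
have tt := edot_ge0 t; have vv := edot_ge0 v.
move: p1 p2; rewrite !(edotDl, edotDr, edotZl, edotZr) (edotC t v) => p1 p2.
by rewrite ler_norml; apply/andP; split; lra.
Qed.

End fibre_coordinates.

(** * Transport along edges and paths *)

Lemma isometric_iso_comp (R : realType) (U V W : espace R) (f : 'Hom(V, W)) (k : 'Hom(U, V)) :
  isometric_iso f -> isometric_iso k -> isometric_iso (f \o k)%VF.
Proof.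
move=> [[f' fK Kf] fi] [[k' kK Kk] ki]; split.
  by exists (k' \o f') => v; rewrite /= comp_lfunE ?fK ?kK ?Kk ?Kf.
by move=> u v; rewrite !comp_lfunE fi ki.
Qed.

Section vertex_casts.
Context (R : realType) (G : graph) (r : nat) (B : bundle R G r).
Implicit Types (x y : vertex G).

Lemma vertex_cast_id x : vertex_cast B x x = \1%VF.
Proof.
rewrite /vertex_cast; case: eqP => // e.
by rewrite (Prop_irrelevance e erefl).
Qed.

Lemma vertex_cast_neq x y : x != y -> vertex_cast B x y = 0.
Proof. by rewrite /vertex_cast; case: eqP. Qed.

Lemma vertex_cast_sym x y u v :
  edot (B y) (vertex_cast B x y u) v = edot (B x) (vertex_cast B y x v) u.
Proof.
have [xy|xy] := eqVneq x y.
  by move: u v; rewrite -xy => u v; rewrite vertex_cast_id !id_lfunE edotC.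
by rewrite !vertex_cast_neq ?(eq_sym y) // !lfunE /= !edot0l.
Qed.

Variable g : connection B.

Lemma transport_iso e : isometric_iso (transport g e).
Proof. exact: (isometric_iso_comp (conn_out_iso g e) (conn_in_iso g e)). Qed.

Lemma holonomy_end x es y : last x (map (@tgt G) es) != y -> holonomy g x es y = 0.
Proof.
elim: es x => [|e es IH] x /=; first exact: vertex_cast_neq.
by move=> h; rewrite IH // comp_lfun0l.
Qed.

Lemma holonomy_le x es y v :
  edot (B y) (holonomy g x es y v) (holonomy g x es y v) <= edot (B x) v v.
Proof.
have cast_le a b (w : B a) :
    edot (B b) (vertex_cast B a b w) (vertex_cast B a b w) <= edot (B a) w w.
  have [ab|ab] := eqVneq a b; last by rewrite vertex_cast_neq // lfunE edot0l edot_ge0.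
  by case: b / ab; rewrite vertex_cast_id id_lfunE.
elim: es x v => [|e es IH] x v /=; first exact: cast_le.
rewrite 2!comp_lfunE; apply: le_trans (IH _ _) _.
by rewrite [leLHS](transport_iso e).2 cast_le.
Qed.

Lemma holonomy1 e x y : holonomy g x [:: e] y =
  (vertex_cast B (tgt e) y \o (transport g e \o vertex_cast B x (src e)))%VF.
Proof. by []. Qed.

Lemma conn_out_cast e e' (E : e = e') :
  (conn_out g e' \o espace_cast (congr1 (fibe B) E) =
   espace_cast (congr1 (fibv B) (congr1 (@tgt G) E)) \o conn_out g e)%VF.
Proof. by case: e' / E; rewrite /= comp_lfun1l comp_lfun1r. Qed.

Lemma espace_cast_trans (U V W : espace R) (e : U = V) (f : V = W) (k : U = W) v :
  espace_cast f (espace_cast e v) = espace_cast k v.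
Proof. by case: W / f k => k; case: V / e k => k /=; rewrite (Prop_irrelevance k erefl) !id_lfunE. Qed.

(** Transport along e^-1 is inverse, hence adjoint, to transport along e.  The axiom
    conn_einv says so for the half-edge at the source of e; for the half-edge at the target
    it is used at e^-1, modulo the equality of (e^-1)^-1 and e. *)
Lemma holonomy_einv_sym e x y u v :
  edot (B y) (holonomy g x [:: e] y u) v =
  edot (B x) (holonomy g y [:: einv e] x v) u.
Proof.
have [sx|sx] := eqVneq x (src e); last first.
  have -> : holonomy g y [:: einv e] x = 0.
    by apply: holonomy_end; rewrite /= tgt_einv eq_sym.
  by rewrite holonomy1 (vertex_cast_neq sx) !comp_lfun0r !zero_lfunE !edot0l.
have [ty|ty] := eqVneq (tgt e) y; last first.
  have -> : holonomy g x [:: e] y = 0 by exact: holonomy_end.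
  rewrite holonomy1 (@vertex_cast_neq y); last by rewrite -tgt_einv einvK eq_sym.
  by rewrite !comp_lfun0r !zero_lfunE !edot0l.
move: v; case: y / ty => v; move: u; rewrite sx => u {x sx}.
rewrite !holonomy1 !vertex_cast_id comp_lfun1l comp_lfun1r.
have [[]] := transport_iso e => f fK Kf iso.
suff -> : (vertex_cast B (tgt (einv e)) (src e) \o
   (transport g (einv e) \o vertex_cast B (tgt e) (src (einv e))))%VF v = f v.
  by rewrite edotC -{1}(Kf v) iso.
apply: (can_inj fK); rewrite Kf.
have E1 : tgt e = src (einv e) by rewrite -tgt_einv einvK.
have vE a b (E : a = b) : vertex_cast B a b = espace_cast (congr1 (fibv B) E).
  by rewrite /vertex_cast; case: eqP => // E'; rewrite (Prop_irrelevance E' E).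
rewrite (vE _ _ (tgt_einv e)) (vE _ _ E1) /transport !comp_lfunE.
set w := conn_in g (einv e) _.
have c1 := conn_einv g e; have c2 := conn_einv g (einv e).
have [ib _] := conn_in_iso g e; have [fK1 Kf1] := bij_lfunK ib.
have [ib' _] := conn_in_iso g (einv e); have [fK2 Kf2] := bij_lfunK ib'.
have wE : w = espace_cast (esym (fibe_einv B e)) (espace_cast (fibe_einv B e) w).
  by rewrite (espace_cast_trans _ _ erefl) /= id_lfunE.
have -> : espace_cast (congr1 B (tgt_einv e)) (conn_out g (einv e) w) =
    (conn_in g e)^-1%VF (espace_cast (fibe_einv B e) w).
  by rewrite -c1 !comp_lfunE -wE.
rewrite Kf1; apply: (bij_inj (espace_cast_bij (congr1 (fibv B) E1))).
rewrite -[RHS](fK2 (espace_cast _ v)) -/w -c2 !comp_lfunE.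
have E : e = einv (einv e) by rewrite einvK.
rewrite -(espace_cast_trans (fibe_einv B e) (congr1 (fibe B) E)).
rewrite -[conn_out g (einv (einv e)) _]comp_lfunE conn_out_cast comp_lfunE.
by rewrite (espace_cast_trans _ _ (congr1 (fibv B) E1)).
Qed.

End vertex_casts.

(** * The trace of the Green function *)

Section bundle_matrices.
Context (R : realType) (G : wgraph R) (r : nat) (B : bundle R G r) (g : connection B).
Local Notation I := (proper_vertex G * 'I_r)%type.
Implicit Types (x y : vertex G) (p q k : I) (theta : vertex G -> R).

Definition fib_at p : B (val p.1) := fib_basis B (val p.1) p.2.

(** The jump operator Q of the walk, twisted by the connection: row (x, i) contains the
    coordinates of the i-th basis vector at x, transported along one random jump and lost
    if the jump ends in the well. *)
Definition jump_index p q : R := \sum_(e | src e == val p.1)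
  cond e / lambda (val p.1) * fib_coord q.2 (holonomy g (val p.1) [:: e] (val q.1) (fib_at p)).

Definition jump_mx := index_mx jump_index.

Definition killing_mx theta := index_mx (diag_index (fun p : I => 1 + theta (val p.1))).

Definition hold_mx theta := index_mx (diag_index (fun p : I => (1 + theta (val p.1))^-1)).

Lemma path_sum_well theta n f x : x \in well G -> path_sum theta n f x = 0.
Proof. by case: n => [|n] /= ->. Qed.

Lemma path_sum_lin theta n (T : Type) (s : seq T) (c : T -> R) (f : T -> seq (edge G) -> R) x :
  path_sum theta n (fun es => \sum_(k <- s) c k * f k es) x =
  \sum_(k <- s) c k * path_sum theta n (f k) x.
Proof.
elim: n f x => [|n IH] f x /=.
  case: ifP => _; first by rewrite big1 // => k _; rewrite mulr0.
  by rewrite mulr_sumr; apply: eq_bigr => k _; rewrite mulrCA.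
case: ifP => _; first by rewrite big1 // => k _; rewrite mulr0.
under eq_bigr do rewrite IH mulr_sumr.
rewrite exchange_big mulr_sumr; apply: eq_bigr => k _ /=.
rewrite mulrCA; congr (_ * _); rewrite mulr_sumr; apply: eq_bigr => e _.
by rewrite mulrCA.
Qed.

Definition transfer theta n p q : R :=
  path_sum theta n (fun es => fib_coord q.2 (holonomy g (val p.1) es (val q.1) (fib_at p))) (val p.1).

Lemma sum_proper0 (V : nmodType) (F : I -> V) y : (forall p, val p.1 != y -> F p = 0) -> y \in well G ->
  \sum_p F p = 0.
Proof.
move=> F0 yW; apply: big1 => -[[x xW] i] _; apply: F0 => /=.
by apply: contraNneq xW => ->.
Qed.

Lemma sum_proper (V : nmodType) (F : I -> V) y (yW : y \notin well G) :
  (forall p, val p.1 != y -> F p = 0) -> \sum_p F p = \sum_i F (Sub y yW, i).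
Proof.
move=> F0; rewrite (eq_bigr (fun p => F (p.1, p.2))); last by case.
rewrite -(pair_bigA _ (fun (z : proper_vertex G) (i : 'I_r) => F (z, i))) /= (bigD1 (Sub y yW)) //= [X in _ + X]big1 ?addr0 //.
by move=> z zy; rewrite big1 // => i _; apply: F0; rewrite -(inj_eq val_inj) in zy.
Qed.

(** Expanding the vector transported along the first edge in the basis of its fibre turns
    the concatenation of edges into a product of matrices. *)
Lemma transfer_neumann theta n :
  index_mx (transfer theta n) = neumann_term (hold_mx theta) jump_mx n.
Proof.
elim: n => [|n IH] /=.
  congr index_mx; apply/funext => p; apply/funext => q.
  rewrite /transfer /= (negPf (valP p.1)) /diag_index mulrC.
  case: p q => x i [y j] /=; have [xy|xy] := eqVneq x y.
    rewrite -xy vertex_cast_id id_lfunE fib_coord_basis xpair_eqE eqxx /=.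
    by rewrite eq_sym.
  by rewrite vertex_cast_neq ?(inj_eq val_inj) // zero_lfunE fib_coord0 xpair_eqE (negPf xy).
rewrite -IH index_mx_diagM index_mxM; congr index_mx; apply/funext => p; apply/funext => q.
rewrite /transfer /= (negPf (valP p.1)).
under [RHS]eq_bigr do rewrite -mulrA; rewrite -mulr_sumr; congr (_ * _).
rewrite /jump_index; under [RHS]eq_bigr do rewrite mulr_suml.
rewrite exchange_big /=; apply: eq_bigr => e ex.
under [RHS]eq_bigr do rewrite -mulrA; rewrite -mulr_sumr; congr (_ * _).
have [eW|eW] := boolP (tgt e \in well G).
  rewrite path_sum_well // (@sum_proper0 _ _ (tgt e)) // => k ke.
  by rewrite vertex_cast_neq 1?eq_sym // comp_lfun0l zero_lfunE fib_coord0 mul0r.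
rewrite (sum_proper eW); last first.
  move=> k ke.
  by rewrite vertex_cast_neq 1?eq_sym // comp_lfun0l zero_lfunE fib_coord0 mul0r.
rewrite -path_sum_lin; congr (path_sum _ _ _ _); apply/funext => es /=.
rewrite vertex_cast_id comp_lfun1l comp_lfunE.
set v := (X in holonomy _ _ _ _ X).
rewrite [in LHS](fib_basisE v) linear_sum fib_coord_sum.
by apply: eq_bigr => i _; rewrite linearZ fib_coordZ.
Qed.

Lemma hold_killing theta : (forall x, 0 <= theta x) ->
  hold_mx theta *m killing_mx theta = 1%:M.
Proof.
move=> theta0; rewrite /hold_mx /killing_mx index_mx_diagM -index_mx_scalar.
congr index_mx; apply/funext => p; apply/funext => q.
by rewrite /diag_index mulrCA mulVf // gt_eqF // ltr_pwDl.
Qed.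

Lemma sum_proper_vertex (F : vertex G -> R) :
  \sum_(x | x \notin well G) F x = \sum_(z : proper_vertex G) F (val z).
Proof. exact: (big_sub [pred x | x \notin well G] F). Qed.

Section green_trace.
Variables (theta : vertex G -> R) (eps : R).
Hypotheses (eps0 : 0 < eps) (theta_ge : forall x, eps <= theta x).

Lemma cvg_geometric0 (C : R) : C * (1 + eps)^-1 ^+ n @[n --> \oo] --> (0 : R).
Proof.
rewrite -(mulr0 C); apply: cvgM; first exact: cvg_cst.
apply: cvg_expr; rewrite ger0_norm ?invr_ge0 ?addr_ge0 ?ltW //.
by rewrite invf_lt1 ?addr_gt0 // ltrDl.
Qed.

Lemma cvg_transfer0 p q : transfer theta n p q @[n --> \oo] --> (0 : R).
Proof.
have [C C0 CP] := @fib_coord_bounded _ _ _ B (val q.1) q.2 _ (edot_ge0 (fib_at p)).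
apply/norm_cvg0P; apply: (@squeeze_cvgr _ _ _ _ (fun=> 0)); last 2 first.
- exact: cvg_cst.
- exact: (cvg_geometric0 C).
near=> n; rewrite normr_ge0 /=; apply: (path_sum_le eps0) => // es.
by apply: CP; exact: holonomy_le.
Unshelve. all: by end_near.
Qed.

Lemma cvg_sum_transfer : killing_mx theta - jump_mx \in unitmx ->
  \sum_(k < m) \sum_p transfer theta k p p @[m --> \oo] -->
  \tr (invmx (killing_mx theta - jump_mx)).
Proof.
move=> u; have := cvg_trace_neumann (hold_killing (fun x => le_trans (ltW eps0) (theta_ge x))) u.
rewrite (_ : (fun m => _) = (fun m => \sum_(k < m) \sum_p transfer theta k p p)).
  by apply => i j; under eq_fun do rewrite -transfer_neumann mxE; exact: cvg_transfer0.
by apply/funext => m; apply: eq_bigr => k _; rewrite -transfer_neumann trace_index_mx.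
Qed.

(** For the connection by conjugation on End(F), this is half the square of the trace of the
    holonomy of F, by lftrace_holonomy_end. *)
Definition half_trace x es : R := 2^-1 * lftrace (holonomy g x es x).

Lemma half_trace_path_sum (n : nat) : \sum_(x | x \notin well G) path_sum theta n (half_trace x) x =
  2^-1 * \sum_p transfer theta n p p.
Proof.
rewrite sum_proper_vertex.
rewrite [in RHS](eq_bigr (fun p : I => transfer theta n (p.1, p.2) (p.1, p.2))); last by case.
rewrite -(pair_bigA _ (fun (z : proper_vertex G) (i : 'I_r) => transfer theta n (z, i) (z, i))) /=.
rewrite mulr_sumr; apply: eq_bigr => z _; rewrite mulr_sumr -path_sum_lin.
congr (path_sum _ _ _ _); apply/funext => es.
by rewrite /half_trace lftrace_fib mulr_sumr.
Qed.

Hypothesis trace_ge0 : forall x es, 0 <= lftrace (holonomy g x es x).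

Lemma half_trace_ge0 x es : 0 <= half_trace x es.
Proof. by rewrite mulr_ge0 ?trace_ge0. Qed.

Lemma half_trace_bounded x : exists2 C : R, 0 <= C & forall es, 0 <= half_trace x es <= C.
Proof.
pose m := \sum_i edot (B x) (fib_basis B x i) (fib_basis B x i).
have m0 : 0 <= m by apply: sumr_ge0 => i _; exact: edot_ge0.
have /choice[C CP] i : exists C : R, 0 <= C /\
    forall v : B x, edot (B x) v v <= m -> `|fib_coord i v| <= C.
  by have [C C0 CP] := @fib_coord_bounded _ _ _ B x i m m0; exists C.
exists (2^-1 * \sum_i C i).
  by rewrite mulr_ge0 // sumr_ge0 // => i _; have [] := CP i.
move=> es; rewrite half_trace_ge0 /half_trace ler_wpM2l // lftrace_fib ler_sum // => i _.
rewrite (le_trans (ler_norm _)) //; have [_] := CP i; apply.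
rewrite (le_trans (holonomy_le _ _ _ _)) // /m (bigD1 i) //= lerDl.
by apply: sumr_ge0 => j _; exact: edot_ge0.
Qed.

Lemma half_trace_well x es : x \notin well G ->
  last x (map (@tgt G) es) \in well G -> half_trace x es = 0.
Proof.
move=> xW esW; rewrite /half_trace holonomy_end ?lftrace_fib.
  by rewrite big1 ?mulr0 // => i _; rewrite zero_lfunE fib_coord0.
by apply: contraNneq xW => <-.
Qed.

Lemma green_fin x : x \notin well G -> green theta (half_trace x) x \is a fin_num.
Proof.
move=> xW; have [C C0 CP] := half_trace_bounded x.
rewrite ge0_fin_numE; last first.
  by apply: integral_ge0 => w _; apply: integral_ge0 => t _; rewrite lee_fin weight_ge0 // => es; exact: half_trace_ge0.
by rewrite (le_lt_trans (green_le eps0 theta_ge C0 CP (fun es => half_trace_well xW (es := es)))) ?ltry.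
Qed.

(** The sum over all vertices x of the paths from x to x with n jumps is the trace of the
    n-th term of the Neumann series of the resolvent. *)
Lemma green_trace : killing_mx theta - jump_mx \in unitmx ->
  (\sum_(x | x \notin well G) green theta (half_trace x) x =
   (2^-1 * \tr (invmx (killing_mx theta - jump_mx)))%:E)%E.
Proof.
move=> u; pose S n := \sum_(x | x \notin well G) \sum_(k < n) path_sum theta k (half_trace x) x.
have -> : (\sum_(x | x \notin well G) green theta (half_trace x) x =
    (\sum_(x | x \notin well G) fine (green theta (half_trace x) x))%:E)%E.
  by rewrite -sumEFin; apply: eq_bigr => x xW; rewrite fineK ?green_fin.
congr EFin; apply: (@cvg_unique _ (@Rhausdorff R) (S n @[n --> \oo])).
  apply: cvg_big => [|x xW]; first exact: add_continuous.
  have [C C0 CP] := half_trace_bounded x.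
  apply/subr_cvg0/norm_cvg0P; apply: (@squeeze_cvgr _ _ _ _ (fun=> 0)); last 2 first.
  - exact: cvg_cst.
  - exact: (cvg_geometric0 (C / eps)).
  near=> n; rewrite normr_ge0 /= distrC.
  exact: (green_path_sum eps0 theta_ge n C0 CP (fun es => half_trace_well xW (es := es))).
rewrite (_ : S = fun n => 2^-1 * \sum_(k < n) \sum_p transfer theta k p p).
  by apply: cvgM; [exact: cvg_cst|exact: cvg_sum_transfer].
apply/funext => n; rewrite /S exchange_big /= mulr_sumr.
by apply: eq_bigr => k _; exact: half_trace_path_sum.
Unshelve. all: by end_near.
Qed.

End green_trace.
End bundle_matrices.

(** * The Dirichlet energy as a quadratic form *)

Section energy_form.
Local Arguments holonomy : simpl never.
Context (R : realType) (G : wgraph R) (r : nat) (B : bundle R G r) (g : connection B).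
Local Notation I := (proper_vertex G * 'I_r)%type.
Implicit Types (x y : vertex G) (p q k : I) (theta : vertex G -> R) (c : I -> R).

Definition section_of c x : B x :=
  if insub x is Some z then \sum_(i < r) c (z, i) *: fib_basis B x i else 0.

Lemma section_of_well c x : x \in well G -> section_of c x = 0.
Proof. by move=> xW; rewrite /section_of insubN // xW. Qed.

Lemma section_of_proper c (z : proper_vertex G) :
  section_of c (val z) = \sum_i c (z, i) *: fib_basis B (val z) i.
Proof. by rewrite /section_of valK. Qed.

(** The casts vanish unless the vertices agree, so the sum may run over all indices; this
    makes the section at y linear in c without reference to y being proper. *)
Lemma section_ofE c y :
  section_of c y = \sum_p c p *: vertex_cast B (val p.1) y (fib_at B p).
Proof.
have cast0 p : val p.1 != y -> c p *: vertex_cast B (val p.1) y (fib_at B p) = 0.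
  by move=> py; rewrite vertex_cast_neq // zero_lfunE scaler0.
have [yW|yW] := boolP (y \in well G); first by rewrite section_of_well // (sum_proper0 cast0).
rewrite (sum_proper yW cast0) [LHS](section_of_proper c (Sub y yW)).
by apply: eq_bigr => i _; rewrite [vertex_cast _ _ _]vertex_cast_id id_lfunE.
Qed.

Lemma section_form c x y (f : 'Hom(B x, B y)) :
  edot (B y) (f (section_of c x)) (section_of c y) = \sum_p \sum_q
    edot (B y) (f (vertex_cast B (val p.1) x (fib_at B p)))
      (vertex_cast B (val q.1) y (fib_at B q)) * (c p * c q).
Proof.
rewrite !section_ofE (linear_sum f).
rewrite (big_morph (fun u => edot (B y) u _) (fun u v => edotDl u v _) (edot0l _)).
apply: eq_bigr => p _; rewrite linearZ edotZl edotC.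
rewrite (big_morph (fun u => edot (B y) u _) (fun u v => edotDl u v _) (edot0l _)).
by rewrite mulr_sumr; apply: eq_bigr => q _; rewrite edotZl edotC; ring.
Qed.

(** The Gram matrix of the fibre bases, which is block diagonal. *)
Definition gram p q : R :=
  edot (B (val q.1)) (vertex_cast B (val p.1) (val q.1) (fib_at B p)) (fib_at B q).

Definition jump_form p q : R := \sum_(e | src e == val p.1) cond e *
  edot (B (val q.1)) (holonomy g (val p.1) [:: e] (val q.1) (fib_at B p)) (fib_at B q).

(** The matrix lambda (1 + theta - Q) Gr of energy_mxE, in a form in which each of the two
    terms is symmetric. *)
Definition energy_index theta p q : R :=
  lambda (val p.1) * (1 + theta (val p.1)) * gram p q - jump_form p q.

Definition vertex_mx := index_mx (diag_index (fun p : I => lambda (val p.1))).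

Lemma jump_gram p q : \sum_k jump_index g p k * gram k q = (lambda (val p.1))^-1 * jump_form p q.
Proof.
rewrite /jump_index /jump_form mulr_sumr; under eq_bigr do rewrite mulr_suml.
rewrite exchange_big; apply: eq_bigr => e _.
rewrite mulrA [cond e / _]mulrC; under eq_bigr do rewrite -mulrA; rewrite -mulr_sumr.
congr (_ * _).
rewrite (sum_proper (valP q.1)); last first.
  by move=> k kq; rewrite /gram vertex_cast_neq // zero_lfunE edot0l mulr0.
set v := holonomy _ _ _ _ _.
rewrite [in RHS](fib_basisE v) edot_suml; apply: eq_bigr => i _.
by rewrite /gram [vertex_cast _ _ _]vertex_cast_id id_lfunE edotZl.
Qed.

Lemma energy_mxE theta :
  index_mx (energy_index theta) =
  vertex_mx *m (killing_mx r theta - jump_mx g) *m index_mx gram.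
Proof.
rewrite -mulmxA mulmxBl index_mx_diagM /jump_mx index_mxM.
rewrite mulmxBr !index_mx_diagM; apply/matrixP => a b; rewrite !mxE /energy_index.
rewrite jump_gram !mulrA divff; last by rewrite gt_eqF // lambda_gt0.
by rewrite mul1r.
Qed.

Lemma gramC p q : gram p q = gram q p.
Proof. exact: vertex_cast_sym. Qed.

Lemma jump_formC p q : jump_form p q = jump_form q p.
Proof.
rewrite /jump_form [RHS](reindex_inj (inv_inj (@einvK G))) /=.
rewrite [LHS](bigID (fun e => tgt e == val q.1)) /= [X in _ + X]big1 ?addr0; last first.
  by move=> e /andP[_ /negPf eq]; rewrite holonomy_end /= ?eq // zero_lfunE edot0l mulr0.
rewrite [RHS](bigID (fun e => src e == val p.1)) /= [X in _ + X]big1 ?addr0; last first.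
  by move=> e /andP[_ eq]; rewrite [holonomy _ _ _ _]holonomy_end /= ?tgt_einv // zero_lfunE edot0l mulr0.
apply: eq_big => e; first by rewrite andbC -(tgt_einv (einv e)) einvK.
by move=> _; rewrite cond_einv holonomy_einv_sym.
Qed.

Lemma energy_indexC theta p q : energy_index theta p q = energy_index theta q p.
Proof.
rewrite /energy_index gramC jump_formC; congr (_ - _).
have [<-//|pq] := eqVneq p.1 q.1.
by rewrite /gram vertex_cast_neq ?(inj_eq val_inj) 1?eq_sym // zero_lfunE edot0l !mulr0.
Qed.

Definition norm2 c x : R := edot (B x) (section_of c x) (section_of c x).

Lemma gram_form (u : vertex G -> R) c :
  \sum_p \sum_q u (val p.1) * gram p q * (c p * c q) = \sum_x u x * norm2 c x.
Proof.
under [RHS]eq_bigr => x _.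
  rewrite /norm2 -[X in edot _ X](id_lfunE) section_form mulr_sumr.
  under eq_bigr do rewrite mulr_sumr.
  over.
rewrite [RHS]exchange_big; apply: eq_bigr => p _.
rewrite [RHS]exchange_big; apply: eq_bigr => q _ /=.
rewrite (bigD1 (val p.1)) //= big1 ?addr0 => [|x xp]; last first.
  by rewrite vertex_cast_neq 1?eq_sym // zero_lfunE linear0 edot0l mul0r mulr0.
by rewrite vertex_cast_id !id_lfunE /gram vertex_cast_sym edotC !mulrA.
Qed.

Lemma jump_form_section c : \sum_p \sum_q jump_form p q * (c p * c q) =
  \sum_e cond e * edot (B (tgt e)) (transport g e (section_of c (src e))) (section_of c (tgt e)).
Proof.
under [RHS]eq_bigr => e _.
  rewrite section_form mulr_sumr; under eq_bigr do rewrite mulr_sumr.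
  over.
rewrite [RHS]exchange_big; apply: eq_bigr => p _.
rewrite [RHS]exchange_big; apply: eq_bigr => q _ /=.
rewrite /jump_form big_mkcond mulr_suml; apply: eq_bigr => e _.
have [ep|ep] := boolP (src e == val p.1); last first.
  by rewrite vertex_cast_neq 1?eq_sym // zero_lfunE linear0 edot0l !mul0r mulr0.
by rewrite holonomy1 !comp_lfunE vertex_cast_sym edotC !mulrA.
Qed.

(** In the expansion of the squares, the terms at the source and at the target of an edge
    have the same sum, because transport is isometric and reversing the edges exchanges
    them. *)
Lemma dirichlet_energyE (f : forall x, B x) : dirichlet_energy g f =
  2^-1 * (\sum_x lambda x * edot (B x) (f x) (f x) -
    \sum_e cond e * edot (B (tgt e)) (transport g e (f (src e))) (f (tgt e))).
Proof.
pose n2 x := edot (B x) (f x) (f x).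
have src_sum : \sum_e cond e * n2 (src e) = \sum_x lambda x * n2 x.
  rewrite (partition_big (@src G) xpredT) //=; apply: eq_bigr => x _.
  by rewrite /lambda mulr_suml; apply: eq_bigr => e /eqP <-.
have tgt_sum : \sum_e cond e * n2 (tgt e) = \sum_x lambda x * n2 x.
  rewrite -src_sum [LHS](reindex_inj (inv_inj (@einvK G))) /=.
  by apply: eq_bigr => e _; rewrite cond_einv tgt_einv.
rewrite /dirichlet_energy.
transitivity (4^-1 * (\sum_e cond e * n2 (src e) + \sum_e cond e * n2 (tgt e) -
   2 * \sum_e cond e * edot (B (tgt e)) (transport g e (f (src e))) (f (tgt e)))).
  congr (_ * _); rewrite mulr_sumr -big_split -sumrB /=; apply: eq_bigr => e _.
  have [b i] := transport_iso g e; have [fK Kf] := bij_lfunK b.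
  rewrite -[X in _ * X = _]i linearB /= Kf -scaleN1r.
  by rewrite !(edotDl, edotDr, edotZl, edotZr) i (edotC (f (tgt e))) /n2; ring.
rewrite src_sum tgt_sum -/(n2 _); set a := \sum_x _; set b := \sum_e _; by field.
Qed.

Lemma energy_quad theta c :
  \sum_p \sum_q energy_index theta p q * (c p * c q) =
  2 * dirichlet_energy g (section_of c) + \sum_x lambda x * theta x * norm2 c x.
Proof.
rewrite dirichlet_energyE mulrA divff ?mul1r ?pnatr_eq0 // addrAC -big_split -jump_form_section /=.
rewrite (eq_bigr (fun x => lambda x * (1 + theta x) * norm2 c x)); last first.
  by move=> x _; rewrite /norm2; ring.
rewrite -(gram_form (fun x => lambda x * (1 + theta x))) -sumrB; apply: eq_bigr => p _.
by rewrite -sumrB; apply: eq_bigr => q _; rewrite /energy_index mulrBl.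
Qed.

Lemma section_of_inj c : (forall x, norm2 c x = 0) -> forall p, c p = 0.
Proof.
move=> c0 [z i]; have := section_of_proper c z; rewrite (edot_eq0 (c0 _)).
move/(congr1 (fib_coord i)); rewrite fib_coord0 fib_coord_sum (bigD1 i) //= big1.
  by rewrite fib_coordZ fib_coord_basis eqxx mulr1 addr0.
by move=> j ji; rewrite fib_coordZ fib_coord_basis eq_sym (negPf ji) mulr0.
Qed.

Lemma norm2_ge0 c x : 0 <= norm2 c x.
Proof. exact: edot_ge0. Qed.

Lemma dirichlet_energy_ge0 (f : forall x, B x) : 0 <= dirichlet_energy g f.
Proof.
by rewrite mulr_ge0 // sumr_ge0 // => e _; rewrite mulr_ge0 ?edot_ge0 // ltW ?cond_gt0.
Qed.

(** If the energy vanishes, the norm of the section is constant along edges, hence on the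
    connected graph, and it is 0 on the well. *)
Lemma dirichlet_energy_gt0 c : (exists p, c p != 0) -> 0 < dirichlet_energy g (section_of c).
Proof.
move=> [p cp]; rewrite lt_neqAle dirichlet_energy_ge0 andbT eq_sym.
apply: contra cp; rewrite /dirichlet_energy mulf_eq0 invr_eq0 pnatr_eq0 /=.
rewrite psumr_eq0 => [/allP E0|e _]; last by rewrite mulr_ge0 ?edot_ge0 // ltW ?cond_gt0.
have edge_norm e : norm2 c (src e) = norm2 c (tgt e).
  have := E0 e (mem_index_enum _); rewrite /= mulf_eq0 gt_eqF ?cond_gt0 //= => /eqP/edot_eq0.
  move/eqP; rewrite subr_eq0 => /eqP fe; rewrite /norm2 fe.
  have [b i] := transport_iso g e; have [fK Kf] := bij_lfunK b.
  by rewrite -i Kf.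
have /set0Pn[w wW] := well_n0 G.
apply/eqP; apply: section_of_inj => x; have /connectP[s] := wgraph_connected x w.
elim: s x => [|y s IH] x /=; first by move=> _ <-; rewrite /norm2 section_of_well // edot0l.
move=> /andP[/existsP[e /andP[/eqP ex /eqP ey]] /IH h] /h; rewrite -ey => <-.
by rewrite -ex edge_norm.
Qed.

Definition energy_mx theta := index_mx (energy_index theta).

Lemma energy_mx_quad theta (c : 'I_#|{: I}| -> R) :
  quad (energy_mx theta) c = 2 * dirichlet_energy g (section_of (c \o enum_rank)) +
    \sum_x lambda x * theta x * norm2 (c \o enum_rank) x.
Proof. by rewrite quad_index_mx -energy_quad. Qed.

Lemma index_neq0 (c : 'I_#|{: I}| -> R) :
  (exists a, c a != 0) -> exists p, (c \o enum_rank) p != 0.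
Proof. by move=> [a ca]; exists (enum_val a); rewrite /= enum_valK. Qed.

Lemma energy_mx_gt0 theta (c : 'I_#|{: I}| -> R) : (forall x, 0 <= theta x) ->
  (exists a, c a != 0) -> 0 < quad (energy_mx theta) c.
Proof.
move=> theta0 /index_neq0 c0; rewrite energy_mx_quad ltr_pwDl //.
  by rewrite mulr_gt0 ?dirichlet_energy_gt0.
by apply: sumr_ge0 => x _; rewrite !mulr_ge0 ?norm2_ge0 ?lambda_ge0.
Qed.

Lemma energy_mxC theta a b : energy_mx theta a b = energy_mx theta b a.
Proof. by rewrite !mxE energy_indexC. Qed.

Lemma det_energy_mx theta : \det (energy_mx theta) =
  \det (killing_mx r theta - jump_mx g) * (\det vertex_mx * \det (index_mx gram)).
Proof. by rewrite /energy_mx energy_mxE !det_mulmx; ring. Qed.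

Lemma det_vertex_gram_gt0 : 0 < \det vertex_mx * \det (index_mx gram).
Proof.
rewrite mulr_gt0 //.
  by rewrite det_index_diag prodr_gt0 // => p _; exact: lambda_gt0.
apply: (proj1 (integral_gauss_quad _ _)) => [a b|c /index_neq0 [p cp]].
  by rewrite !mxE gramC.
rewrite quad_index_mx.
have -> : \sum_p \sum_q gram p q * (c (enum_rank p) * c (enum_rank q)) =
    \sum_x norm2 (c \o enum_rank) x.
  rewrite [RHS](eq_bigr (fun x => 1 * norm2 (c \o enum_rank) x)) => [|x _]; last by rewrite mul1r.
  rewrite -(gram_form (fun=> 1)); apply: eq_bigr => p' _; apply: eq_bigr => q _.
  by rewrite mul1r.
rewrite lt_neqAle sumr_ge0 ?andbT => [|x _]; last exact: norm2_ge0.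
apply: contra cp; rewrite eq_sym psumr_eq0 => [/allP n0|x _]; last exact: norm2_ge0.
by apply/eqP; apply: section_of_inj => x; apply/eqP; exact: n0 (mem_index_enum _).
Qed.

(** The matrix 1 + theta - Q need not be symmetric, but it becomes symmetric positive
    definite after multiplication by lambda on the left and by the Gram matrix on the right, both of
    which have positive determinants. *)
Lemma det_killing_gt0 theta : (forall x, 0 <= theta x) ->
  0 < \det (killing_mx r theta - jump_mx g).
Proof.
move=> theta0; rewrite -(pmulr_lgt0 _ det_vertex_gram_gt0) -det_energy_mx.
by have [] := integral_gauss_quad (energy_mxC theta) (fun v => @energy_mx_gt0 theta v theta0).
Qed.

Definition gauss_norm : R := Num.sqrt (2 * pi) ^+ #|{: I}| /
  Num.sqrt (\det vertex_mx * \det (index_mx gram)).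

Lemma gauss_norm_gt0 : 0 < gauss_norm.
Proof.
by rewrite divr_gt0 ?exprn_gt0 ?sqrtr_gt0 ?det_vertex_gram_gt0 // mulr_gt0 // pi_gt0.
Qed.

Lemma integral_gaussian_field theta : (forall x, 0 <= theta x) ->
  (\int[tuple_measure (@lebesgue_measure R) #|{: I}|]_c
    (expR (- (dirichlet_energy g (section_of_coord B c) +
      2^-1 * \sum_x lambda x * theta x *
        edot (B x) (section_of_coord B c x) (section_of_coord B c x))))%:E =
   (gauss_norm / Num.sqrt (\det (killing_mx r theta - jump_mx g)))%:E)%E.
Proof.
move=> theta0.
have [_ I1] := integral_gauss_quad (energy_mxC theta) (fun v => @energy_mx_gt0 theta v theta0).
rewrite /gauss_norm -mulrA -invfM -sqrtrM ?(ltW det_vertex_gram_gt0) // [_ * \det (killing_mx _ _ - _)]mulrC.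
rewrite -det_energy_mx -I1; apply: eq_integral => c _.
by rewrite energy_mx_quad mulrDr mulrA mulVf ?mul1r ?pnatr_eq0.
Qed.

End energy_form.

(** * The trace of a conjugation *)

Section conjugation_trace.
Context (R : realType).
Implicit Types V : espace R.

Lemma lftrace0 (V : vectType R) : lftrace (0 : 'End(V)) = 0.
Proof. by rewrite -(scale0r 0) lftraceZ mul0r. Qed.

Definition rank1 V (w v : V) : 'End(V) := linfun (fun u : V => edot V u v *: w).

Lemma rank1E V (w v u : V) : rank1 w v u = edot V u v *: w.
Proof.
have lin : linear (fun u : V => edot V u v *: w).
  by move=> k x y; rewrite edotDl edotZl scalerDl scalerA.
pose L := GRing.isLinear.Build _ _ _ _ _ lin.
pose f : {linear V -> V} := HB.pack (fun u : V => edot V u v *: w) L.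
exact: (lfunE f).
Qed.

(** The resolution of the identity by the vectors w k makes f a combination of rank-one
    maps, whose traces are scalar products. *)
Lemma lftrace_frame V (K : finType) (a : K -> R) (w : K -> V) (f : 'End(V)) :
  (forall u, u = \sum_k (a k * edot V u (w k)) *: w k) ->
  lftrace f = \sum_k a k * edot V (f (w k)) (w k).
Proof.
move=> wE; have fE : f = \sum_k a k *: rank1 (f (w k)) (w k).
  apply/lfunP => u; rewrite {1}(wE u) linear_sum sum_lfunE; apply: eq_bigr => k _.
  by rewrite scale_lfunE rank1E linearZ /= scalerA.
rewrite [in LHS]fE (big_morph (@lftrace _ _) (@lftraceD _ _) (lftrace0 V)).
by apply: eq_bigr => k _; rewrite lftraceZ lftrace_rank1.
Qed.

(** Conjugation by f sends the rank-one map given by w and v to the one given by f w and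
    f v, so that its trace is the product of the traces of f and of f^-1, that is of f and
    of its adjoint. *)
Lemma lftrace_conjugation V (f : 'End(V)) : isometric_iso f ->
  lftrace (conjugation f) = lftrace f ^+ 2.
Proof.
move=> [fb fi]; have [fK Kf] := bij_lfunK fb; have [b [b0 bE]] := orthobasisT V.
pose c i := (edot V (tnth b i) (tnth b i))^-1.
have trE (h : 'End(V)) : lftrace h = \sum_i c i * edot V (h (tnth b i)) (tnth b i).
  by apply: lftrace_frame => u; rewrite {1}(bE u); apply: eq_bigr => i _; rewrite mulrC.
have fV i : edot V ((f^-1)%VF (tnth b i)) (tnth b i) = edot V (f (tnth b i)) (tnth b i).
  by rewrite -fi Kf edotC.
pose K := ('I_(\dim {:V}) * 'I_(\dim {:V}))%type.
rewrite (@lftrace_frame (end_space V) K (fun k => c k.1 * c k.2)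
  (fun k => rank1 (tnth b k.1) (tnth b k.2))); last first.
  move=> u; apply/lfunP => v; rewrite sum_lfunE.
  rewrite (eq_bigr (fun k : K => (c k.1 * c k.2 * edot V v (tnth b k.2) *
     edot V (u (tnth b k.2)) (tnth b k.1)) *: tnth b k.1)); last first.
    move=> k _; rewrite scale_lfunE rank1E scalerA; congr (_ *: _).
    rewrite /= /end_dot.
    have -> : (adjoint u \o rank1 (tnth b k.1) (tnth b k.2))%VF =
        rank1 (adjoint u (tnth b k.1)) (tnth b k.2).
      by apply/lfunP => x; rewrite comp_lfunE !rank1E linearZ.
    by rewrite lftrace_rank1 edotC -adjointP; ring.
  rewrite -(pair_bigA _ (fun i j => (c i * c j * edot V v (tnth b j) *
     edot V (u (tnth b j)) (tnth b i)) *: tnth b i)) /= exchange_big /=.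
  rewrite {1}(bE v) linear_sum; apply: eq_bigr => j _; rewrite linearZ /= [in LHS](bE (u _)).
  rewrite scaler_sumr; apply: eq_bigr => i _; rewrite scalerA; congr (_ *: _).
  by rewrite /c; ring.
rewrite expr2 {1}(trE f) trE mulr_suml -(pair_bigA _ (fun i j => c i * c j *
  end_dot (conjugation f (rank1 (tnth b i) (tnth b j))) (rank1 (tnth b i) (tnth b j)))) /=.
apply: eq_bigr => i _; rewrite mulr_sumr; apply: eq_bigr => j _.
rewrite /end_dot conjugationE.
set h := (f \o _ \o _)%VF.
have -> : (adjoint h \o rank1 (tnth b i) (tnth b j))%VF =
        rank1 (adjoint h (tnth b i)) (tnth b j).
  by apply/lfunP => x; rewrite comp_lfunE !rank1E linearZ.
rewrite lftrace_rank1 edotC -adjointP /h !comp_lfunE rank1E linearZ edotZl fV.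
ring.
Qed.

End conjugation_trace.

Section end_holonomy.
Context (R : realType) (G : graph) (r : nat) (F : bundle R G r) (h : connection F).
Implicit Types (x y : vertex G).

(** The two holonomies are 0 together, namely if es is not a walk from x to y; otherwise
    both are compositions of isometries, and conjugation is functorial. *)
Lemma holonomy_conjugation x es y : 
  (holonomy h x es y = 0 /\ holonomy (end_connection h) x es y = 0) \/
  (isometric_iso (holonomy h x es y) /\
   holonomy (end_connection h) x es y = conjugation (holonomy h x es y)).
Proof.
have cast_case a b : (vertex_cast F a b = 0 /\ vertex_cast (end_bundle F) a b = 0) \/
  (isometric_iso (vertex_cast F a b) /\
   vertex_cast (end_bundle F) a b = conjugation (vertex_cast F a b)).
  have [<-|ab] := eqVneq a b; [right|by left; rewrite !vertex_cast_neq].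
  rewrite !vertex_cast_id conjugation1; split=> //; split; last by move=> u v; rewrite !id_lfunE.
  by exists id => v; rewrite id_lfunE.
elim: es x => [|e es IH] x /=; first exact: cast_case.
have [[-> ->]|[i1 ->]] := IH (tgt e); first by left; rewrite !comp_lfun0l.
have [[-> ->]|[i2 ->]] := cast_case x (src e); first by left; rewrite !comp_lfun0r.
have i3 := transport_iso h e; right.
have i4 := isometric_iso_comp i3 i2.
split; first exact: isometric_iso_comp.
by rewrite transport_end (conjugation_comp i1.1 i4.1) (conjugation_comp i3.1 i2.1).
Qed.

Lemma lftrace_holonomy_end x es :
  lftrace (holonomy (end_connection h) x es x) = lftrace (holonomy h x es x) ^+ 2.
Proof.
have [[-> ->]|[i ->]] := holonomy_conjugation x es x; last exact: lftrace_conjugation.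
by rewrite !lftrace0 expr0n.
Qed.

End end_holonomy.

(** * The walk stopped at a Lebesgue-distributed time *)

Section image_density_measure.
Context d d' (T : measurableType d) (Z : measurableType d') (R : realType).
Local Open Scope ereal_scope.

(** The intensity of the loops is given as a function on all sets; on measurable sets it
    is such a sum of images of densities, hence agrees with a measure. *)
Lemma image_density_measure (I : Type) (r : seq I) (P : pred I)
    (k : I -> {measure set Z -> \bar R}) (phi : Z -> T) (rho : I -> Z -> R) :
  measurable_fun setT phi -> (forall i, measurable_fun setT (rho i)) ->
  (forall i z, (0 <= rho i z)%R) ->
  exists m : {measure set T -> \bar R}, forall A, measurable A -> m A =
     \sum_(i <- r | P i) \int[k i]_z (\1_A (phi z) * rho i z)%:E.
Proof.
move=> mphi mrho rho0; pose m (A : set T) : \bar R := 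
  \sum_(i <- r | P i) \int[k i]_z (\1_A (phi z) * rho i z)%:E.
have m0 : m set0 = 0.
  by rewrite /m big1 // => i _; apply: integral0_eq => z _; rewrite indic0 mul0r.
have mge0 A : 0 <= m A.
  by apply: sume_ge0 => i _; apply: integral_ge0 => z _; rewrite lee_fin mulr_ge0.
have msa : semi_sigma_additive m.
  move=> F mF tF mUF.
  rewrite (_ : m _ = \sum_(n <oo) m (F n)); first exact: is_cvg_nneseries.
  rewrite /m nneseries_sum; last first.
    by move=> i n _; apply: integral_ge0 => z _; rewrite lee_fin mulr_ge0.
  apply: eq_bigr => i _; rewrite -integral_nneseries //; last 2 first.
  - move=> n; apply/measurable_EFinP; apply: measurable_funM => //.
    exact: (measurableT_comp (measurable_indic (mF n))).
  - by move=> n z _; rewrite lee_fin mulr_ge0.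
  apply: eq_integral => z _; rewrite EFinM.
  have -> : (\1_(\bigcup_n F n) (phi z))%:E = \sum_(n <oo) (\1_(F n) (phi z))%:E :> \bar R.
    have -> : (\1_(\bigcup_n F n) (phi z))%:E = \d_(phi z) (\bigcup_n F n) :> \bar R.
      by rewrite diracE indicE.
    rewrite measure_bigcup //; rewrite eseries_mkcond; apply: eq_eseriesr => n _.
    by rewrite mem_set // diracE indicE.
  rewrite muleC -nneseriesZl //.
  by apply: eq_eseriesr => n _; rewrite EFinM muleC.
pose M := isMeasure.Build _ _ _ m m0 mge0 msa.
pose mm : {measure set T -> \bar R} := HB.pack m M.
by exists mm.
Qed.

End image_density_measure.

Section walk_law.
Context (R : realType) (G : wgraph R).
Local Notation itinerary := (itinerary R G).
Local Notation leb := (@lebesgue_measure R).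
Local Notation E1 := (@exponential1 R).
Implicit Types (x y : vertex G) (w : itinerary).

Lemma walk_law_setT x : walk_law x setT = 1%E.
Proof.
rewrite -(@hit_prob1 R G x) -[LHS]mul1e -integral_cst // integral_walk_law //.
apply: eq_esum => es _; rewrite [X in (_ * X)%E](_ : _ = 1%E) ?mule1 //.
have := integral_cst (tuple_measure E1 (size es)) measurableT 1.
by rewrite mul1e => I1; apply: (etrans I1); exact: tuple_measure_setT.
Qed.

Lemma walk_law_sigma_finite x : sigma_finite setT (walk_law x).
Proof.
exists (fun=> setT); first by rewrite bigcup_const.
by move=> _; split => //; rewrite walk_law_setT ltry.
Qed.

HB.instance Definition _ x := Measure_isSigmaFinite.Build _ _ _ (walk_law x)
  (@walk_law_sigma_finite x).

Lemma eq_integral_exponential n (H H' : n.-tuple (measurableTypeR R) -> \bar R) :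
  measurable_fun setT H -> measurable_fun setT H' ->
  (forall t, 0 <= H t)%E -> (forall t, 0 <= H' t)%E ->
  (forall t : n.-tuple R, all (fun s => 0 <= s) t -> H t = H' t) ->
  (\int[tuple_measure E1 n]_t H t = \int[tuple_measure E1 n]_t H' t)%E.
Proof.
elim: n H H' => [|n IH] H H' mH mH' H0 H'0 HH'.
  by apply: eq_integral => t _; apply: HH'; rewrite (tuple0 t).
have mc (K : n.+1.-tuple (measurableTypeR R) -> \bar R) :
    measurable_fun setT K -> measurable_fun setT (fun p => K (tcons p)).
  by move=> mK; apply: (measurableT_comp mK); exact: measurable_tcons.
have mF (K : n.+1.-tuple (measurableTypeR R) -> \bar R) :
    measurable_fun setT K -> (forall t, 0 <= K t)%E ->
    measurable_fun setT (fun s => \int[tuple_measure E1 n]_t K (tcons (s, t)))%E.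
  by move=> mK K0; apply: (measurable_fun_fubini_tonelli_F (m2 := tuple_measure exponential1 n)
    (fun p => K (tcons p))) => //; exact: mc.
have F0 (K : n.+1.-tuple (measurableTypeR R) -> \bar R) : (forall t, 0 <= K t)%E ->
    forall s, (0 <= \int[tuple_measure E1 n]_t K (tcons (s, t)))%E.
  by move=> K0 s; apply: integral_ge0.
have E1E (K : n.+1.-tuple (measurableTypeR R) -> \bar R) : measurable_fun setT K ->
    (forall t, 0 <= K t)%E -> (\int[tuple_measure E1 n.+1]_t K t = \int[leb]_(s in `[0%R, +oo[)
      (\int[tuple_measure E1 n]_t K (tcons (s, t)) * (expR (- s))%:E))%E.
  move=> mK K0; rewrite integral_exponential_tupleS //.
  by apply: integral_exponential1; [exact: mF|exact: F0].
rewrite (E1E H) // (E1E H') //.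
apply: eq_integral => s; rewrite inE /= in_itv /= andbT => s0; congr (_ * _)%E.
have ms (K : n.+1.-tuple (measurableTypeR R) -> \bar R) :
    measurable_fun setT K -> measurable_fun setT (fun t => K (tcons (s, t))).
  move=> mK; apply: (measurableT_comp (mc _ mK)); exact: measurable_pair1.
apply: IH => //; do ?exact: ms.
by move=> t t0; apply: HH'; rewrite /= s0.
Qed.

(** Almost sure properties of the walk started at x.  They matter because an itinerary may
    have negative holding times, for which local times are negative. *)
Definition nonneg_from x w := [/\ itin_start w = x, all (fun s => 0 <= s) (itin_times w) & itin_last w = +oo%E].

Lemma eq_integral_walk x (H H' : itinerary -> \bar R) :
  measurable_fun setT H -> measurable_fun setT H' ->
  (forall w, 0 <= H w)%E -> (forall w, 0 <= H' w)%E ->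
  (forall w, nonneg_from x w -> H w = H' w) ->
  (\int[walk_law x]_w H w = \int[walk_law x]_w H' w)%E.
Proof.
move=> mH mH' H0 H'0 HH'; rewrite !integral_walk_law //; apply: eq_esum => es _.
congr (_ * _)%E; apply: eq_integral_exponential => //.
- apply: (measurableT_comp mH); exact: measurable_well_path.
- apply: (measurableT_comp mH'); exact: measurable_well_path.
- move=> t t0; apply: HH'; split => //.
  by rewrite /itin_times /= -/(unzip1 _) unzip1_zip ?size_tuple.
Qed.

Lemma position_stop w (t : R) :
  position w t = last (itin_start w) (map (@tgt G) (itin_edges (stop w t))).
Proof.
case: w => -[x js] l; rewrite /position /stop /itin_start /itin_edges /itin_jumps /=.
elim: js x t => [|[s e] js IH] x t //=; case: ifP => _ //=; exact: IH.
Qed.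

Lemma cost_const (eps : R) w (t : R) : cost (fun=> eps) (stop w t) = eps * t.
Proof.
case: w => -[x js] l; elim: js x t => [|[s e] js IH] x t; first exact: cost_nil.
rewrite /stop /=; case: ifP => _ /=; first exact: cost_nil.
by rewrite cost_cons; move: (IH (tgt e) (t - s)); rewrite /stop /= => ->; ring.
Qed.

Lemma costD (theta theta' : vertex G -> R) w :
  cost (fun x => theta x + theta' x) w = cost theta w + cost theta' w.
Proof. by rewrite /cost -big_split; apply: eq_bigr => y _; rewrite mulrDl. Qed.

Lemma occ_stop_ge0 x y w (t : R) : nonneg_from x w -> 0 <= t -> (0 <= occ y (stop w t))%E.
Proof.
case: w => -[x' js] l [_ + _]; rewrite /itin_times /=.
elim: js x' t => [|[s e] js IH] x' t /=.
  by move=> _ t0; rewrite /stop /= occ_nil lee_fin; case: ifP.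
move=> /andP[s0 js0] t0; rewrite /stop /=; case: ltP => st /=.
  by rewrite occ_nil lee_fin; case: ifP.
rewrite occ_cons adde_ge0 //; first by rewrite lee_fin; case: ifP.
by have := IH (tgt e) (t - s) js0; rewrite subr_ge0 => /(_ st).
Qed.

Lemma occ_stop_fin y w (t : R) : occ y (stop w t) \is a fin_num.
Proof. by case: w => -[x js] l; exact: occ_fin. Qed.

Definition walk_time x : set (itinerary * measurableTypeR R) -> \bar R := (walk_law x \x leb)%E.

HB.instance Definition _ x := Measure.on (walk_time x).

Lemma walk_time_sigma_finite x : sigma_finite setT (walk_time x).
Proof.
have /sigma_finiteP[F [TF ndF Foo]] := sigma_finiteT leb.
exists (fun k => setT `*` F k).
  apply/seteqP; split => // -[w t] _; have : setT t by [].
  by rewrite TF => -[k _ Fk]; exists k.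
move=> k; have [mF Fk] := Foo k; split; first exact: measurableX.
rewrite /walk_time product_measure1E // [X in (X * _)%E](_ : _ = 1%E) ?mul1e //.
exact: walk_law_setT.
Qed.

HB.instance Definition _ x := Measure_isSigmaFinite.Build _ _ _ (walk_time x)
  (@walk_time_sigma_finite x).

Lemma integral_walk_time x (f : itinerary * measurableTypeR R -> \bar R) :
  measurable_fun setT f -> (forall z, 0 <= f z)%E ->
  (\int[walk_time x]_z f z = \int[walk_law x]_w \int[leb]_t f (w, t))%E.
Proof. by move=> mf f0; rewrite /walk_time fubini_tonelli1. Qed.

End walk_law.

(** * The exponent of the Laplace functional of the loops *)

Section half_line.
Context (R : realType).
Local Notation leb := (@lebesgue_measure R).

Lemma integral_half_line (F : R -> \bar R) :
  (\int[leb]_(t in `]0%R, +oo[) F t = \int[leb]_t (if (0 < t)%R then F t else 0))%E.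
Proof.
rewrite integral_mkcond; apply: eq_integral => t _; rewrite patchE.
by rewrite mem_setE in_itv /= andbT.
Qed.

Lemma integral_half_line_expR (c : R) : 0 < c ->
  (\int[leb]_(t in `]0%R, +oo[) (expR (- (c * t)))%:E = (c^-1)%:E)%E.
Proof.
move=> c0; rewrite integral_itv_obnd_cbnd ?integral_expR_0y //.
by apply/measurable_EFinP; exact: measurable_expR_lin.
Qed.

Lemma measurable_gt0 : measurable_fun setT (fun t : measurableTypeR R => 0 < t).
Proof. exact: measurable_fun_ltr. Qed.

Lemma measurable_half_line_inv :
  measurable_fun setT (fun t : measurableTypeR R => if 0 < t then t^-1 else 0).
Proof.
rewrite (_ : (fun t => _) = (fun t : measurableTypeR R => if 0 < t then t `^ (-1) else 0)).
  by apply: measurable_fun_ifT; [exact: measurable_gt0|exact: measurable_powR|exact: measurable_cst].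
by apply/funext => t; case: ifPn => // t0; rewrite powR_inv1 // ltW.
Qed.

End half_line.

Section loop_exponent.
Context (R : realType) (G : wgraph R) (r : nat) (B : bundle R G r) (g : connection B).
Local Notation itinerary := (itinerary R G).
Local Notation leb := (@lebesgue_measure R).
Local Notation Z := (itinerary * measurableTypeR R)%type.
Implicit Types (x y : vertex G) (w : itinerary) (theta : vertex G -> R).
Hypothesis trace_ge0 : forall x es, 0 <= lftrace (holonomy g x es x).

(** On paths this is cost; the maximum makes it nonnegative on all itineraries. *)
Definition potential theta w : \bar R := (\sum_y (theta y)%:E * maxe 0 (occ y w))%E.

Lemma measurable_potential theta : measurable_fun setT (potential theta).
Proof.
apply: emeasurable_sum => y; apply: measurable_funeM.
by apply: measurable_maxe => //; exact: measurable_occ.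
Qed.

Lemma potential_ge0 theta w : (forall x, 0 <= theta x) -> (0 <= potential theta w)%E.
Proof.
by move=> theta0; apply: sume_ge0 => y _; rewrite mule_ge0 ?lee_fin // le_max lexx.
Qed.

Lemma potential_stop theta x w t : nonneg_from x w -> 0 <= t ->
  potential theta (stop w t) = (cost theta (stop w t))%:E.
Proof.
move=> gw t0; rewrite /potential /cost -sumEFin; apply: eq_bigr => y _.
rewrite [RHS]EFinM fineK ?occ_stop_fin //; congr (_ * _)%E.
by apply/max_idPr/(occ_stop_ge0 y gw t0).
Qed.

(** The density of the loop intensity with respect to walk_time x.  If the walk is not at
    x at time z.2 then the holonomy from x to x, and with it half_trace, is 0. *)
Definition loop_weight x (z : Z) : R :=
  half_trace g x (itin_edges (stop z.1 z.2)) * (if 0 < z.2 then z.2^-1 else 0).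

Lemma measurable_half_trace_stop x :
  measurable_fun setT (fun z : Z => half_trace g x (itin_edges (stop z.1 z.2))).
Proof.
exact: (measurableT_comp (measurable_fun_skeleton (fun s => half_trace g x s.2)) (@measurable_stop R G)).
Qed.

Lemma measurable_loop_weight x : measurable_fun setT (loop_weight x).
Proof.
apply: measurable_funM; first exact: measurable_half_trace_stop.
exact: (measurableT_comp (@measurable_half_line_inv R) measurable_snd).
Qed.

Lemma loop_weight_ge0 x z : 0 <= loop_weight x z.
Proof.
by rewrite mulr_ge0 ?half_trace_ge0 //; case: ifP => // /ltW; rewrite invr_ge0.
Qed.

Section exponent.
Variable theta : vertex G -> R.
Hypothesis theta0 : forall x, 0 <= theta x.

Let A (z : Z) : R := 1 - expNe (potential theta (stop z.1 z.2)).

Let A0 z : 0 <= A z.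
Proof. by rewrite subr_ge0 expNe_le1 // potential_ge0. Qed.

Let mA : measurable_fun setT A.
Proof.
apply: measurable_funB => //; apply: measurable_expNe.
exact: (measurableT_comp (measurable_potential theta) (@measurable_stop R G)).
Qed.

(** Replacing 1 / t by the integral of exp(- eps t) over eps > 0 turns the integrand into a
    difference of two weights. *)
Let K x (p : Z * measurableTypeR R) : R := if (0 < p.1.2) && (0 < p.2) then
  A p.1 * half_trace g x (itin_edges (stop p.1.1 p.1.2)) * expR (- (p.2 * p.1.2)) else 0.

Let K0 x p : 0 <= K x p.
Proof. by rewrite /K; case: ifP => // _; rewrite !mulr_ge0 ?expR_ge0 ?half_trace_ge0. Qed.

Let mK x : measurable_fun setT (K x).
Proof.
apply: measurable_fun_if => //.
- apply: measurable_and.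
    exact: (measurableT_comp (@measurable_gt0 R) (measurableT_comp measurable_snd measurable_fst)).
  exact: (measurableT_comp (@measurable_gt0 R) measurable_snd).
- apply: measurable_funTS; apply: measurable_funM.
    apply: measurable_funM; first exact: (measurableT_comp mA measurable_fst).
    exact: (measurableT_comp (measurable_half_trace_stop x) measurable_fst).
  apply: measurableT_comp => //; apply: measurableT_comp => //; apply: measurable_funM => //.
  exact: (measurableT_comp measurable_snd measurable_fst).
Qed.

Lemma integral_loop_weight x :
  (\int[walk_time x]_z ((A z)%:E * (loop_weight x z)%:E) =
   \int[leb]_e \int[walk_time x]_z (K x (z, e))%:E)%E.
Proof.
rewrite -(@fubini_tonelli _ _ _ _ _ (walk_time x) leb (fun p => (K x p)%:E)) //; last 2 first.
- exact/measurable_EFinP.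
- by move=> p; rewrite lee_fin.
apply: eq_integral => z _; rewrite /K /loop_weight -EFinM /=.
have [t0|t0] := boolP (0 < z.2); last first.
  by rewrite !mulr0; symmetry; apply: integral0_eq => e _; rewrite andFb.
rewrite mulrA EFinM -(integral_half_line_expR t0) -ge0_integralZl_EFin //; last 2 first.
- by apply/measurable_EFinP; exact: measurable_expR_lin.
- by rewrite mulr_ge0 ?half_trace_ge0.
rewrite integral_half_line; apply: eq_integral => e _; case: ifP => // _.
by rewrite -EFinM (mulrC e).
Qed.

(** For a walk with nonnegative holding times, A times exp(- eps t) is the difference of
    the weights for the killing rates eps and eps + theta; a sum of integrals, unlike a
    difference, makes sense even if they are infinite. *)
Lemma integral_decay_green x (e : R) : 0 < e ->
  (\int[walk_time x]_z (K x (z, e))%:E + green (fun y => e + theta y)%R (half_trace g x) x =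
   green (fun=> e) (half_trace g x) x)%E.
Proof.
move=> e0; have q0 es : 0 <= half_trace g x es by exact: half_trace_ge0.
pose k (z : Z) := A z * half_trace g x (itin_edges (stop z.1 z.2)) * expR (- (e * z.2)).
have k0 z : 0 <= k z by rewrite !mulr_ge0 ?expR_ge0.
have mk : measurable_fun setT k.
  apply: measurable_funM; first by apply: measurable_funM => //; exact: measurable_half_trace_stop.
  apply: measurableT_comp => //; apply: measurableT_comp => //.
  exact: measurable_funM.
have mE (f : Z -> R) : measurable_fun setT f -> (forall z, 0 <= f z) ->
    measurable_fun setT (fun w => \int[leb]_(t in `]0%R, +oo[) (f (w, t))%:E)%E.
  move=> mf f0; apply: (@measurable_integral_lebesgue R _ _ (fun z => (f z)%:E)) => //.
  exact/measurable_EFinP.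
have I0 (f : Z -> R) w : (forall z, 0 <= f z) ->
    (0 <= \int[leb]_(t in `]0%R, +oo[) (f (w, t))%:E)%E.
  by move=> f0; apply: integral_ge0 => t _; rewrite lee_fin.
pose W th (z : Z) := weight th (half_trace g x) (stop z.1 z.2).
have mW th : measurable_fun setT (W th) by exact: measurable_weight_stop.
have W0 th z : 0 <= W th z by exact: weight_ge0.
have -> : (\int[walk_time x]_z (K x (z, e))%:E =
    \int[walk_law x]_w \int[leb]_(t in `]0%R, +oo[) (k (w, t))%:E)%E.
  rewrite integral_walk_time //; last 2 first.
  - apply/measurable_EFinP; apply: (measurableT_comp (mK x)); exact: measurable_pair2.
  - by move=> z; rewrite lee_fin.
  apply: eq_integral => w _; rewrite integral_half_line; apply: eq_integral => t _.
  by rewrite /K /= e0 andbT; case: ifP.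
rewrite /green -(@ge0_integralD _ _ _ (walk_law x) setT measurableT
  (fun w => \int[leb]_(t in `]0%R, +oo[) (k (w, t))%:E)%E
  (fun w => \int[leb]_(t in `]0%R, +oo[) (W (fun y => e + theta y) (w, t))%:E)%E); last 4 first.
- by move=> w _; exact: I0.
- exact: mE.
- by move=> w _; exact: I0.
- exact: mE.
apply: eq_integral_walk.
- by apply: emeasurable_funD; exact: mE.
- exact: (mE (W (fun=> e))).
- by move=> w; rewrite adde_ge0 ?I0.
- by move=> w; exact: (I0 (W (fun=> e))).
move=> w gw; rewrite -ge0_integralD //; last 4 first.
- by move=> t _; rewrite lee_fin.
- by apply/measurable_EFinP; apply: measurable_funTS; apply: (measurableT_comp mk); exact: measurable_pair1.
- by move=> t _; rewrite lee_fin.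
- by apply/measurable_EFinP; apply: measurable_funTS; apply: (measurableT_comp (mW _)); exact: measurable_pair1.
apply: eq_integral => t; rewrite inE /= in_itv /= andbT => t0.
rewrite -EFinD /k /W /weight /A /= (potential_stop _ gw (ltW t0)) expNe_EFin.
rewrite costD cost_const opprD expRD; congr EFin; ring.
Qed.

Local Notation resolvent_trace th e :=
  (\tr (invmx (e%:M + (killing_mx r th - jump_mx g)))).

Lemma killing_shift e th : killing_mx r (fun y => e + th y) = e%:M + killing_mx (G := G) r th.
Proof.
rewrite -(index_mx_scalar _ e); apply/matrixP => a b; rewrite !mxE /diag_index.
by rewrite -mulrDr addrCA.
Qed.

Let zero_ge0 (x : vertex G) : 0 <= (0 : R). Proof. by []. Qed.

Let det_gt0 th e : (forall x, 0 <= th x) -> 0 <= e ->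
  0 < \det (e%:M + (killing_mx r th - jump_mx g)).
Proof.
move=> th0 e0; rewrite addrA -killing_shift; apply: det_killing_gt0 => x.
by rewrite addr_ge0.
Qed.

Lemma green_resolvent th (e : R) : (forall x, 0 <= th x) -> 0 < e ->
  (\sum_(x | x \notin well G) green (fun y => e + th y)%R (half_trace g x) x =
   (2^-1 * resolvent_trace th e)%R%:E)%E.
Proof.
move=> th0 e0; have ge x : e <= e + th x by rewrite lerDl.
have u : killing_mx r (fun y => e + th y) - jump_mx g \in unitmx.
  by rewrite unitmxE unitfE gt_eqF // det_killing_gt0 // => x; rewrite addr_ge0 // ltW.
by rewrite (green_trace e0 ge trace_ge0 u) killing_shift addrA.
Qed.

Let D e := (\sum_(x | x \notin well G) \int[walk_time x]_z (K x (z, e))%:E)%E.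

Let D0 e : (0 <= D e)%E.
Proof. by apply: sume_ge0 => x _; apply: integral_ge0 => z _; rewrite lee_fin. Qed.

Let ereal_sub (a : \bar R) (s t : R) : (a + s%:E = t%:E)%E -> a = (t - s)%:E.
Proof. by case: a => [b| |] //= [<-]; rewrite addrK. Qed.

Let DE e : 0 < e -> D e = (2^-1 * (resolvent_trace (fun=> 0) e - resolvent_trace theta e))%:E.
Proof.
move=> e0; have h1 := green_resolvent zero_ge0 e0; have h2 := green_resolvent theta0 e0.
have e00 : (fun y : vertex G => e + 0) = (fun=> e) by apply/funext => y; rewrite addr0.
rewrite e00 in h1.
rewrite mulrBr; apply: ereal_sub; rewrite -h1 -h2.
rewrite /D -big_split.
apply: eq_bigr => x _.
exact: integral_decay_green.
Qed.

(** By Tonelli the integral over eps comes last.  For fixed eps, the sum over x is half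
    the difference of the traces of the resolvents for the killing rates 0 and theta, and
    these traces are compared by the positivity of that sum. *)
Lemma loop_exponent :
  (\sum_(x | x \notin well G) \int[walk_time x]_z
     ((1 - expNe (potential theta (stop z.1 z.2)))%R%:E * (loop_weight x z)%:E) =
   (2^-1 * ln (\det (killing_mx r theta - jump_mx g) /
               \det (killing_mx r (fun=> 0) - jump_mx g)))%R%:E)%E.
Proof.
have mx x : measurable_fun setT (fun e => \int[walk_time x]_z (K x (z, e))%:E)%E.
  apply: (measurable_fun_fubini_tonelli_G (m1 := walk_time x) (fun p => (K x p)%:E)).
  - exact/measurable_EFinP.
  - by move=> p; rewrite lee_fin.
have mD : measurable_fun setT D.
  rewrite (_ : D = fun e => \sum_(x <- [seq x <- index_enum (vertex G) | x \notin well G])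
    \int[walk_time x]_z (K x (z, e))%:E)%E; last by apply/funext => e; rewrite big_filter.
  exact: emeasurable_sum.
transitivity (\int[leb]_e D e)%E.
  under eq_bigr do rewrite integral_loop_weight.
  rewrite -big_filter -ge0_integral_sum //.
    by apply: eq_integral => e _; rewrite big_filter.
  by move=> x e _; apply: integral_ge0 => z _; rewrite lee_fin.
have AB e : 0 < e -> resolvent_trace theta e <= resolvent_trace (fun=> 0) e.
  move=> e0; have := D0 e; rewrite DE // lee_fin pmulr_rge0 ?invr_gt0 //.
  by rewrite subr_ge0.
have := integral_trace_resolvent (fun e => @det_gt0 _ e zero_ge0) (fun e => @det_gt0 _ e theta0) AB.
set T := ln _; set I2 := integral _ _ _ => I2E.
suff : (I2 = 2%:E * \int[leb]_e D e)%E.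
  rewrite I2E; set J := (\int[leb]_e D e)%E.
  have : (0 <= J)%E by exact: integral_ge0.
  case: J => [j| |] //=; last by rewrite mulry gtr0_sg ?mul1e.
  by move=> _ [->]; rewrite mulKf.
rewrite -ge0_integralZl_EFin //.
transitivity (\int[leb]_(e in `]0%R, +oo[) (2%:E * D e))%E.
  apply: eq_integral => e; rewrite inE /= in_itv /= andbT => e0.
  by rewrite DE // -EFinM mulrA divff ?mul1r.
rewrite integral_half_line; apply: eq_integral => e _; case: ifPn => // e0.
rewrite /D big1 ?mule0 // => x _; apply: integral0_eq => z _.
by rewrite /K (negPf e0) andbF.
Qed.

End exponent.
End loop_exponent.

(** * The Laplace transform of the Gaussian field *)

Section gaussian_laplace.
Context (R : realType) (G : wgraph R) (r : nat) (B : bundle R G r) (g : connection B).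
Local Notation I := (proper_vertex G * 'I_r)%type.
Local Notation tuples := (#|{: I}|.-tuple (measurableTypeR R)).
Local Notation lebt := (tuple_measure (@lebesgue_measure R) #|{: I}|).
Context d (Omega : measurableType d) (P : probability Omega R)
  (Phi : Omega -> forall x, B x).
Hypothesis GF : gaussian_free_field g P Phi.
Implicit Types (x : vertex G) (theta : vertex G -> R).

Let n2 (f : forall x, B x) x := edot (B x) (f x) (f x).

Lemma measurable_norm2 x : measurable_fun setT (fun c : tuples => n2 (section_of_coord B c) x).
Proof.
rewrite (_ : (fun c => _) = fun c => quad (index_mx
   (fun p q => (val p.1 == x)%:R * gram B p q)) (tnth c)); first exact: measurable_quad.
apply/funext => c; rewrite quad_index_mx.
rewrite (@gram_form R G r B (fun y => (y == x)%:R) (fun p => tnth c (enum_rank p))).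
rewrite (bigD1 x) //= eqxx mul1r big1 ?addr0 // => y /negPf ->.
by rewrite mul0r.
Qed.

Lemma measurable_energy :
  measurable_fun setT (fun c : tuples => dirichlet_energy g (section_of_coord B c)).
Proof.
rewrite (_ : (fun c => _) = fun c => 2^-1 * quad (energy_mx g (fun=> 0)) (tnth c)).
  by apply: measurable_funM => //; exact: measurable_quad.
apply/funext => c; rewrite energy_mx_quad big1 => [|x _]; last by rewrite mulr0 mul0r.
by rewrite addr0 mulKf.
Qed.

Lemma measurable_field_norm x : measurable_fun setT (fun w => n2 (Phi w) x).
Proof.
have [C [mC CE] _] := GF; rewrite (_ : (fun w => _) = (fun w => n2 (section_of_coord B (C w)) x)).
  exact: (measurableT_comp (measurable_norm2 x) mC).
by apply/funext => w; rewrite /n2 CE.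
Qed.

(** The normalizing constant z is determined by the case theta = 0, in which the left-hand
    side is the total mass. *)
Lemma gaussian_laplace theta : (forall x, 0 <= theta x) ->
  (\int[P]_w (expR (- (2^-1 * \sum_x lambda x * theta x * n2 (Phi w) x)))%:E =
   (Num.sqrt (\det (killing_mx r (fun=> 0) - jump_mx g)) /
    Num.sqrt (\det (killing_mx r theta - jump_mx g)))%:E)%E.
Proof.
move=> theta0; have [C [mC CE] [z PE]] := GF.
pose E (c : tuples) := dirichlet_energy g (section_of_coord B c).
have I0 := integral_gaussian_field g (fun x : vertex G => lexx (0 : R)).
have I1 := integral_gaussian_field g theta0.
have s0 : 0 < Num.sqrt (\det (killing_mx r (fun=> 0) - jump_mx g)).
  by rewrite sqrtr_gt0 det_killing_gt0.
have c0 := gauss_norm_gt0 B; set k := gauss_norm B in I0 I1 c0.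
have IE : (\int[lebt]_c (expR (- E c))%:E =
    (k / Num.sqrt (\det (killing_mx r (fun=> 0) - jump_mx g)))%:E)%E.
  rewrite -I0; apply: eq_integral => c _; congr (expR (- _))%:E.
  by rewrite big1 ?mulr0 ?addr0 // => x _; rewrite mulr0 mul0r.
have zE : z = Num.sqrt (\det (killing_mx r (fun=> 0) - jump_mx g)) / k.
  have := PE setT measurableT; rewrite preimage_setT IE -EFinM => P1.
  have {}P1 : z * (k / Num.sqrt (\det (killing_mx r (fun=> 0) - jump_mx g))) = 1.
    by apply: EFin_inj; rewrite -P1; exact: probability_setT.
  have kN0 : k / Num.sqrt (\det (killing_mx r (fun=> 0) - jump_mx g)) != 0.
    by rewrite gt_eqF // divr_gt0.
  by apply: (mulIf kN0); rewrite P1 mulrA divfK ?divff // gt_eqF.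
have z0 : 0 <= z by rewrite zE divr_ge0 ?ltW.
have mS (f : tuples -> R) : measurable_fun setT f -> measurable_fun setT (fun c => expR (- f c)).
  by move=> mf; apply: measurableT_comp => //; exact: measurableT_comp.
have mE : measurable_fun setT (fun c => z * expR (- E c)).
  by apply: measurable_funM => //; apply: mS; exact: measurable_energy.
have mN : measurable_fun setT (fun c : tuples => 2^-1 * \sum_x lambda x * theta x * n2 (section_of_coord B c) x).
  apply: measurable_funM => //; apply: measurable_sum => x.
  by apply: measurable_funM => //; exact: measurable_norm2.
pose N (c : tuples) := 2^-1 * \sum_x lambda x * theta x * n2 (section_of_coord B c) x.
have F0 c : (0 <= (expR (- N c))%:E)%E by rewrite lee_fin expR_ge0.
have mF : measurable_fun setT (fun c => (expR (- N c))%:E) by apply/measurable_EFinP; exact: mS.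
have -> : (\int[P]_w (expR (- (2^-1 * \sum_x lambda x * theta x * n2 (Phi w) x)))%:E =
    \int[pushforward P C]_c (expR (- N c))%:E)%E.
  rewrite (ge0_integral_pushforward mC) // preimage_setT; apply: eq_integral => w _ /=.
  congr (expR (- (_ * _)))%:E; apply: eq_bigr => x _; congr (_ * _).
  by rewrite /n2 CE.
pose m := measure_function_pushforward__canonical__measure_function_Measure P mC.
rewrite (@integral_image_density _ _ tuples tuples R unit [:: tt] xpredT m (fun=> lebt) idfun
  (fun _ c => z * expR (- E c))) //; last 2 first.
- by move=> _ c; rewrite mulr_ge0 ?expR_ge0.
- move=> A mA; rewrite big_seq1 -[LHS]/(P (C @^-1` A)) PE // -ge0_integralZl_EFin //.
    rewrite [LHS]integral_mkcond; apply: eq_integral => c _.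
    by rewrite epatch_indic -!EFinM mulrC.
  by apply/measurable_EFinP; apply: measurable_funTS; apply: mS; exact: measurable_energy.
rewrite big_seq1; transitivity (z%:E * (k / Num.sqrt (\det (killing_mx r theta - jump_mx g)))%:E)%E.
  rewrite -I1 -ge0_integralZl_EFin //.
  + by apply: eq_integral => c _; rewrite -!EFinM mulrCA -expRD -opprD (addrC (N c)).
  + by apply/measurable_EFinP; apply: mS; apply: measurable_funD => //; exact: measurable_energy.
rewrite -EFinM zE; congr EFin.
  by field; rewrite !gt_eqF // sqrtr_gt0 det_killing_gt0.
exact: measurable_id.
Qed.

End gaussian_laplace.

(** * The Laplace transform of the occupation field *)

Section main.
Context (R : realType) (G : wgraph R) (r : nat) (F : bundle R G r) (h : connection F).
Local Notation itinerary := (itinerary R G).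
Local Notation leb := (@lebesgue_measure R).
Local Notation g := (end_connection h).
Implicit Types (x y : vertex G) (w : itinerary) (s : proper_vertex G -> nat).

Lemma trace_end_ge0 x es : 0 <= lftrace (holonomy g x es x).
Proof. by rewrite lftrace_holonomy_end sqr_ge0. Qed.

(** Almost every walk starts at x; the condition that it be at x at the time t is implied
    by the holonomy from x to x being nonzero. *)
Lemma loop_intensityE A : measurable A -> loop_intensity h A =
  (\sum_(x | x \notin well G) \int[walk_time x]_z (\1_A (stop z.1 z.2) * loop_weight g x z)%:E)%E.
Proof.
move=> mA; apply: eq_bigr => x xW.
pose f1 (p : itinerary * measurableTypeR R) : R := \1_A (stop p.1 p.2) *
  (2^-1 * loop_trace h (stop p.1 p.2) ^+ 2) * (if position p.1 p.2 == x then
   (if 0 < p.2 then p.2^-1 else 0) else 0).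
pose f2 (p : itinerary * measurableTypeR R) : R := \1_A (stop p.1 p.2) * loop_weight g x p.
have mI : measurable_fun setT (fun p : itinerary * measurableTypeR R => \1_A (stop p.1 p.2) : R).
  exact: (measurableT_comp (measurable_indic mA) (@measurable_stop R G)).
have m2 : measurable_fun setT f2.
  by apply: measurable_funM => //; exact: measurable_loop_weight.
have mT : measurable_fun setT (fun t : measurableTypeR R => if 0 < t then t^-1 else 0 : R).
  exact: (@measurable_half_line_inv R).
have m1 : measurable_fun setT f1.
  apply: measurable_funM.
    apply: measurable_funM => //.
    apply: (measurableT_comp (measurable_fun_skeleton (fun q : vertex G * seq (edge G) =>
      2^-1 * lftrace (holonomy h q.1 q.2 q.1) ^+ 2)) (@measurable_stop R G)).
  apply: measurable_fun_ifT; last exact: measurable_cst.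
    rewrite (_ : (fun p => _) = (fun p : itinerary * measurableTypeR R =>
       (fun q : vertex G * seq (edge G) => last q.1 (map (@tgt G) q.2) == x)
         (skeleton (stop p.1 p.2)))).
      exact: (measurableT_comp (measurable_fun_skeleton (fun q : vertex G * seq (edge G) =>
         last q.1 (map (@tgt G) q.2) == x)) (@measurable_stop R G)).
    by apply/funext => p; rewrite position_stop.
  exact: (measurableT_comp mT measurable_snd).
have f10 p : 0 <= f1 p.
  rewrite /f1 mulr_ge0 //; first by rewrite mulr_ge0 // mulr_ge0 ?sqr_ge0.
  have [_|//] := boolP (position p.1 p.2 == x); have [/ltW|//] := boolP (0 < p.2).
  by rewrite invr_ge0.
have f20 p : 0 <= f2 p by rewrite mulr_ge0 // loop_weight_ge0 // => *; exact: trace_end_ge0.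
transitivity (\int[walk_law x]_w \int[leb]_(t in `]0%R, +oo[) (f1 (w, t))%:E)%E.
  apply: eq_integral => w _; apply: eq_integral => t; rewrite inE /= in_itv /= andbT => t0.
  by rewrite /f1 /= t0 -EFinM.
have mE (f : itinerary * measurableTypeR R -> R) : measurable_fun setT f -> (forall p, 0 <= f p) ->
    measurable_fun setT (fun w => \int[leb]_(t in `]0%R, +oo[) (f (w, t))%:E)%E.
  move=> mf f0; apply: (@measurable_integral_lebesgue R _ _ (fun p => (f p)%:E)) => //.
  exact/measurable_EFinP.
transitivity (\int[walk_law x]_w \int[leb]_(t in `]0%R, +oo[) (f2 (w, t))%:E)%E.
  apply: eq_integral_walk; [exact: mE|exact: mE| | |].
  - by move=> w; apply: integral_ge0 => t _; rewrite lee_fin.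
  - by move=> w; apply: integral_ge0 => t _; rewrite lee_fin.
  move=> w [wx _ _]; apply: eq_integral => t; rewrite inE /= in_itv /= andbT => t0.
  rewrite /f1 /f2 /loop_weight /half_trace /= t0 -mulrA; congr (_ * _)%:E.
  have sx : itin_start (stop w t) = x by [].
  rewrite lftrace_holonomy_end /loop_trace sx position_stop wx.
  case: eqP => // /eqP px; rewrite holonomy_end // lftrace0 expr0n /= !mulr0 mul0r //.
rewrite integral_walk_time; last 2 first.
- exact/measurable_EFinP.
- by move=> z; rewrite lee_fin; exact: f20.
apply: eq_integral => w _; rewrite integral_half_line; apply: eq_integral => t _.
case: ifPn => // t0.
by rewrite /f2 /loop_weight /= (negPf t0) !mulr0.
Qed.

(** The local time at x is the time spent at x divided by lambda x. *)
Definition killing_rate s x : R := if insub x is Some z then (s z)%:R / lambda x else 0.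

Lemma killing_rate_ge0 s x : 0 <= killing_rate s x.
Proof. by rewrite /killing_rate; case: insubP => // z _ _; rewrite divr_ge0 ?lambda_ge0. Qed.

Lemma sum_killing_rate s (a : vertex G -> R) :
  \sum_x lambda x * killing_rate s x * a x = \sum_z (s z)%:R * a (val z).
Proof.
rewrite (bigID (fun x => x \notin well G)) /= [X in _ + X]big1 ?addr0; last first.
  by move=> x xW; rewrite /killing_rate insubN // mulr0 mul0r.
rewrite sum_proper_vertex; apply: eq_bigr => z _; rewrite /killing_rate valK.
by rewrite mulrCA divff ?mulr1 // gt_eqF // lambda_gt0.
Qed.

Lemma expNeMn (y : \bar R) n : (0 <= y)%E -> expNe (n%:R%:E * y) = expNe y ^+ n.
Proof.
move=> y0; elim: n => [|n IH]; first by rewrite mul0e expNe0 expr0.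
rewrite -natr1 EFinD ge0_muleDl ?lee_fin // mul1e expNeD ?mule_ge0 ?lee_fin //.
by rewrite IH exprSr.
Qed.

Lemma expNe_combination s (Y : proper_vertex G -> \bar R) : (forall z, 0 <= Y z)%E ->
  \prod_z expNe (Y z) ^+ s z = expNe (\sum_z (s z)%:R%:E * Y z)%E.
Proof.
move=> Y0; rewrite expNe_sum => [|z]; last by rewrite mule_ge0 ?lee_fin.
by apply: eq_bigr => z _; rewrite expNeMn.
Qed.

Lemma visits_ge0 w : cloop w -> forall v, v \in visits w -> (0 <= v.2)%E.
Proof.
case: w => -[x js] l [[_ + l0] _]; rewrite /itin_times /visits /= => js0.
have {}l0 : (0 < l)%E by [].
rewrite /itin_start /itin_jumps /=.
elim: js x js0 => [|[t e] js IH] x /=.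
  by move=> _ v; rewrite inE => /eqP -> /=; exact: ltW.
move=> /andP[t0 js0] v; rewrite inE => /predU1P[-> /=|]; first by rewrite lee_fin ltW.
exact: IH.
Qed.

Lemma occ_cloop_ge0 y w : cloop w -> (0 <= occ y w)%E.
Proof.
by move=> /visits_ge0 wl; rewrite /occ big_seq_cond; apply: sume_ge0 => v /andP[/wl].
Qed.

Lemma potential_cloop s w : cloop w ->
  potential (killing_rate s) w = (\sum_z (s z)%:R%:E * local_time (val z) w)%E.
Proof.
move=> wl; rewrite /potential (bigID (fun x => x \notin well G)) /= [X in (_ + X)%E]big1 ?adde0; last first.
  by move=> x xW; rewrite /killing_rate insubN // mul0e.
rewrite (big_sub [pred x | x \notin well G] (fun y => (killing_rate s y)%:E * maxe 0 (occ y w))%E).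
apply: eq_bigr => z _; rewrite /killing_rate valK (max_idPr (occ_cloop_ge0 _ wl)).
by rewrite EFinM -muleA.
Qed.

Context (d' : measure_display) (Omega' : measurableType d')
    (P' : probability Omega' R) (L : Omega' -> set itinerary).
Hypothesis L_loop : forall omega, L omega `<=` @cloop R G.
Hypothesis PP : poisson_process P' (loop_intensity h) L.

Lemma local_time_cloop_ge0 y w : cloop w -> (0 <= local_time y w)%E.
Proof.
by move=> wl; rewrite mule_ge0 ?lee_fin ?invr_ge0 ?lambda_ge0 //; exact: occ_cloop_ge0.
Qed.

Lemma occupation_ge0 omega y : (0 <= occupation (L omega) y)%E.
Proof. by apply: esum_ge0 => w /L_loop; exact: local_time_cloop_ge0. Qed.

Lemma measurable_occupation y : measurable_fun setT (fun omega => occupation (L omega) y).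
Proof.
rewrite (_ : (fun omega => _) = fun omega => (\esum_(w in L omega) maxe 0 (local_time y w))%E).
  apply: (measurable_esum PP) => [|w]; last by rewrite le_max lexx.
  by apply: measurable_maxe => //; exact: measurable_local_time.
apply/funext => omega; apply: eq_esum => w /L_loop wl.
by rewrite (max_idPr _) // local_time_cloop_ge0.
Qed.

(** All loops of L are paths, on which potential is the combination of local times with
    coefficients s; the Laplace functional and loop_exponent then give the result, since
    exp(- ln (D / D0) / 2) is the square root of D0 / D. *)
Lemma laplace_occupation s :
  (\int[P']_omega (\prod_z expNe (occupation (L omega) (val z)) ^+ s z)%:E =
   (Num.sqrt (\det (killing_mx (r * r) (fun=> 0) - jump_mx g)) /
    Num.sqrt (\det (killing_mx (r * r) (killing_rate s) - jump_mx g)))%:E)%E.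
Proof.
have th0 x : 0 <= killing_rate s x by exact: killing_rate_ge0.
have [m mE] := @image_density_measure _ _ itinerary (itinerary * measurableTypeR R)%type R
  (vertex G) (index_enum _) (fun x => x \notin well G) (fun x => walk_time x)
  (fun z => stop z.1 z.2) (loop_weight g) (@measurable_stop R G)
  (fun x => measurable_loop_weight g x) (fun x z => loop_weight_ge0 trace_end_ge0 x z).
have nuE A : measurable A -> loop_intensity h A = m A.
  by move=> mA; rewrite loop_intensityE // mE.
have mpot : measurable_fun setT (@potential R G (killing_rate s)) by exact: measurable_potential.
have pot0 w : (0 <= potential (killing_rate s) w)%E by exact: potential_ge0.
transitivity (\int[P']_omega (expNe (\esum_(w in L omega) potential (killing_rate s) w))%:E)%E.
  apply: eq_integral => omega _; congr EFin.
  rewrite expNe_combination => [|z]; last exact: occupation_ge0.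
  congr expNe; rewrite (eq_esum (fun w wL => potential_cloop s (L_loop wL))) esum_sum //.
    apply: eq_bigr => z _; set y := \val z.
    have ltE w : L omega w -> local_time y w = (maxe 0 (local_time y w))%E.
      by move=> /L_loop wl; apply/esym/max_idPr/local_time_cloop_ge0.
    rewrite /occupation (eq_esum ltE) -esumZl // => [|w]; last by rewrite le_max lexx.
    by apply: eq_esum => w wL; rewrite -ltE.
  by move=> w z /L_loop wl _; rewrite mule_ge0 ?lee_fin ?local_time_cloop_ge0.
rewrite (laplace_poisson PP nuE) //.
rewrite (integral_image_density (@measurable_stop R G) (fun x => measurable_loop_weight g x)
  (fun x z => loop_weight_ge0 trace_end_ge0 x z) mE); last 2 first.
- by apply/measurable_EFinP; apply: measurable_funB => //; exact: measurable_expNe.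
- by move=> w; rewrite lee_fin subr_ge0 expNe_le1.
rewrite (loop_exponent trace_end_ge0 th0) expNe_EFin.
have d0 : 0 < \det (killing_mx (r * r) (fun=> 0) - jump_mx g) by apply: det_killing_gt0.
have ds : 0 < \det (killing_mx (r * r) (killing_rate s) - jump_mx g) by apply: det_killing_gt0.
move: d0 ds; set D0 := \det _; set Ds := \det _ => d0 ds; congr EFin.
have sq (a : R) : 0 < a -> expR (2^-1 * ln a) = Num.sqrt a.
  move=> a0; apply/eqP; rewrite -(@eqrXn2 _ 2) ?expR_ge0 ?sqrtr_ge0 // sqr_sqrtr ?ltW //.
  by rewrite -expRM_natl mulrA divff ?mul1r ?lnK.
by rewrite ln_div // mulrBr opprB expRD expRN !sq.
Qed.

End main.

Theorem theorem2 (R : realType) (G : wgraph R) (r : nat) (F : bundle R G r)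
    (h : connection F)
    (d : measure_display) (Omega : measurableType d) (P : probability Omega R)
    (Psi : Omega -> forall x : vertex G, 'End(F x))
    (d' : measure_display) (Omega' : measurableType d')
    (P' : probability Omega' R) (L : Omega' -> set (itinerary R G)) :
  gaussian_free_field (end_connection h) P Psi ->
  (forall omega, L omega `<=` @cloop R G) ->
  poisson_process P' (loop_intensity h) L ->
  same_law
    P (fun omega (x : proper_vertex G) =>
         (2^-1 * lftrace (adjoint (Psi omega (val x)) \o Psi omega (val x))%VF)%:E)
    P' (fun omega (x : proper_vertex G) => occupation (L omega) (val x)).
Proof.
move=> GF L_loop PP.
pose n2 omega x := edot (end_bundle F x) (Psi omega x) (Psi omega x).
have n20 omega x : 0 <= n2 omega x by exact: edot_ge0.
apply: laplace_same_law.
- move=> z; apply/measurable_EFinP; apply: measurable_funM => //.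
  exact: (measurable_field_norm GF).
- by move=> z; exact: (measurable_occupation L_loop PP).
- by move=> omega z; rewrite lee_fin mulr_ge0 //; exact: n20.
- by move=> omega z; exact: (occupation_ge0 L_loop).
move=> s; rewrite (laplace_occupation L_loop PP s) -(gaussian_laplace GF (killing_rate_ge0 s)).
apply: eq_integral => omega _; congr EFin.
rewrite (sum_killing_rate s (n2 omega)) mulr_sumr -sumrN expR_sum.
apply: eq_bigr => z _; rewrite expNe_EFin -expRM_natl; congr expR.
by rewrite mulrN mulrCA.
Qed.
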